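(* Let $I$ be a nonzero proper ideal in a Dedekind domain $D$. There exists a Dedekind domain $E$ having the following properties: (i) $E$ is a finite separable integral extension of $D$; and (ii) there exist a radical ideal $J$ of $E$ and a positive integer $m$ such that $IE = J^m$. Therefore $J$ is a projectively full radical ideal that is projectively equivalent to $IE$, and the Rees integers of $J$ are all equal to one. The extension $E$ also has the property that for each maximal ideal $N$ of $E$ with $I\subseteq N$, the canonical inclusion $D/(N\cap D)\hookrightarrow E/N$ is an isomorphism, and $m$ is a multiple of $[E_{(0)}:D_{(0)}]$, where $E_{(0)}$ and $D_{(0)}$ denote the quotient fields of $E$ and $D$.
   Context: All rings are commutative with $1\neq 0$. $K_a$ denotes the integral closure in the ring of an ideal $K$ of that ring. Extensions: a finite separable integral extension of a domain $D$ is an integral domain $E\supseteq D$ that is integral over $D$, finitely generated as a $D$-module, and whose quotient field is a separable algebraic extension of the quotient field of $D$. Rees valuation rings: for a nonzero proper ideal $I$ of a Noetherian domain $R$ with quotient field $F$, let $\mathbf{R}=R[t^{-1},It]$ ($t$ an indeterminate) and let $\mathbf{R}'$ be its integral closure in its quotient field. $\operatorname{Rees} I$ is the finite set of rank one discrete valuation rings $V=\mathbf{R}'_p\cap F$, where $p$ ranges over the minimal primes of $t^{-1}\mathbf{R}'$; its members are the Rees valuation rings of $I$. If $\operatorname{Rees} I=\{(V_1,N_1),\dots,(V_n,N_n)\}$, the Rees integers of $I$ are the integers $e_1,\dots,e_n$ with $IV_i=N_i^{e_i}$. Projective equivalence: ideals $I,J$ (nonzero proper, in a Noetherian domain) are projectively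 equivalent if $(I^m)_a=(J^n)_a$ for some positive integers $m,n$. $\mathbf{P}(I)$ is the set of integrally closed ideals projectively equivalent to $I$; it is linearly ordered by inclusion. $\mathbf{P}(I)$ is projectively full if every element of $\mathbf{P}(I)$ has the form $(K^n)_a$ for some positive integer $n$, where $K$ is the largest element of $\mathbf{P}(I)$; in that case each ideal $J$ with $J_a=K$ is called projectively full. *)

(* Defs.v *)
From HB Require Import structures.
From mathcomp Require Import all_boot all_order all_algebra.
From mathcomp Require Import separable.
From mathcomp Require Import boolp classical_sets.

Set Implicit Arguments.
Unset Strict Implicit.
Unset Printing Implicit Defensive.

Import GRing.Theory.
Local Open Scope classical_set_scope.
Local Open Scope quotient_scope.
Local Open Scope ring_scope.

Notation "x %:F" := (@FracField.tofrac _ x) : ring_scope.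

(* Ideals and subrings are sets. The parameter S below is a subring of the
   ambient ring R, so that the same notions serve for R itself (S = setT) and
   for the subrings of fields used to define Rees valuation rings. *)

Section Ideals.
Variable R : comNzRingType.
Implicit Types S A B P M : set R.

Definition ideal_of S A : Prop :=
  [/\ A `<=` S, A 0,
      (forall x y, A x -> A y -> A (x + y)) &
      (forall s x, S s -> A x -> A (s * x))].

Definition prime_ideal_of S P : Prop :=
  [/\ ideal_of S P, ~ P 1 &
      forall x y, S x -> S y -> P (x * y) -> P x \/ P y].

Definition maximal_ideal_of S M : Prop :=
  [/\ ideal_of S M, ~ M 1 &
      forall A, ideal_of S A -> ~ A 1 -> M `<=` A -> A = M].

Definition minimal_prime_over S A P : Prop :=
  [/\ prime_ideal_of S P, A `<=` P &
      forall Q, prime_ideal_of S Q -> A `<=` Q -> Q `<=` P -> Q = P].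

(* Finite sums of products a * b; when B is a subring this is the B-submodule
   generated by A. *)
Definition mul_span A B : set R :=
  [set x | exists n (a b : 'I_n -> R),
     (forall i, A (a i) /\ B (b i)) /\ x = \sum_i a i * b i].

Definition ideal_exp S A (n : nat) : set R := iter n (mul_span A) S.

End Ideals.

Notation ideal := (ideal_of setT).
Notation prime_ideal := (prime_ideal_of setT).
Notation maximal_ideal := (maximal_ideal_of setT).
Notation "A ^^+ n" := (ideal_exp setT A n) (at level 29, left associativity).

Section IdealTheory.
Variable R : comNzRingType.
Implicit Types A I J K L : set R.

Definition nonzero_proper_ideal A : Prop :=
  [/\ ideal A, (exists2 x, A x & x != 0) & ~ A 1].

Definition radical_ideal A : Prop :=
  ideal A /\ forall x n, A (x ^+ n) -> A x.

Definition noetherian : Prop :=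
  forall A, ideal A ->
    exists n (b : 'I_n -> R), A = [set x | exists c : 'I_n -> R,
                                     x = \sum_i c i * b i].

(* The integral closure K_a of K in R: the x satisfying an equation
   x ^ n + a_1 x ^ (n - 1) + ... + a_n = 0 with a_i in K ^ i. *)
Definition ideal_closure K : set R :=
  [set x | exists (n : nat) (a : nat -> R),
     [/\ (0 < n)%N,
         forall i, (1 <= i <= n)%N -> (K ^^+ i) (a i) &
         x ^+ n + \sum_(1 <= i < n.+1) a i * x ^+ (n - i) = 0]].

Definition proj_equiv I J : Prop :=
  [/\ nonzero_proper_ideal I, nonzero_proper_ideal J &
      exists m n : nat, [/\ (0 < m)%N, (0 < n)%N &
        ideal_closure (I ^^+ m) = ideal_closure (J ^^+ n)]].

(* The set P(I). *)
Definition proj_class I : set (set R) :=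
  [set J | proj_equiv J I /\ ideal_closure J = J].

Definition largest_in (C : set (set R)) K : Prop :=
  C K /\ forall J, C J -> J `<=` K.

(* "P(I) is projectively full", K being the largest element of P(I). *)
Definition projectively_full_class I K : Prop :=
  largest_in (proj_class I) K /\
  forall J, proj_class I J ->
    exists2 n : nat, (0 < n)%N & J = ideal_closure (K ^^+ n).

Definition projectively_full J : Prop :=
  ideal J /\
  exists I K, [/\ nonzero_proper_ideal I, projectively_full_class I K &
                  ideal_closure J = K].

End IdealTheory.

Arguments noetherian R : clear implicits.

Definition integrally_closed_domain (D : idomainType) : Prop :=
  forall x : {fraction D}, integralOver (@FracField.tofrac D) x ->
    exists a : D, x = a%:F.

Definition dedekind (D : idomainType) : Prop :=
  [/\ noetherian D, integrally_closed_domain D &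
      forall P : set D, prime_ideal P -> (exists2 x, P x & x != 0) ->
        maximal_ideal P].

Section FieldExtensions.
Variables (K L : fieldType) (iota : K -> L).

(* p is the minimal polynomial of x over K. *)
Definition separable_algebraic : Prop :=
  forall x : L, exists p : {poly K},
    [/\ p \is monic, irreducible_poly p, root (map_poly iota p) x &
        separable_poly p].

Definition extension_degree (d : nat) : Prop :=
  exists b : 'I_d -> L, forall x : L,
    exists! c : {ffun 'I_d -> K}, x = \sum_i iota (c i) * b i.

End FieldExtensions.

(* The map induced on quotient fields by an injective f; see frac_mapE. *)
Definition frac_map (D E : idomainType) (f : D -> E) (x : {fraction D}) :
    {fraction E} :=
  (f \n_(repr x))%:F / (f \d_(repr x))%:F.

Lemma frac_repr (D : idomainType) (x : {fraction D}) :
  x = (\n_(repr x))%:F / (\d_(repr x))%:F.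
Proof.
set q := repr x; have q0 : \d_q != 0 by exact: denom_ratioP.
apply: (canRL (mulfK _)); first by rewrite tofrac_eq0.
rewrite -{1}[x]reprK -/q; unlock FracField.tofrac.
rewrite -[LHS]FracField.pi_mul; apply/eqmodP => /=.
rewrite FracField.equivfE /FracField.mulf.
by rewrite !numden_Ratio ?oner_eq0 // ?mulr1 // mulrC.
Qed.

Lemma frac_mapE (D E : idomainType) (f : {rmorphism D -> E}) (a b : D) :
  injective f -> b != 0 ->
  frac_map f (a%:F / b%:F) = (f a)%:F / (f b)%:F.
Proof.
move=> f_inj b0; rewrite /frac_map; set x := a%:F / b%:F.
have f0 c : c != 0 -> (f c)%:F != 0.
  by rewrite tofrac_eq0 -(rmorph0 f) (inj_eq f_inj).
have q0 : \d_(repr x) != 0 by exact: denom_ratioP.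
apply/eqP; rewrite eqr_div ?f0 // -!tofracM -!rmorphM tofrac_eq (inj_eq f_inj).
rewrite -tofrac_eq !tofracM -eqr_div ?tofrac_eq0 //.
by rewrite -frac_repr.
Qed.

Section RingExtensions.
Variables (D E : idomainType) (f : {rmorphism D -> E}).

Definition finite_module : Prop :=
  exists n (b : 'I_n -> E), forall x, exists c : 'I_n -> D,
    x = \sum_i f (c i) * b i.

(* E is viewed as an extension of D through the injection f. *)
Definition finite_separable_integral_extension : Prop :=
  [/\ injective f, integralRange f, finite_module &
      separable_algebraic (frac_map f)].

Definition ideal_extension (I : set D) : set E := mul_span (f @` I) setT.

Section ResidueMap.
Variable N : idealr E.

Definition contraction : {pred D} := [pred x | f x \in N].

Fact contraction_idealr : idealr_closed contraction.
Proof.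
split=> [||a u v]; rewrite !inE ?rmorph0 ?rmorph1 ?idealr0 ?idealr1 //.
by move=> fu fv; rewrite rmorphD rmorphM rpredD // idealMr.
Qed.

HB.instance Definition _ := isIdealr.Build D contraction contraction_idealr.

(* The canonical map D / (N :&: D) -> E / N. *)
Definition residue_map (x : {ideal_quot contraction}) : {ideal_quot N} :=
  \pi_({ideal_quot N}) (f (repr x)).

Lemma residue_mapE (a : D) :
  residue_map (\pi_({ideal_quot contraction}) a) = \pi_({ideal_quot N}) (f a).
Proof.
apply/eqP; rewrite -Quotient.idealrBE -rmorphB.
suff: repr (\pi_({ideal_quot contraction}) a) - a \in contraction by [].
by rewrite Quotient.idealrBE reprK.
Qed.

End ResidueMap.

End RingExtensions.

Section Subrings.
Variable K : fieldType.
Implicit Types S P : set K.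

Definition subquotient_field S : set K :=
  [set x | exists a b, [/\ S a, S b, b != 0 & x = a / b]].

(* The integral closure of S in its quotient field. *)
Definition normalization S : set K :=
  [set x | subquotient_field S x /\
     exists p : {poly K}, [/\ p \is monic, forall i, S p`_i & root p x]].

Definition localization S P : set K :=
  [set x | exists a b, [/\ S a, S b, ~ P b & x = a / b]].

End Subrings.

Section ReesValuations.
Variable R : idomainType.
Local Notation F := {fraction R}.
Local Notation Ft := {fraction {poly F}}.

Definition of_quotient_field (x : F) : Ft := (x%:P)%:F.
Definition rees_var : Ft := ('X : {poly F})%:F.

(* The subring R[1/t, I t] of F(t). *)
Definition rees_ring (I : set R) : set Ft :=
  smallest [set S | subring_closed [pred x | x \in S]]
    [set x | [\/ exists a : R, x = of_quotient_field a%:F,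
                 x = rees_var^-1 |
                 exists2 a : R, I a & x = of_quotient_field a%:F * rees_var]].

(* V is a Rees valuation ring of I, that is, V belongs to Rees I. *)
Definition rees_valuation_ring (I : set R) (V : set F) : Prop :=
  let R' := normalization (rees_ring I) in
  exists2 p : set Ft,
    minimal_prime_over R' [set rees_var^-1 * y | y in R'] p &
    V = [set x : F | localization R' p (of_quotient_field x)].

(* I V = N ^ e, with N the maximal ideal of V. *)
Definition rees_integer (I : set R) (V : set F) (e : nat) : Prop :=
  exists2 N : set F, maximal_ideal_of V N &
    mul_span [set a%:F | a in I] V = ideal_exp V N e.

End ReesValuations.

(* Main.v *)
(* Write I as a product of P^(a_P), let c be the gcd of the a_P, b_P = a_P / c,
   d the product of the b_P, and e_P = d / b_P, so that a_P e_P = c d for all P.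
   By approximation there is a monic polynomial p of degree d over D whose Newton
   polygon at each P has b_P edges of width e_P, with distinct slopes k / e_P such
   that k = 1 mod e_P. The constant term of a factor of p shows that its degree is
   a multiple of every e_P, hence of d because the b_P are coprime; so p is
   irreducible, and it is separable because its linear coefficient is nonzero.

   Let E be the integral closure of D in the field generated by a root z of p.
   Each slope occurs among the conjugates of z, which are compared in a valuation
   ring of a splitting field dominating the localization at P; this gives b_P
   primes of E over P with ramification at least e_P. As b_P e_P = d these are all
   the primes over P, with ramification exactly e_P and trivial residue extension.
   Hence IE = J^(c d) where J is the product of the primes containing IE. All
   valuations of J are 0 or 1, which yields projective fullness and the Rees
   integers. *)
Require Import Defs.
From HB Require Import structures.
From mathcomp Require Import all_boot all_order all_algebra.
From mathcomp Require Import falgebra fieldext separable.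
From mathcomp Require Import boolp classical_sets.

Set Implicit Arguments.
Unset Strict Implicit.
Unset Printing Implicit Defensive.

Import GRing.Theory.
Local Open Scope classical_set_scope.
Local Open Scope ring_scope.

(** * Ideals and the localizations of a Dedekind domain *)

(** The residue field at [P] may be finite with fewer than [b_P] elements, so [b_P] primes over [P]
    cannot in general be produced by a polynomial with distinct linear factors modulo [P]. Here the
    primes are told apart by the order of [z]: distinct slopes give distinct primes whatever the
    residue field is. Since [b_P * e_P = d] leaves no room for more, exact ramification and trivial
    residue extensions come out of the count alone. Dividing the exponents by their gcd is what
    makes irreducibility work: the degree of a factor is known only modulo each [e_P], and for
    coprime [b_P] these congruences add up to divisibility by [d]. No completion is used. Local
    statements over [D] are written with denominators outside [P]. The valuation ring of the
    splitting field comes from Zorn's lemma, and its values are compared up to units, without a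
    value group. For the same reason the Newton polygon theorem is proved only in the weak form that
    every root has one of the slopes; that every slope occurs is recovered from the constant term by
    reading multiplicities as digits. *)

Section IdealBasics.
Variable R : comNzRingType.
Implicit Types (A B P M : set R) (x y : R).

Lemma ideal0 A : ideal A -> A 0. Proof. by case. Qed.

Lemma idealD A x y : ideal A -> A x -> A y -> A (x + y).
Proof. by case=> _ _ + _; apply. Qed.

Lemma ideal_mull A s x : ideal A -> A x -> A (s * x).
Proof. by case=> _ _ _; apply. Qed.

Lemma ideal_mulr A s x : ideal A -> A x -> A (x * s).
Proof. by rewrite mulrC; apply: ideal_mull. Qed.

Lemma idealN A x : ideal A -> A x -> A (- x).
Proof. by move=> iA Ax; rewrite -mulN1r; apply: ideal_mull. Qed.

Lemma idealB A x y : ideal A -> A x -> A y -> A (x - y).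
Proof. by move=> iA Ax Ay; apply: idealD => //; apply: idealN. Qed.

Lemma ideal_sum A I (r : seq I) (Q : pred I) (F : I -> R) :
  ideal A -> (forall i, Q i -> A (F i)) -> A (\sum_(i <- r | Q i) F i).
Proof.
move=> iA AF; apply: big_ind => //; first exact: ideal0.
by move=> x y; apply: idealD.
Qed.

Lemma idealT : ideal [set: R]. Proof. by split. Qed.

Lemma prime_idealP P x y : prime_ideal P -> P (x * y) -> P x \/ P y.
Proof. by case=> _ _; apply. Qed.

Lemma prime_idealW P : prime_ideal P -> ideal P. Proof. by case. Qed.

Lemma prime_ideal_mul P x y : prime_ideal P -> ~ P x -> ~ P y -> ~ P (x * y).
Proof. by move=> pP Px Py /(prime_idealP pP)[]. Qed.

Lemma prime_ideal_exp P x n : prime_ideal P -> ~ P x -> ~ P (x ^+ n).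
Proof.
move=> pP Px; elim: n => [|n IHn]; first by case: pP.
by rewrite exprS; apply: prime_ideal_mul.
Qed.

Lemma prime_ideal_prod P I (r : seq I) (Q : pred I) (F : I -> R) :
  prime_ideal P -> (forall i, Q i -> ~ P (F i)) -> ~ P (\prod_(i <- r | Q i) F i).
Proof.
move=> pP PF; apply: (big_ind (fun x => ~ P x)) => //; first by case: pP.
by move=> x y; apply: prime_ideal_mul.
Qed.

Definition ideal_adjoin A x : set R :=
  [set z | exists a s, A a /\ z = a + s * x].

Lemma ideal_adjoinP A x : ideal A ->
  [/\ ideal (ideal_adjoin A x), A `<=` ideal_adjoin A x & ideal_adjoin A x x].
Proof.
move=> iA; split.
- split=> //; first by exists 0, 0; rewrite mul0r addr0; split=> //; apply: ideal0.
  + move=> _ _ [a [s [Aa ->]]] [b [t [Ab ->]]]; exists (a + b), (s + t).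
    by rewrite mulrDl addrACA; split=> //; apply: idealD.
  + move=> u _ _ [a [s [Aa ->]]]; exists (u * a), (u * s).
    by rewrite mulrDr mulrA; split=> //; apply: ideal_mull.
- by move=> a Aa; exists a, 0; rewrite mul0r addr0.
- by exists 0, 1; rewrite mul1r add0r; split=> //; apply: ideal0.
Qed.

Lemma ideal_principal (x : R) : ideal [set z | exists s, z = s * x].
Proof.
split=> //; first by exists 0; rewrite mul0r.
- by move=> _ _ [s ->] [t ->]; exists (s + t); rewrite mulrDl.
- by move=> u _ _ [s ->]; exists (u * s); rewrite mulrA.
Qed.

Lemma ideal_colon A b : ideal A -> ideal [set s | A (s * b)].
Proof.
move=> iA; split=> //=; first by rewrite mul0r; apply: ideal0.
- by move=> x y Ax Ay; rewrite mulrDl; apply: idealD.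
- by move=> s x _ Ax; rewrite -mulrA; apply: ideal_mull.
Qed.

Lemma maximal_comax P s : maximal_ideal P -> ~ P s ->
  exists t p, P p /\ t * s + p = 1.
Proof.
move=> [iP P1 maxP] Ps; have [iPs sub Pss] := ideal_adjoinP s iP.
have: ideal_adjoin P s 1.
  by apply: contrapT => n1; apply: Ps; rewrite -(maxP _ iPs n1 sub).
by move=> [p [t [Pp e1]]]; exists t, p; split=> //; rewrite addrC.
Qed.

Lemma maximal_prime P : maximal_ideal P -> prime_ideal P.
Proof.
move=> mP; have [iP P1 _] := mP; split=> // x y _ _ Pxy.
case: (pselect (P x)) => [|Px]; [by left | right].
have [t [p [Pp e1]]] := maximal_comax mP Px.
rewrite -[y]mul1r -e1 mulrDl -mulrA; apply: idealD => //; last exact: ideal_mulr.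
exact: ideal_mull.
Qed.

Lemma noetherian_max (C : set (set R)) A0 : noetherian R ->
  (forall A, C A -> ideal A) -> C A0 ->
  exists2 M, C M & forall A, C A -> M `<=` A -> A = M.
Proof.
move=> noR iC CA0; apply: contrapT => noM.
have next (A : {A | C A}) : exists B : {A | C A},
    sval A `<=` sval B /\ ~ (sval B `<=` sval A).
  case: A => A CA /=; apply: contrapT => noB; apply: noM; exists A => // B CB sAB.
  apply/seteqP; split=> //; apply: contrapT => nBA.
  by apply: noB; exists (exist _ B CB).
have [g gP] := choice next.
pose s n := iter n g (exist _ A0 CA0).
have s_mono i j : (i <= j)%N -> sval (s i) `<=` sval (s j).
  move=> /subnK <-; elim: (j - i)%N => // k IHk x /IHk.
  by rewrite addSn /=; apply: (gP _).1.
(* The union of the chain is finitely generated, so one term contains all generators and the chain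
   cannot grow beyond it. *)
pose U := [set x | exists n, sval (s n) x].
have is_ n : ideal (sval (s n)) by apply: iC; case: (s n).
have iU : ideal U.
  split=> //; first by exists 0%N; apply: ideal0.
  - move=> x y [i si] [j sj]; exists (maxn i j).
    apply: idealD => //; [apply: (s_mono i) => //|apply: (s_mono j) => //].
      exact: leq_maxl.
    exact: leq_maxr.
  - by move=> t x _ [i si]; exists i; apply: ideal_mull.
have [n [b Ub]] := noR _ iU.
have bU i : U (b i).
  rewrite Ub; exists (fun j => (j == i)%:R).
  by rewrite (bigD1 i) //= eqxx mul1r big1 ?addr0 // => j /negPf->; rewrite mul0r.
have [k kP] := choice bU.
pose K := (\max_i k i)%N.
apply: (gP (s K)).2 => x sx.
have: U x by exists K.+1.
rewrite Ub => -[c ->]; apply: ideal_sum => // i _; apply: ideal_mull => //.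
by apply: (s_mono (k i)) => //; apply: leq_bigmax.
Qed.

Lemma maximal_over A : noetherian R -> ideal A -> ~ A 1 ->
  exists2 M, maximal_ideal M & A `<=` M.
Proof.
move=> noR iA A1.
pose C := [set B : set R | [/\ ideal B, ~ B 1 & A `<=` B]].
have [] := @noetherian_max C A noR.
- by move=> B [].
- by split.
move=> M [iM M1 sAM] maxM; exists M => //; split=> // B iB B1 sMB.
by apply: maxM => //; split=> //; apply: subset_trans sMB.
Qed.

(** Noetherian induction. A maximal counterexample [B] is not prime, since a prime over [A] is
    maximal and is the only prime over itself. So some [x * y] lies in [B] with [x] and [y] outside,
    and each prime over [B] contains one of the two larger ideals obtained by adjoining [x] or [y],
    which have finitely many primes over them. *)
Lemma finite_primes_over A : noetherian R -> ideal A ->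
  (forall P, prime_ideal P -> A `<=` P -> maximal_ideal P) ->
  exists ps : seq (set R), forall P, (P \in ps) = `[< prime_ideal P /\ A `<=` P >].
Proof.
move=> noR iA maxA.
suff [ps psP] : exists ps : seq (set R), forall P, prime_ideal P -> A `<=` P -> P \in ps.
  exists [seq P <- ps | `[< prime_ideal P /\ A `<=` P >]] => P.
  by rewrite mem_filter andb_idr // => /asboolP[]; apply: psP.
apply: contrapT => nA.
pose C := [set B : set R | [/\ ideal B, A `<=` B &
  ~ exists ps : seq (set R), forall P, prime_ideal P -> B `<=` P -> P \in ps]].
have [] := @noetherian_max C A noR.
- by move=> B [].
- by split.
move=> B [iB sAB nB] maxB.
have B1 : ~ B 1.
  by move=> B1; apply: nB; exists [::] => P [_ P1 _] /(_ _ B1).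
have bigger x : ~ B x -> exists ps : seq (set R),
    forall P, prime_ideal P -> B `<=` P -> P x -> P \in ps.
  move=> Bx; have [iBx sub Bxx] := ideal_adjoinP x iB.
  apply: contrapT => nBx; apply: Bx; rewrite -(maxB (ideal_adjoin B x)) //.
  split=> // [|[ps psP]]; first exact: subset_trans sub.
  apply: nBx; exists ps => P pP sBP Px; apply: psP => //.
  move=> _ [a [s [Ba ->]]]; have iP := prime_idealW pP.
  by apply: idealD => //; [apply: sBP | apply: ideal_mull].
case: (pselect (prime_ideal B)) => [pB | npB].
  have [_ _ maxB'] := maxA B pB sAB.
  apply: nB; exists [:: B] => P [iP P1 _] sBP.
  by rewrite inE; apply/eqP/maxB'.
apply: npB; split=> // x y _ _ Bxy; apply: contrapT => /not_orP[Bx By].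
have [ps psP] := bigger x Bx; have [qs qsP] := bigger y By.
apply: nB; exists (ps ++ qs) => P pP sBP; rewrite mem_cat.
case: (prime_idealP pP (sBP _ Bxy)) => [Px|Py].
  by rewrite psP.
by rewrite qsP // orbT.
Qed.

End IdealBasics.

(** * Orders at the nonzero primes of a Dedekind domain *)

Section Dedekind.
Variable D : idomainType.
Hypothesis dedD : dedekind D.
Implicit Types (A B P Q : set D) (x y a b : D).

Definition nzprime P : Prop := prime_ideal P /\ exists2 x, P x & x != 0.

Let noD : noetherian D. Proof. by case: dedD. Qed.

Lemma nzprime_max P : nzprime P -> maximal_ideal P.
Proof. by case: dedD => _ _ + [pP P0]; apply. Qed.

Lemma nzprime_prime P : nzprime P -> prime_ideal P. Proof. by case. Qed.

Lemma nzprime_ideal P : nzprime P -> ideal P. Proof. by case=> -[]. Qed.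

Lemma nzprime_neq P Q : nzprime P -> nzprime Q -> P != Q ->
  exists2 x, P x & ~ Q x.
Proof.
move=> /nzprime_max[iP _ maxP] nQ /eqP nPQ; apply: contrapT => nx; apply: nPQ.
apply/esym/maxP; first exact: nzprime_ideal.
  by case: nQ => -[].
by move=> x Px; apply: contrapT => nQx; apply: nx; exists x.
Qed.

(* P is an associated prime of D/(a): a maximal element among the annihilators
   of the elements of D/(a) that survive localization at P is P itself. *)
Lemma nzprime_associated P a : nzprime P -> P a -> a != 0 ->
  exists2 b, (forall x, P x -> exists y, b * x = a * y) &
             ~ exists y, b = a * y.
Proof.
move=> nP Pa a0; have pP := nzprime_prime nP; have iP := nzprime_ideal nP.
pose I := [set z | exists s, z = s * a]; have iI : ideal I := ideal_principal a.
pose C := [set B | exists2 b, B = [set s | I (s * b)] &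
                                forall s, ~ P s -> ~ I (s * b)].
have sIP : I `<=` P by move=> _ [s ->]; apply: ideal_mull.
have [||_ [b -> bP] maxB] := @noetherian_max _ C [set s | I (s * 1)] noD.
- by move=> _ [b -> _]; apply: ideal_colon.
- by exists 1 => // s Ps; rewrite mulr1 => /sIP.
pose B := [set s | I (s * b)].
have maxB' s : ~ P s -> [set t | I (t * (s * b))] = B.
  move=> Ps; apply: maxB.
    exists (s * b) => // t Pt; rewrite mulrA; apply: bP.
    exact: prime_ideal_mul.
  by move=> t /= It; rewrite mulrCA; apply: ideal_mull.
have iB : ideal B by apply: ideal_colon.
have Ba : B a by exists b; rewrite mulrC.
have pB : prime_ideal B.
  split=> //.
    by move=> /(bP 1); apply; case: pP.
  move=> x y _ _ Bxy; case: (pselect (B y)) => [|By]; [by right | left].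
  suff yP s : ~ P s -> ~ I (s * (y * b)).
    rewrite /B -(maxB [set t | I (t * (y * b))]) /=; first by rewrite mulrA.
      by exists (y * b).
    by move=> t /= It; rewrite mulrCA; apply: ideal_mull.
  move=> Ps Is; apply: By; rewrite -(maxB' s Ps) /=.
  by rewrite mulrCA.
have mB : maximal_ideal B by apply: nzprime_max; split=> //; exists a.
have BP : P = B.
  case: mB => _ _; apply=> //; first by case: pP.
  by move=> s Bs; apply: contrapT => /bP; apply.
exists b => [x|[y yb]].
  by rewrite BP => -[y]; rewrite (mulrC x) (mulrC y); exists y.
by apply: (bP 1); [case: pP | exists y; rewrite mul1r yb mulrC].
Qed.

(* Multiplication by b / a acts on the generators of P by a matrix over D, so
   b / a is a root of the characteristic polynomial. *)
Lemma nzprime_stable P a b : nzprime P -> a != 0 ->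
  (forall x, P x -> exists2 y, P y & b * x = a * y) -> exists y, b = a * y.
Proof.
move=> nP a0 stab; have [_ icD _] := dedD; have [_ [x0 Px0 x00]] := nP.
have [n [g gP]] := noD (nzprime_ideal nP).
have gi i : exists c : 'I_n -> D, b * g i = a * \sum_j c j * g j.
  have Pg : P (g i).
    rewrite gP; exists (fun j => (j == i)%:R).
    by rewrite (bigD1 i) //= eqxx mul1r big1 ?addr0 // => j /negPf->; rewrite mul0r.
  by have [y + ->] := stab _ Pg; rewrite gP => -[c ->]; exists c.
have [c cP] := choice gi.
pose M := \matrix_(i, j) c j i : 'M[D]_n.
pose v := \row_j (g j)%:F : 'rV[{fraction D}]_n.
have aF0 : a%:F != 0 by rewrite tofrac_eq0.
pose toF : {rmorphism D -> {fraction D}} := @FracField.tofrac D.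
have eigv : v *m map_mx toF M = (b%:F / a%:F) *: v.
  apply/rowP => j; rewrite !mxE; apply: (mulfI aF0).
  rewrite mulrA mulrCA mulfV // mulr1 -tofracM cP.
  rewrite tofracM; congr (_ * _); rewrite rmorph_sum; apply: eq_bigr => i _.
  by rewrite !mxE -tofracM mulrC.
have v0 : v != 0.
  apply: contraNneq x00 => v0; move: Px0; rewrite gP => -[d ->].
  rewrite big1 // => i _; have := congr1 (fun w : 'rV__ => w 0 i) v0.
  by rewrite !mxE => /eqP; rewrite tofrac_eq0 => /eqP ->; rewrite mulr0.
have : eigenvalue (map_mx toF M) (b%:F / a%:F) by apply/eigenvalueP; exists v.
rewrite eigenvalue_root_char => rt.
have [|y yP] := icD (b%:F / a%:F).
  exists (char_poly M); first exact: char_poly_monic.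
  by rewrite -[map_poly _ _]/(map_poly toF (char_poly M)) map_char_poly.
exists y; apply/eqP; rewrite -tofrac_eq tofracM -yP mulrCA mulfV // mulr1.
exact: eqxx.
Qed.

(** Multiplication by [b / a] maps [P] into [D], but not into [P], since [b / a] would then lie in
    [D]. Hence [b * p = a * u] for some [p] in [P] and [u] outside [P]; for [x] in [P],
    [b * x = a * y] then gives [u * x = p * y], so [p] generates [P] locally and the single
    denominator [u] serves all [x]. *)
Lemma uniformizer_exists P : nzprime P -> exists pu : D * D,
  [/\ P pu.1, pu.1 != 0, ~ P pu.2 & forall x, P x -> exists y, pu.2 * x = pu.1 * y].
Proof.
move=> nP; have [pP [a Pa a0]] := nP.
have [b bP bN] := nzprime_associated nP Pa a0.
have: exists2 p, P p & ~ exists2 y, P y & b * p = a * y.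
  apply: contrapT => np; apply/bN/(nzprime_stable nP a0) => x Px.
  by apply: contrapT => nx; apply: np; exists x.
move=> [p Pp pN]; have [u uP] := bP p Pp.
exists (p, u); split=> //=.
- apply: contra_notN pN => /eqP ->; exists 0; rewrite ?mulr0 //.
  exact: ideal0 (nzprime_ideal nP).
- by move=> Pu; apply: pN; exists u.
move=> x /bP[y yP]; exists y; apply: (mulfI a0).
by rewrite mulrA -uP mulrCA -yP -!mulrA mulrCA.
Qed.

(* If unif P = (pi, u), then pi is a uniformizer of the localization at P, and u
   clears the denominators of x / pi for all x in P. *)
Definition unif P : D * D := xget (0, 0) [set pu : D * D |
  [/\ P pu.1, pu.1 != 0, ~ P pu.2 & forall x, P x -> exists y, pu.2 * x = pu.1 * y]].

Lemma unifP P : nzprime P ->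
  [/\ P (unif P).1, (unif P).1 != 0, ~ P (unif P).2 &
      forall x, P x -> exists y, (unif P).2 * x = (unif P).1 * y].
Proof. by move=> /uniformizer_exists ex; apply: xgetPex ex. Qed.

Notation pi_ P := (unif P).1.

Definition ord_spec P x n : Prop :=
  exists s y, [/\ ~ P s, ~ P y & s * x = pi_ P ^+ n * y].

(* The P-adic valuation; pval P 0 is a junk value, which vge below corrects. *)
Definition pval P x : nat := xget 0%N [set n | ord_spec P x n].

(** If no exponent fitted, [x] would be divisible by every power of the uniformizer [p] once [u] is
    inverted. The quotients [y n] generate an increasing sequence of ideals, and its becoming
    stationary would make [p] invertible there, forcing a power of [u] into [P]. *)
Lemma ord_exists P x : nzprime P -> x != 0 -> exists n, ord_spec P x n.
Proof.
move=> nP x0; have [Ppi pi0 Pu uP] := unifP nP.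
have pP := nzprime_prime nP.
set p := (unif P).1 in Ppi pi0 uP *; set u := (unif P).2 in Pu uP.
apply: contrapT => no.
have ex n : exists y, u ^+ n * x = p ^+ n * y.
  elim: n => [|n [y yP]]; first by exists x.
  have Py : P y.
    apply: contrapT => Py; apply: no; exists n, (u ^+ n), y; split=> //.
    exact: prime_ideal_exp.
  have [z zP] := uP y Py; exists z.
  by rewrite !exprS -mulrA yP mulrCA zP mulrCA mulrA.
have [y yP] := choice ex.
have y0 n : y n != 0.
  apply: contra_neq x0 => yn; have := yP n; rewrite yn mulr0 => /eqP.
  rewrite mulf_eq0 expf_eq0 => /orP[/andP[_ /eqP u0]|/eqP //].
  by case: Pu; rewrite u0; apply: ideal0 (nzprime_ideal nP).
have yS n : u * y n = p * y n.+1.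
  apply: (mulfI (expf_neq0 n pi0)); rewrite mulrCA -yP.
  by rewrite [LHS]mulrA -exprS yP exprSr mulrA.
(* The contraction to [D] of the ideal generated by [y n] in [D[1/u]]. *)
pose A n := [set z | exists k w, u ^+ k * z = w * y n].
have iA n : ideal (A n).
  split=> //.
  - by exists 0%N, 0; rewrite mulr0 mul0r.
  - move=> z z' [k [w e]] [k' [w' e']].
    exists (k + k')%N, (u ^+ k' * w + u ^+ k * w').
    rewrite mulrDr {1}addnC !exprD -!mulrA e e' mulrDl !mulrA mulrAC.
    by rewrite (mulrC (u ^+ k)) -!mulrA.
  - move=> s z _ [k [w e]]; exists k, (s * w).
    by rewrite mulrCA e mulrA.
have [||M [n _ <-] maxA] := @noetherian_max _ [set A n | n in setT] (A 0%N) noD.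
- by move=> _ [n _ <-].
- by exists 0%N.
have: A n (y n.+1).
  rewrite -(maxA (A n.+1)); first by exists 0%N, 1; rewrite !mul1r.
    by exists n.+1.
  move=> z [k [w e]]; exists k.+1, (w * p).
  by rewrite exprS -mulrA e mulrCA yS mulrA.
move=> [k [w e]].
have : P (u ^+ k.+1).
  suff -> : u ^+ k.+1 = p * w by apply: ideal_mulr => //; case: pP.
  apply: (mulIf (y0 n)); rewrite exprSr -mulrA yS mulrCA e.
  by rewrite mulrA.
exact: prime_ideal_exp.
Qed.

Lemma ord_uniq P x n n' : nzprime P -> ord_spec P x n -> ord_spec P x n' -> n = n'.
Proof.
move=> nP; have [Ppi pi0 _ _] := unifP nP; have pP := nzprime_prime nP.
have iP := nzprime_ideal nP; set p := (unif P).1 in Ppi pi0 *.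
wlog: n n' / (n <= n')%N.
  move=> W Hn Hn'; case/orP: (leq_total n n') => l; first exact: W.
  by apply/esym; apply: W.
rewrite leq_eqVlt => /orP[/eqP //|lt].
move=> [s [y [Ps Py e]]] [s' [y' [Ps' Py' e']]].
case: (prime_ideal_mul pP Ps' Py).
suff -> : s' * y = p * (p ^+ (n' - n.+1) * (s * y')).
  by apply: ideal_mulr.
apply: (mulfI (expf_neq0 n pi0)); rewrite mulrCA -e mulrCA e'.
have -> : p ^+ n' = p ^+ n * (p * p ^+ (n' - n.+1)).
  by rewrite -exprS -exprD addnS -addSn subnKC.
by rewrite -!mulrA 3!(mulrCA s).
Qed.

Lemma pvalP P x : nzprime P -> x != 0 -> ord_spec P x (pval P x).
Proof. by move=> nP x0; apply: xgetPex (ord_exists nP x0). Qed.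

Lemma pval_eq P x n : nzprime P -> x != 0 -> ord_spec P x n -> pval P x = n.
Proof. by move=> nP x0; apply: ord_uniq nP (pvalP nP x0). Qed.

Lemma pvalM P x y : nzprime P -> x != 0 -> y != 0 ->
  pval P (x * y) = (pval P x + pval P y)%N.
Proof.
move=> nP x0 y0; apply: pval_eq => //; first exact: mulf_neq0.
have [s [z [Ps Pz e]]] := pvalP nP x0; have [s' [z' [Ps' Pz' e']]] := pvalP nP y0.
have pP := nzprime_prime nP.
exists (s * s'), (z * z'); split; try exact: prime_ideal_mul.
by rewrite mulrACA e e' exprD mulrACA.
Qed.

Lemma pval_gt0 P x : nzprime P -> x != 0 -> (0 < pval P x)%N <-> P x.
Proof.
move=> nP x0; have [s [y [Ps Py e]]] := pvalP nP x0.
have [Ppi pi0 _ _] := unifP nP; have pP := nzprime_prime nP.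
have iP := nzprime_ideal nP.
split=> [v0 | Px].
  have : P (s * x).
    by rewrite e -(prednK v0) exprS -mulrA; apply: ideal_mulr.
  by case/(prime_idealP pP).
rewrite lt0n; apply/eqP => v0; apply: Py.
by move: e; rewrite v0 mul1r => <-; apply: ideal_mull.
Qed.

Lemma pval_eq0 P x : nzprime P -> ~ P x -> pval P x = 0%N.
Proof.
move=> nP Px; have x0 : x != 0.
  by apply: contra_notN Px => /eqP ->; apply: ideal0 (nzprime_ideal nP).
by apply/eqP; rewrite -leqn0 leqNgt; apply/negP => /(pval_gt0 nP x0).
Qed.

Lemma pval_unif P : nzprime P -> pval P (pi_ P) = 1%N.
Proof.
move=> nP; have [Ppi pi0 Pu uP] := unifP nP; apply: pval_eq => //.
have P1 : ~ P 1 by case: nP => -[].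
by exists 1, 1; split; rewrite // mul1r expr1 mulr1.
Qed.

Lemma pvalX P x n : nzprime P -> x != 0 -> pval P (x ^+ n) = (n * pval P x)%N.
Proof.
move=> nP x0; elim: n => [|n IHn]; first by rewrite pval_eq0 //; case: nP => -[].
by rewrite exprS pvalM ?expf_neq0 // IHn.
Qed.

Lemma pval_prod P I (r : seq I) (F : I -> D) : nzprime P ->
  (forall i, F i != 0) -> pval P (\prod_(i <- r) F i) = (\sum_(i <- r) pval P (F i))%N.
Proof.
move=> nP F0; elim: r => [|i r IHr].
  by rewrite !big_nil pval_eq0 //; case: nP => -[].
rewrite !big_cons pvalM ?IHr //.
by apply: (big_ind (fun x => x != 0)) => //; [apply: oner_neq0 | apply: mulf_neq0].
Qed.

Definition vge P n x : Prop := x = 0 \/ (n <= pval P x)%N.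

(** This is divisibility by the [n]-th power of the uniformizer in the localization. Unlike the
    comparison of orders it makes closure under addition a matter of common denominators. *)
Lemma vgeE P n x : nzprime P ->
  vge P n x <-> exists s y, ~ P s /\ s * x = pi_ P ^+ n * y.
Proof.
move=> nP; have pP := nzprime_prime nP; have P1 : ~ P 1 by case: pP.
split=> [[->|le]|].
- by exists 1, 0; rewrite !mulr0.
- have [->|x0] := eqVneq x 0; first by exists 1, 0; rewrite !mulr0.
  have [s [y [Ps Py e]]] := pvalP nP x0.
  exists s, (pi_ P ^+ (pval P x - n) * y); split=> //.
  by rewrite mulrA -exprD subnKC.
move=> [s [y [Ps e]]]; have [->|x0] := eqVneq x 0; [by left | right].
have s0 : s != 0.
  by apply: contra_notN Ps => /eqP ->; apply: ideal0 (nzprime_ideal nP).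
have [_ pi0 _ _] := unifP nP.
have y0 : y != 0.
  have: pi_ P ^+ n * y != 0 by rewrite -e mulf_neq0.
  by apply: contra_neq => ->; rewrite mulr0.
have := congr1 (pval P) e.
rewrite !pvalM ?expf_neq0 // pvalX // pval_unif // muln1 (pval_eq0 nP Ps).
by rewrite add0n => ->; apply: leq_addr.
Qed.

Lemma vge_ideal P n : nzprime P -> ideal (vge P n).
Proof.
move=> nP; split=> //; first by left.
- move=> x y /(vgeE _ _ nP)[s [z [Ps e]]] /(vgeE _ _ nP)[s' [z' [Ps' e']]].
  apply/(vgeE _ _ nP); exists (s * s'), (s' * z + s * z').
  split; first by apply: prime_ideal_mul => //; apply: nzprime_prime.
  by rewrite !mulrDr mulrAC e -mulrA e' [_ * s']mulrC !mulrA
    [s' * _]mulrC [s * _]mulrC.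
- move=> t x _ /(vgeE _ _ nP)[s [z [Ps e]]]; apply/(vgeE _ _ nP).
  by exists s, (t * z); rewrite mulrCA e mulrCA.
Qed.

Lemma vgeW P n m x : (m <= n)%N -> vge P n x -> vge P m x.
Proof. by move=> mn [->|le]; [left | right; apply: leq_trans le]. Qed.

Lemma vgeM P n m x y : nzprime P -> vge P n x -> vge P m y -> vge P (n + m) (x * y).
Proof.
move=> nP [->|nx]; first by rewrite mul0r; left.
move=> [->|my]; first by rewrite mulr0; left.
have [->|x0] := eqVneq x 0; first by rewrite mul0r; left.
have [->|y0] := eqVneq y 0; first by rewrite mulr0; left.
by right; rewrite pvalM // leq_add.
Qed.

Lemma vge1 P x : nzprime P -> vge P 1 x <-> P x.
Proof.
move=> nP; have [->|x0] := eqVneq x 0.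
  by split=> _; [apply: ideal0 (nzprime_ideal nP) | left].
split=> [[e|/(pval_gt0 nP x0)//]|/(pval_gt0 nP x0)]; last by right.
by rewrite e eqxx in x0.
Qed.

Lemma vgeMl P n s x : nzprime P -> ~ P s -> vge P n (s * x) -> vge P n x.
Proof.
move=> nP Ps; have s0 : s != 0.
  by apply: contra_notN Ps => /eqP ->; apply: ideal0 (nzprime_ideal nP).
have [->|x0] := eqVneq x 0; first by left.
move=> [/eqP|]; first by rewrite mulf_eq0 (negPf s0) (negPf x0).
by rewrite pvalM // (pval_eq0 nP Ps); right.
Qed.

Lemma vge_lt P x n : x != 0 -> vge P n x <-> (n <= pval P x)%N.
Proof.
move=> x0; split=> [|le]; last by right.
by case=> // e; rewrite e eqxx in x0.
Qed.

End Dedekind.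
Section IdealProducts.
Variable R : comNzRingType.
Implicit Types (A B : set R) (x y : R).

Lemma mul_span_mem A B a b : A a -> B b -> mul_span A B (a * b).
Proof.
by move=> Aa Bb; exists 1%N, (fun=> a), (fun=> b); rewrite big_ord1.
Qed.

Lemma mul_spanD A B x y : mul_span A B x -> mul_span A B y -> mul_span A B (x + y).
Proof.
move=> [n [a [b [ab ->]]]] [m [c [d [cd ->]]]].
exists (n + m)%N, (fun i => match split i with inl j => a j | inr j => c j end),
  (fun i => match split i with inl j => b j | inr j => d j end).
split; first by move=> i; case: split.
rewrite big_split_ord; congr (_ + _); apply: eq_bigr => i _.
  by rewrite -[lshift _ _]/(unsplit (inl i)) unsplitK.
by rewrite -[rshift _ _]/(unsplit (inr i)) unsplitK.
Qed.

Lemma mul_span0 A B : mul_span A B 0.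
Proof.
exists 0%N, (fun=> 0), (fun=> 0); rewrite big_ord0.
by split=> //; case.
Qed.

Lemma mul_span_ideal A B : ideal B -> ideal (mul_span A B).
Proof.
move=> iB; split=> //; first exact: mul_span0.
- by move=> x y; apply: mul_spanD.
- move=> s x _ [n [a [b [ab ->]]]]; exists n, a, (fun i => s * b i).
  split; last by rewrite mulr_sumr; apply: eq_bigr => i _; rewrite mulrCA.
  by move=> i; have [Aa Bb] := ab i; split=> //; apply: ideal_mull.
Qed.

Lemma mul_span_sub A B (C : set R) :
  C 0 -> (forall x y, C x -> C y -> C (x + y)) ->
  (forall a b, A a -> B b -> C (a * b)) -> mul_span A B `<=` C.
Proof.
move=> C0 CD Cab _ [n [a [b [ab ->]]]].
by apply: big_ind => // i _; have [] := ab i; apply: Cab.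
Qed.

Lemma ideal_exp_sub A n : ideal A -> (0 < n)%N -> A ^^+ n `<=` A.
Proof.
case: n => // n iA _; apply: mul_span_sub; first exact: ideal0.
  by move=> x y; apply: idealD.
by move=> a b Aa _; apply: ideal_mulr.
Qed.

End IdealProducts.

(** * Orders of ideals, approximation, and the local-global principle *)

Section IdealValuation.
Variable D : idomainType.
Hypothesis dedD : dedekind D.
Implicit Types (A B P Q : set D) (x y a b : D).

Let noD : noetherian D. Proof. by case: dedD. Qed.
Hint Resolve nzprime_ideal nzprime_prime : core.

Lemma uniformizer_away (ps : seq (set D)) P :
  (forall Q, Q \in ps -> nzprime Q) -> P \in ps ->
  exists2 t, pval P t = 1%N /\ t != 0 & forall Q, Q \in ps -> Q != P -> ~ Q t.
Proof.
move=> nps Pps; have nP := nps P Pps; pose us := undup ps.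
have usE Q : (Q \in us) = (Q \in ps) by rewrite mem_undup.
have ex (QQ : set D * set D) : exists a, QQ.1 \in ps -> QQ.2 \in ps ->
    QQ.1 != QQ.2 -> QQ.1 a /\ ~ QQ.2 a.
  case: (pselect (QQ.1 \in ps /\ QQ.2 \in ps /\ QQ.1 != QQ.2)) => [[p1 [p2 ne]]|no].
    by have [a] := nzprime_neq dedD (nps _ p1) (nps _ p2) ne; exists a.
  by exists 0 => p1 p2 ne; case: no.
have [a aP] := choice ex.
pose q Q := \prod_(Q' <- us | Q' != Q) a (Q', Q).
have qN Q : Q \in ps -> ~ Q (q Q).
  move=> Qps; rewrite /q big_seq_cond; apply: prime_ideal_prod; first exact/nzprime_prime/nps.
  by move=> Q' /andP[]; rewrite usE => Q'ps ne; case: (aP (Q', Q)).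
have qP Q Q' : Q \in ps -> Q' \in ps -> Q' != Q -> Q' (q Q).
  move=> Qps Q'ps ne; rewrite /q -big_filter.
  rewrite (bigD1_seq Q') ?filter_uniq ?undup_uniq ?mem_filter ?usE ?ne //=.
  by apply: ideal_mulr; [apply/nzprime_ideal/nps | case: (aP (Q', Q))].
pose w := \sum_(Q <- us | Q != P) q Q.
have wP : P w.
  rewrite /w big_seq_cond; apply: ideal_sum; first exact: nzprime_ideal.
  by move=> Q /andP[]; rewrite usE => Qps ne; apply: qP; rewrite // eq_sym.
have wN Q : Q \in ps -> Q != P -> ~ Q w.
  move=> Qps ne; rewrite /w -big_filter.
  rewrite (bigD1_seq Q) ?filter_uniq ?undup_uniq ?mem_filter ?usE ?ne //= => Qw.
  have iQ := nzprime_ideal (nps Q Qps); apply: (qN Q Qps).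
  rewrite -[q Q](addrK (\sum_(i <- [seq i <- us | i != P] | i != Q) q i)).
  apply: idealB => //; rewrite big_seq_cond; apply: ideal_sum => // Q' /andP[].
  rewrite mem_filter usE => /andP[_ Q'ps] ne'; apply: qP => //.
  by rewrite eq_sym.
have [Ppi pi0 _ _] := unifP dedD nP.
(* At [P] the first summand has order one and the square has order at least two. At another [Q] of
   the list the first summand lies in [Q] and the square does not. *)
pose t := q P * (unif P).1 + w ^+ 2.
have w2 : vge P 2 (w ^+ 2) by apply: (@vgeM _ dedD _ 1 1) => //; apply/vge1.
have tN : ~ vge P 2 t.
  move=> t2; have := idealB (vge_ideal dedD 2 nP) t2 w2; rewrite addrK.
  move=> /(vgeMl dedD nP (qN P Pps)) [/eqP|]; first by rewrite (negPf pi0).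
  by rewrite pval_unif.
have t0 : t != 0 by apply: contra_notN tN => /eqP ->; left.
have Pt : P t.
  by apply: idealD; [..|apply: ideal_mull|apply: ideal_mulr]; try exact: nzprime_ideal.
exists t.
  split=> //; apply/eqP; rewrite eqn_leq; apply/andP; split.
    by rewrite leqNgt; apply/negP => lt; apply: tN; right.
  exact/(pval_gt0 dedD nP t0).
move=> Q Qps ne Qt; have iQ := nzprime_ideal (nps Q Qps).
apply: (prime_ideal_exp (n := 2) (nzprime_prime (nps Q Qps)) (wN Q Qps ne)).
rewrite -[w ^+ 2](addrK (q P * (unif P).1)); apply: idealB => //.
  by rewrite addrC.
by apply: ideal_mulr => //; apply: qP.
Qed.

Lemma pval_approx (ps : seq (set D)) (n : set D -> nat) :
  (forall Q, Q \in ps -> nzprime Q) ->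
  exists2 c, c != 0 & forall P, P \in ps -> pval P c = n P.
Proof.
move=> nps.
have ex P : exists t, t != 0 /\ (P \in ps -> pval P t = 1%N /\
    forall Q, Q \in ps -> Q != P -> ~ Q t).
  case: (boolP (P \in ps)) => Pps; last by exists 1; rewrite oner_neq0.
  by have [t [] ] := uniformizer_away nps Pps; exists t.
have [t tP] := choice ex.
(* Without [undup] a prime listed twice would receive twice its exponent. *)
exists (\prod_(P <- undup ps) t P ^+ n P).
  apply: (big_ind (fun x => x != 0)); first exact: oner_neq0.
    exact: mulf_neq0.
  by move=> P _; rewrite expf_neq0 //; case: (tP P).
move=> P Pps; have nP := nps P Pps.
rewrite pval_prod // => [|Q]; last by rewrite expf_neq0 //; case: (tP Q).
rewrite (bigD1_seq P) ?undup_uniq ?mem_undup //=.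
have [t0 /(_ Pps)[vt _]] := tP P.
rewrite pvalX // vt muln1 big_seq_cond big1 ?addn0 // => Q /andP[].
rewrite mem_undup => Qps ne; have [tQ0 /(_ Qps)[_ tN]] := tP Q.
by rewrite pvalX // pval_eq0 ?muln0 //; apply: tN; rewrite // eq_sym.
Qed.

Definition nzideal A : Prop := ideal A /\ exists2 x, A x & x != 0.

Lemma nzidealT : nzideal [set: D].
Proof. by split; [apply: idealT | exists 1; rewrite ?oner_neq0]. Qed.

Definition ival_spec P A n : Prop :=
  (forall x, A x -> vge P n x) /\ exists x, [/\ A x, x != 0 & pval P x = n].

Definition ival P A : nat := xget 0%N [set n | ival_spec P A n].

Lemma ivalP P A : nzideal A -> ival_spec P A (ival P A).
Proof.
move=> [iA [x0 Ax0 x00]].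
suff ex : exists n, ival_spec P A n by apply: xgetPex ex.
pose p n := `[< exists x, [/\ A x, x != 0 & pval P x = n] >].
have: exists n, p n by exists (pval P x0); apply/asboolP; exists x0.
move=> /ex_minnP[n /asboolP[x [Ax xn0 vx]] min]; exists n; split; last by exists x.
move=> y Ay; have [->|y0] := eqVneq y 0; [by left | right].
by apply: min; apply/asboolP; exists y.
Qed.

Lemma ival_eq P A n : nzideal A -> ival_spec P A n -> ival P A = n.
Proof.
move=> nA [ge [x [Ax x0 vx]]]; have [ge' [y [Ay y0 vy]]] := ivalP P nA.
have := (vge_lt P _ x0).1 (ge' x Ax); have := (vge_lt P _ y0).1 (ge y Ay).
by rewrite vx vy => l1 l2; apply/eqP; rewrite eqn_leq l1 l2.
Qed.

Lemma ival_gt0 P A : nzprime P -> nzideal A -> (0 < ival P A)%N <-> A `<=` P.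
Proof.
move=> nP nA; have [ge [x [Ax x0 vx]]] := ivalP P nA.
split=> [gt0 y /ge vy|sAP]; first by apply/vge1 => //; apply: vgeW vy.
by rewrite -vx; apply/(pval_gt0 dedD nP x0)/sAP.
Qed.

Lemma ival_setT P : nzprime P -> ival P setT = 0%N.
Proof.
move=> nP; apply: ival_eq; first exact: nzidealT.
split=> [x _|]; first by right.
exists 1; split; rewrite ?oner_neq0 // pval_eq0 //.
by case: nP => -[].
Qed.

Lemma mul_span_nzideal A B : nzideal A -> nzideal B -> nzideal (mul_span A B).
Proof.
move=> [iA [x Ax x0]] [iB [y By y0]]; split; first exact: mul_span_ideal.
by exists (x * y); [apply: mul_span_mem | apply: mulf_neq0].
Qed.

Lemma ideal_exp_nzideal A n : nzideal A -> nzideal (A ^^+ n).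
Proof.
by move=> nA; elim: n => [|n IHn]; [apply: nzidealT | apply: mul_span_nzideal].
Qed.

Lemma ival_mul P A B : nzprime P -> nzideal A -> nzideal B ->
  ival P (mul_span A B) = (ival P A + ival P B)%N.
Proof.
move=> nP nA nB; apply: ival_eq; first exact: mul_span_nzideal.
have [geA [x [Ax x0 vx]]] := ivalP P nA; have [geB [y [By y0 vy]]] := ivalP P nB.
split; last first.
  exists (x * y); split; rewrite ?mulf_neq0 ?pvalM ?vx ?vy //.
  exact: mul_span_mem.
have iv := vge_ideal dedD (ival P A + ival P B) nP.
apply: mul_span_sub; first exact: ideal0.
  by move=> z z'; apply: idealD.
by move=> a b /geA va /geB vb; apply: vgeM.
Qed.

Lemma ival_exp P A n : nzprime P -> nzideal A ->
  ival P (A ^^+ n) = (n * ival P A)%N.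
Proof.
move=> nP nA; elim: n => [|n IHn]; first exact: ival_setT.
by rewrite [A ^^+ n.+1]/= ival_mul // ?IHn //; apply: ideal_exp_nzideal.
Qed.

(** Otherwise the colon ideal of [x] into [A] lies in a maximal ideal [M]. An element of [A] of
    least order at [M] divides [x] in the localization at [M], and the denominator of that division
    is in the colon ideal but outside [M]. *)
Lemma ideal_mem A x : nzideal A ->
  (forall P, nzprime P -> vge P (ival P A) x) -> A x.
Proof.
move=> nA ge; have [iA [a Aa a0]] := nA; apply: contrapT => Ax.
pose C := [set s | A (s * x)]; have iC : ideal C := ideal_colon x iA.
have C1 : ~ C 1 by rewrite /C /= mul1r.
have [M mM sCM] := maximal_over noD iC C1.
have nM : nzprime M.
  split; first exact: maximal_prime.
  by exists a => //; apply: sCM; apply: ideal_mulr.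
have pM := nzprime_prime nM.
have [_ [b [Ab b0 vb]]] := ivalP M nA.
have := ge M nM; rewrite -vb => /(vgeE dedD _ _ nM)[s' [z [Ms' e']]].
have [s [y [Ms My e]]] := pvalP dedD nM b0.
have: M (y * s').
  apply: sCM; rewrite /C /= -mulrA e' mulrCA mulrA -e -mulrA mulrCA.
  by apply: ideal_mulr.
exact: prime_ideal_mul.
Qed.

Lemma ival_sub A B : nzideal A -> nzideal B ->
  (forall P, nzprime P -> (ival P B <= ival P A)%N) -> A `<=` B.
Proof.
move=> nA nB le x Ax; apply: ideal_mem => // P nP; apply: (vgeW (le P nP)).
by have [+ _] := ivalP P nA; apply.
Qed.

Lemma ival_inj A B : nzideal A -> nzideal B ->
  (forall P, nzprime P -> ival P A = ival P B) -> A = B.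
Proof.
by move=> nA nB e; apply/seteqP; split; apply: ival_sub => // P nP; rewrite e.
Qed.

(** If [x] had smaller order than [A] at some [P], each term [a i * x ^+ (n - i)] of the integral
    equation would have order larger than that of [x ^+ n], so the terms could not cancel. *)
Lemma ideal_closure_id A : nzideal A -> ideal_closure A = A.
Proof.
move=> nA; have [iA _] := nA; apply/seteqP; split=> x; last first.
  move=> Ax; exists 1%N, (fun=> - x); split=> //; last first.
    by rewrite big_nat1 subnn expr0 expr1 mulr1 subrr.
  move=> [|[|i]] // _; rewrite -[- x]mulr1.
  by apply: mul_span_mem => //; apply: idealN.
move=> [n [a [n0 aP e]]]; apply: ideal_mem => // P nP.
have [->|x0] := eqVneq x 0; [by left | right].
rewrite leqNgt; apply/negP => lt.
have: vge P (n * pval P x).+1 (x ^+ n).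
  have iv := vge_ideal dedD (n * pval P x).+1 nP.
  move/eqP: e; rewrite addr_eq0 => /eqP ->; apply: idealN => //.
  rewrite big_nat_cond; apply: ideal_sum => // i /andP[/andP[i1 iltn] _].
  have nAi := ideal_exp_nzideal i nA.
  have [+ _] := ivalP P nAi => /(_ (a i) (aP i _)) ; rewrite i1 -ltnS iltn => /(_ erefl).
  rewrite ival_exp // => va.
  have vx : vge P ((n - i) * pval P x) (x ^+ (n - i)).
    by right; rewrite pvalX.
  apply: vgeW (vgeM dedD nP va vx); rewrite -{1}(subnKC (ltnSE iltn)).
  rewrite mulnDl -addSn leq_add2r.
  by rewrite ltn_mul2l i1.
by move/(vge_lt P _ (expf_neq0 n x0)); rewrite pvalX // ltnn.
Qed.

End IdealValuation.
(** * Valuation rings and Newton polygons *)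

Section ValuationRings.
Variable L : fieldType.
Implicit Types (A B O P : set L) (x y u w : L).

Definition subring A : Prop :=
  [/\ A 1, (forall x y, A x -> A y -> A (x - y)) &
           (forall x y, A x -> A y -> A (x * y))].

Section SubringTheory.
Variable A : set L.
Hypothesis sA : subring A.

Lemma subring1 : A 1. Proof. by case: sA. Qed.
Lemma subringB x y : A x -> A y -> A (x - y). Proof. by case: sA => _ + _; apply. Qed.
Lemma subringM x y : A x -> A y -> A (x * y). Proof. by case: sA => _ _; apply. Qed.
Lemma subring0 : A 0. Proof. by rewrite -(subrr 1); apply: subringB; apply: subring1. Qed.
Lemma subringN x : A x -> A (- x).
Proof. by move=> Ax; rewrite -[- x]add0r; apply: subringB => //; apply: subring0. Qed.
Lemma subringD x y : A x -> A y -> A (x + y).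
Proof. by move=> Ax Ay; rewrite -[y]opprK; apply: subringB => //; apply: subringN. Qed.
Lemma subringX x n : A x -> A (x ^+ n).
Proof.
by move=> Ax; elim: n => [|n IHn]; [apply: subring1 | rewrite exprS; apply: subringM].
Qed.
Lemma subring_sum I (r : seq I) (Q : pred I) (F : I -> L) :
  (forall i, Q i -> A (F i)) -> A (\sum_(i <- r | Q i) F i).
Proof.
by move=> AF; apply: big_ind => //; [apply: subring0 | apply: subringD].
Qed.

End SubringTheory.

Definition valuation_ring O : Prop := subring O /\ forall x, O x \/ O x^-1.

(* Since 0^-1 = 0 lies in O, the element 0 has to be added separately. *)
Definition nonunit O x : Prop := x = 0 \/ ~ O x^-1.

(** * Existence of valuation rings dominating a given subring *)

Section Existence.
Variables A P : set L.
Hypotheses (sA : subring A) (P1 : ~ mul_span P A 1).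

(** Chevalley's argument: a subring that is maximal among those in which [P] still generates a
    proper ideal is a valuation ring, and [P] consists of nonunits of it. *)
Let good B := [/\ subring B, A `<=` B & ~ mul_span P B 1].

Let maximal_good : exists2 B, good B & forall C, good C -> B `<=` C -> C = B.
Proof.
have [|B [gB maxB]] := @Zorn_bigcup L [set B | B = set0 \/ good B].
  move=> F FP totF; case: (pselect (exists2 B, F B & good B)) => [[B0 FB0 gB0]|no].
    right; have sub B x : F B -> B x -> B `<=` \bigcup_(X in F) X /\ good B.
      move=> FB Bx; split; first by move=> y By; exists B.
      by case: (FP B FB) => // e; rewrite e in Bx.
    have two x y : (\bigcup_(X in F) X) x -> (\bigcup_(X in F) X) y ->
        exists B, [/\ F B, good B, B x & B y].
      move=> [B FB Bx] [C FC Cy].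
      have [_ gB] := sub B x FB Bx; have [_ gC] := sub C y FC Cy.
      by case: (totF B C FB FC) => s; [exists C | exists B]; split=> //; apply: s.
    split; last 1 first.
    - move=> [n [a [b [ab e]]]].
      have [C [FC gC Cb]] : exists C, [/\ F C, good C & forall i, C (b i)].
        clear e; elim: n a b ab => [|n IHn] a b ab; first by exists B0; split=> //; case.
        have [i|C [FC gC Cb]] := IHn (fun i => a (lift ord0 i)) (fun i => b (lift ord0 i)).
          exact: ab.
        have [_ [C' FC' Cb']] := ab ord0.
        have [_ gC'] := sub _ _ FC' Cb'.
        case: (totF C C' FC FC') => s; [exists C' | exists C]; split=> // i;
          by case: (unliftP ord0 i) => [j ->|->] //; apply: s.
      have [_ _] := gC; apply; exists n, a, b; split=> // i.
      by have [Pa _] := ab i; split.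
    - split.
      + by exists B0 => //; case: gB0 => -[].
      + move=> x y Ux Uy; have [B [FB [sB _ _] Bx By]] := two x y Ux Uy.
        by exists B => //; apply: subringB.
      + move=> x y Ux Uy; have [B [FB [sB _ _] Bx By]] := two x y Ux Uy.
        by exists B => //; apply: subringM.
    - by move=> x Ax; exists B0 => //; case: gB0 => _ + _; apply.
  left; apply/seteqP; split=> // x [B FB Bx].
  by case: (FP B FB) => [e|gB]; [rewrite e in Bx | case: no; exists B].
have gA : good A by split.
have ne : good B.
  case: gB => // B0; have := maxB A; rewrite B0 => /(_ _) [] //.
    split=> // /(_ 1); apply; exact: subring1.
  by right.
exists B => // C gC sBC; apply: contrapT => neq; apply: (maxB C).
  by split=> // sCB; apply: neq; apply/seteqP.
by right.
Qed.

Section Maximal.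
Variable B : set L.
Hypotheses (gB : good B) (maxB : forall C, good C -> B `<=` C -> C = B).

Let sB : subring B. Proof. by case: gB. Qed.
Let PB := mul_span P B.
Let PB1 : ~ PB 1. Proof. by case: gB. Qed.

Let PB_M s x : B s -> PB x -> PB (s * x).
Proof.
move=> Bs [n [a [b [ab ->]]]]; exists n, a, (fun i => s * b i).
split; last by rewrite mulr_sumr; apply: eq_bigr => i _; rewrite mulrCA.
by move=> i; have [Pa Bb] := ab i; split=> //; apply: subringM.
Qed.

Let PB_sum I (r : seq I) (Q : pred I) (F : I -> L) :
  (forall i, Q i -> PB (F i)) -> PB (\sum_(i <- r | Q i) F i).
Proof.
move=> AF; apply: big_ind => //; [exact: mul_span0 | exact: mul_spanD].
Qed.

(** By maximality [B[x]] is not good, so [P] generates the unit ideal of [B[x]]. Collecting powers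
    of [x] turns this into a polynomial relation with coefficients in [PB]. *)
Let adjoin_relation x : ~ B x -> exists2 p : {poly L},
  (forall i, PB p`_i) & p.[x] = 1.
Proof.
move=> Bx; pose C := [set z | exists2 p : {poly L}, (forall i, B p`_i) & z = p.[x]].
have sBC : B `<=` C.
  move=> z Bz; exists z%:P; last by rewrite hornerC.
  by move=> i; rewrite coefC; case: ifP => // _; apply: subring0.
have CX : C x.
  exists 'X; last by rewrite hornerX.
  by move=> i; rewrite coefX; case: eqP => _; [apply: subring1 | apply: subring0].
have sC : subring C.
  split.
  - by apply: sBC; apply: subring1.
  - move=> _ _ [p Bp ->] [q Bq ->]; exists (p - q); last by rewrite !hornerE.
    by move=> i; rewrite coefB; apply: subringB.
  - move=> _ _ [p Bp ->] [q Bq ->]; exists (p * q); last by rewrite hornerM.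
    by move=> i; rewrite coefM; apply: subring_sum => // j _; apply: subringM.
have sAB : A `<=` B by case: gB.
apply: contrapT => no; apply: Bx; rewrite -(maxB (C := C)) //; split=> //.
  exact: subset_trans sBC.
move=> [n [a [b [ab e]]]].
have ex i : exists p : {poly L}, (forall k, B p`_k) /\ b i = p.[x].
  by have [_ [p Bp ->]] := ab i; exists p.
have [g gP] := choice ex.
apply: no; exists (\sum_i a i *: g i).
  move=> k; rewrite coef_sum; apply: PB_sum => i _; rewrite coefZ.
  by apply: mul_span_mem; [case: (ab i) | case: (gP i)].
rewrite horner_sum e; apply: eq_bigr => i _; rewrite hornerZ.
by case: (gP i) => _ ->.
Qed.

Hypothesis sPA : P `<=` A.

Let PB_sub : PB `<=` B.
Proof.
have sAB : A `<=` B by case: gB.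
apply: mul_span_sub; first exact: subring0.
  by move=> x y; apply: subringD.
by move=> a b /sPA/sAB Ba Bb; apply: subringM.
Qed.

(** If the inverse were missing from [B], its relation multiplied by a power of [1 - c] would put
    that power into [PB]. But every power of [1 - c] is 1 modulo [PB]. *)
Let one_sub_unit c : PB c -> B (1 - c)^-1.
Proof.
move=> PBc; apply: contrapT => /adjoin_relation[p PBp e]; apply: PB1.
have c1 : 1 - c != 0 by apply: contra_notN PB1; rewrite subr_eq0 => /eqP ->.
have Bc : B (1 - c) by apply: subringB => //; [apply: subring1 | apply: PB_sub].
have e1 : PB ((1 - c) ^+ size p).
  have -> : (1 - c) ^+ size p = \sum_(i < size p) ((1 - c) ^+ size p * (1 - c)^-1 ^+ i) * p`_i.
    rewrite -[LHS]mulr1 -[X in _ * X]e horner_coef mulr_sumr.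
    by apply: eq_bigr => i _; rewrite mulrCA mulrC.
  apply: PB_sum => i _; apply: PB_M => //.
  rewrite exprVn -expfB //; exact: subringX.
have : PB (1 - (1 - c) ^+ size p).
  rewrite -[X in X - _](expr1n _ (size p)) subrXX.
  rewrite opprB addrC subrK mulrC; apply: PB_M => //.
  apply: subring_sum => // i _; rewrite expr1n mul1r; exact: subringX.
by move=> e2; have := mul_spanD e1 e2; rewrite addrC subrK.
Qed.

(* The relation for x^-1, multiplied by a power of x, rewrites the leading term
   of the relation for x, so relations of minimal degrees cannot coexist. *)
Let no_two_relations n m x : x != 0 ->
  (exists p : {poly L}, [/\ forall i, PB p`_i, (size p <= n.+1)%N & p.[x] = 1]) ->
  (exists p : {poly L}, [/\ forall i, PB p`_i, (size p <= m.+1)%N & p.[x^-1] = 1]) ->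
  False.
Proof.
have [N] := ubnP (n + m); elim: N n m x => // N IHN n m x.
wlog le_mn : n m x / (m <= n)%N.
  move=> W lt x0 hp hq; case/orP: (leq_total m n) => le; first exact: (W n m x).
  by apply: (W m n x^-1); rewrite ?invr_eq0 ?invrK // addnC.
move=> lt x0 [p [PBp sp ep]] [q [PBq sq eq]].
have q0 : 1 - q`_0 != 0.
  by apply: contra_notN PB1; rewrite subr_eq0 => /eqP ->.
case: n => [|n] in le_mn lt sp *.
  apply: PB1; rewrite -ep (size1_polyC sp) hornerC; exact: PBp.
apply: (IHN n m x) => //; last by exists q.
pose a := p`_n.+1; pose u := (1 - q`_0)^-1.
exists (\poly_(i < n.+1) (p`_i + a * u * q`_(n.+1 - i))); split.
- move=> i; rewrite coef_poly; case: ifP => _; last exact: mul_span0.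
  apply: mul_spanD; [exact: PBp | apply: PB_M; last exact: PBq]; apply: subringM => //.
    exact/PB_sub/PBp.
  exact: one_sub_unit.
- exact: size_poly.
rewrite horner_poly.
under eq_bigr do rewrite mulrDl.
rewrite big_split /=.
have -> : \sum_(i < n.+1) a * u * q`_(n.+1 - i) * x ^+ i = a * x ^+ n.+1.
  have e2 : 1 - q`_0 = \sum_(i < n.+1) q`_i.+1 * x^-1 ^+ i.+1.
    rewrite -eq (horner_coef_wide _ (leq_trans sq (le_mn : m.+1 <= n.+2)%N)).
    by rewrite big_ord_recl /= expr0 mulr1 addrC addKr.
  rewrite (reindex_inj rev_ord_inj) /=.
  under eq_bigr => i _.
    rewrite subKn //.
    have -> : x ^+ (n.+1 - i.+1) = x ^+ n.+1 * x^-1 ^+ i.+1.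
      by rewrite exprVn; apply: (canRL (mulfK _)); rewrite ?expf_neq0 // -exprD subnK.
    rewrite -!mulrA [q`__ * _]mulrCA.
    over.
  by rewrite -!mulr_sumr -e2 /u [x ^+ _ * _]mulrC mulKf.
rewrite -ep (horner_coef_wide _ sp) [in RHS]big_ord_recr /=.
by [].
Qed.

Lemma maximal_valuation_ring : valuation_ring B /\ P `<=` nonunit B.
Proof.
split.
  split=> // x; apply: contrapT => /not_orP[Bx Bx'].
  have x0 : x != 0 by apply: contra_notN Bx => /eqP ->; apply: subring0.
  have [p PBp ep] := adjoin_relation Bx; have [q PBq eq] := adjoin_relation Bx'.
  apply: (@no_two_relations (size p) (size q) x x0).
    by exists p; split.
  by exists q; split.
move=> x Px; have [->|x0] := eqVneq x 0; [by left | right=> Bx].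
apply: PB1; rewrite -(mulVf x0); apply: PB_M => //.
by rewrite -[x]mulr1; apply: (mul_span_mem Px (subring1 sB)).
Qed.

End Maximal.

Lemma valuation_ring_exists : P `<=` A ->
  exists O, [/\ valuation_ring O, A `<=` O & P `<=` nonunit O].
Proof.
move=> sPA; have [B gB maxB] := maximal_good.
have [vB sPB] := maximal_valuation_ring gB maxB sPA.
by exists B; split=> //; case: gB.
Qed.

End Existence.
End ValuationRings.
Section ValuationRingTheory.
Variables (L : fieldType) (O : set L).
Hypothesis vO : valuation_ring O.
Implicit Types (x y z u w : L).

Let sO : subring O. Proof. by case: vO. Qed.
Local Notation m := (nonunit O).

Lemma nonunit_mem x : m x -> O x.
Proof.
by case=> [->|]; [apply: subring0 | case: vO => _ /(_ x)[]].
Qed.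

Lemma nonunitM x y : O x -> m y -> m (x * y).
Proof.
move=> Ox my; have [->|x0] := eqVneq x 0; first by left; rewrite mul0r.
case: my => [->|my]; first by left; rewrite mulr0.
right=> Oxy; apply: my; rewrite -[y^-1](mulKf x0) mulrCA -invfM.
exact: subringM.
Qed.

Lemma nonunitMr x y : m x -> O y -> m (x * y).
Proof. by rewrite mulrC => mx Oy; apply: nonunitM. Qed.

Lemma nonunit1 : ~ m 1.
Proof.
by case=> [/eqP|]; [rewrite oner_eq0 | rewrite invr1; case; apply: subring1].
Qed.

Lemma nonunitD x y : m x -> m y -> m (x + y).
Proof.
have [->|x0] := eqVneq x 0; first by rewrite add0r.
have [->|y0] := eqVneq y 0; first by rewrite addr0.
move=> mx my; case: vO => _ /(_ (x / y))[Oxy|Oyx].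
  have -> : x + y = (x / y + 1) * y by rewrite mulrDl mul1r mulfVK.
  apply: nonunitM => //.
  by apply: subringD => //; apply: subring1.
rewrite invf_div in Oyx.
have -> : x + y = (y / x + 1) * x by rewrite mulrDl mul1r mulfVK // addrC.
apply: nonunitM => //.
by apply: subringD => //; apply: subring1.
Qed.

Lemma nonunitN x : m x -> m (- x).
Proof.
rewrite -mulN1r; apply: nonunitM; apply: subringN => //; exact: subring1.
Qed.

Lemma nonunit_sum I (r : seq I) (Q : pred I) (F : I -> L) :
  (forall i, Q i -> m (F i)) -> m (\sum_(i <- r | Q i) F i).
Proof.
by move=> mF; apply: big_ind => //; [left | apply: nonunitD].
Qed.

Lemma nonunit_prime x y : O x -> O y -> m (x * y) -> m x \/ m y.
Proof.
move=> Ox Oy [/eqP|]; first by rewrite mulf_eq0 => /orP[] /eqP ->; [left|right]; left.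
move=> Oxy; case: (pselect (O x^-1)) => Ox'; last by left; right.
right; right=> Oy'; apply: Oxy; rewrite invfM; exact: subringM.
Qed.

Lemma nonunit_exp x n : O x -> m (x ^+ n) -> m x.
Proof.
move=> Ox; elim: n => [/nonunit1//|n IHn]; rewrite exprS.
by case/nonunit_prime => //; apply: subringX.
Qed.

Lemma nonunitX x n : m x -> (0 < n)%N -> m (x ^+ n).
Proof.
case: n => // n mx _; rewrite exprSr; apply: nonunitM => //.
by apply: subringX => //; apply: nonunit_mem.
Qed.

Lemma valuation_ring_integral (p : {poly L}) x :
  p \is monic -> (forall i, O p`_i) -> root p x -> O x.
Proof.
move=> mp Op /rootP px; apply: contrapT => Ox.
have x0 : x != 0 by apply: contra_notN Ox => /eqP ->; apply: subring0.
have mx : m x^-1 by right; rewrite invrK.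
have p0 : (0 < size p)%N by rewrite lt0n size_poly_eq0 monic_neq0.
pose n := (size p).-1; have sn : size p = n.+1 by rewrite prednK.
apply: nonunit1; move: px; rewrite horner_coef sn big_ord_recr /=.
have -> : p`_n = 1 by move/monicP: mp.
rewrite mul1r => /eqP; rewrite addrC addr_eq0 => /eqP e.
rewrite -(mulfV (expf_neq0 n x0)) {1}e mulNr mulr_suml; apply: nonunitN.
apply: nonunit_sum => i _; rewrite -mulrA; apply: nonunitM => //.
rewrite -exprVn.
have -> : x ^+ i * x^-1 ^+ n = x^-1 ^+ (n - i).
  rewrite !exprVn; apply: (canLR (mulfK _)); first by rewrite expf_neq0.
  by rewrite mulrC; apply: (canRL (mulfK _)); rewrite ?expf_neq0 // -exprD subnKC // ltnW.
by apply: nonunitX; rewrite ?subn_gt0.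
Qed.

(** Equality of values for the valuation of [O], expressed without a value group. *)
Definition associate x y : Prop :=
  exists u, [/\ u != 0, O u, O u^-1 & x = u * y].

Lemma assoc_refl x : associate x x.
Proof. by exists 1; rewrite mul1r invr1 oner_neq0; split=> //; apply: subring1. Qed.

Lemma assoc_sym x y : associate x y -> associate y x.
Proof.
move=> [u [u0 Ou Ou' ->]]; exists u^-1.
by rewrite invr_eq0 invrK mulKf.
Qed.

Lemma assocM x y z w : associate x y -> associate z w -> associate (x * z) (y * w).
Proof.
move=> [u [u0 Ou Ou' ->]] [v [v0 Ov Ov' ->]]; exists (u * v).
rewrite mulf_neq0 // invfM mulrACA; split=> //; exact: subringM.
Qed.

Lemma assoc_trans x y z : associate x y -> associate y z -> associate x z.
Proof.
move=> [u [u0 Ou Ou' ->]] [v [v0 Ov Ov' ->]]; exists (u * v).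
rewrite mulf_neq0 // invfM mulrA; split=> //; exact: subringM.
Qed.

Lemma assocX x y n : associate x y -> associate (x ^+ n) (y ^+ n).
Proof.
move=> xy; elim: n => [|n IHn]; first exact: assoc_refl.
by rewrite !exprS; apply: assocM.
Qed.

Lemma assocN x y : associate x y -> associate (- x) y.
Proof.
move=> [u [u0 Ou Ou' ->]]; exists (- u).
by rewrite oppr_eq0 invrN mulNr; split=> //; apply: subringN.
Qed.

Lemma assoc_unit x : O x -> ~ m x -> associate x 1.
Proof.
move=> Ox mx; exists x; rewrite mulr1; split=> //.
  by apply: contra_notN mx => /eqP ->; left.
by apply: contrapT => Ox'; apply: mx; right.
Qed.

Lemma assoc_neq0 x y : associate x y -> y != 0 -> x != 0.
Proof. by move=> [u [u0 _ _ ->]] y0; rewrite mulf_neq0. Qed.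

Lemma assoc_expI w n k : m w -> w != 0 -> associate (w ^+ n) (w ^+ k) -> n = k.
Proof.
move=> mw w0; wlog lt : n k / (n < k)%N.
  move=> W a; case: (ltngtP n k) => // lt; first exact: W.
  by apply/esym; apply: W => //; apply: assoc_sym.
move=> /assoc_sym[u [u0 _ Ou' e]]; case: nonunit1.
have -> : 1 = u^-1 * w ^+ (k - n).
  by rewrite expfB // e -mulrA mulfV ?expf_neq0 // mulr1 mulVf.
by apply: nonunitM => //; apply: nonunitX; rewrite ?subn_gt0.
Qed.

Section DedekindMap.
Variables (R : idomainType) (phi : {rmorphism R -> L}).
Hypotheses (dedR : dedekind R) (phi_inj : injective phi).
Hypothesis phiO : forall r, O (phi r).

Definition center : set R := [set r | m (phi r)].

Lemma center_nzprime (r : R) : m (phi r) -> r != 0 -> nzprime center.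
Proof.
move=> mr r0; split; last by exists r.
split.
- split=> //=; first by rewrite /center /= rmorph0; left.
  + by move=> x y mx my; rewrite /center /= rmorphD; apply: nonunitD.
  + by move=> s x _ mx; rewrite /center /= rmorphM; apply: nonunitM.
- by rewrite /center /= rmorph1; apply: nonunit1.
- by move=> x y _ _; rewrite /center /= rmorphM; apply: nonunit_prime.
Qed.

(** Elements of [R] outside the center become units of [O]. So the valuation of [O], restricted to
    [R], is the order at the center, measured in multiples of the value of a uniformizer. *)
Lemma center_pval (x : R) : nzprime center -> x != 0 ->
  associate (phi x) (phi (unif center).1 ^+ pval center x).
Proof.
move=> nN x0; have [s [y [Ns Ny e]]] := pvalP dedR nN x0.
have := congr1 phi e; rewrite !rmorphM rmorphXn => e'.
have us : associate (phi s) 1 by apply: assoc_unit.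
have uy : associate (phi y) 1 by apply: assoc_unit.
rewrite -[phi x]mul1r -[_ ^+ _]mulr1.
apply: (@assoc_trans _ (phi s * phi x)).
  by apply: assocM; [apply: assoc_sym | apply: assoc_refl].
by rewrite e'; apply: assocM => //; apply: assoc_refl.
Qed.

Lemma center_unif : nzprime center ->
  m (phi (unif center).1) /\ phi (unif center).1 != 0.
Proof.
move=> nN; have [Npi pi0 _ _] := unifP dedR nN; split=> //.
by rewrite -(rmorph0 phi) (inj_eq phi_inj).
Qed.

End DedekindMap.

(* The polynomial with coefficients c k has a Newton polygon with the b edges of
   width e and slopes kap j / e, j < b. Its vertices, counted from the leading
   coefficient, sit at the exponents (b - t) * e and heights newton_ord t. *)
Section Newton.
Variables (w : L) (b e : nat) (kap : nat -> nat) (c : nat -> L).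
Hypotheses (mw : m w) (w0 : w != 0) (b0 : (0 < b)%N) (e0 : (0 < e)%N).
Hypothesis kap_gt0 : forall j, (0 < kap j)%N.
Hypothesis kap_lt : forall i j, (i < j)%N -> (kap i < kap j)%N.

Definition newton_ord t : nat := (\sum_(j < t) kap j)%N.
Local Notation S := newton_ord.

Hypothesis c_vertex : forall t, (t <= b)%N -> associate (c ((b - t) * e)%N) (w ^+ S t).
Hypothesis c_other : forall k, (k < b * e)%N -> ~~ (e %| k)%N ->
  exists2 z, O z & c k = w ^+ S b * z.
Hypothesis c_monic : c (b * e)%N = 1.

Let Ow : O w := nonunit_mem mw.

Let S_gt0 t : (0 < t)%N -> (0 < S t)%N.
Proof.
by case: t => // t _; rewrite /S big_ord_recr /=; apply: ltn_addl.
Qed.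

(** If [x ^+ e] had none of the values [w ^+ kap j], its value would fall strictly between two
    consecutive ones, or beyond all of them, and a single vertex term would have strictly least
    value in a sum equal to 0. The terms off the vertices do not interfere: their coefficients are
    divisible by [w ^+ S b], the value of the constant term, and they carry a positive power of the
    nonunit [x]. *)
Lemma newton_root x : O x -> \sum_(k < (b * e).+1) c k * x ^+ k = 0 ->
  exists2 j, (j < b)%N & associate (x ^+ e) (w ^+ kap j).
Proof.
move=> Ox sum0; pose d := (b * e)%N.
have mc k : (k < d)%N -> m (c k).
  move=> lt; have [/dvdnP[l lk]|ndiv] := boolP (e %| k)%N.
    have lb : (l < b)%N by move: lt; rewrite lk /d ltn_mul2r => /andP[].
    have [|u [_ Ou _]] := c_vertex (t := b - l); first exact: leq_subr.
    rewrite subKn ?(ltnW lb) // -lk => ->; apply: nonunitM => //.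
    by apply: nonunitX => //; apply: S_gt0; rewrite subn_gt0.
  have [z Oz ->] := c_other lt ndiv; apply: nonunitMr => //.
  by apply: nonunitX => //; apply: S_gt0.
have mx : m x.
  apply: (@nonunit_exp _ d) => //; move: sum0; rewrite big_ord_recr /= c_monic mul1r.
  move=> /eqP; rewrite addrC addr_eq0 => /eqP ->; apply/nonunitN/nonunit_sum => i _.
  by apply: nonunitMr; [apply: mc | apply: subringX].
have c0 : c 0%N != 0.
  have := c_vertex (leqnn b); rewrite subnn mul0n => /assoc_neq0; apply.
  exact: expf_neq0.
have d0 : (0 < d)%N by rewrite muln_gt0 b0.
have x0 : x != 0.
  apply: contraNneq c0 => x0; move: sum0; rewrite big_ord_recl /= expr0 mulr1.
  rewrite big1 ?addr0 => [->//|i _]; by rewrite x0 exprS mul0r mulr0.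
apply: contrapT => no; pose y := x ^+ e.
have y0 : y != 0 by rewrite expf_neq0.
have wn n : w ^+ n != 0 by rewrite expf_neq0.
(* t is the index of the dominant vertex term. *)
have [t tb [low high]] : exists2 t, (t <= b)%N &
    (forall j, (j < t)%N -> m (y / w ^+ kap j)) /\
    (forall j, (t <= j)%N -> (j < b)%N -> m (w ^+ kap j / y)).
  have dich j : (j < b)%N -> ~ m (w ^+ kap j / y) -> m (y / w ^+ kap j).
    move=> jb nm; apply: contrapT => nm'; apply: no; exists j => //.
    have O1 : O (y / w ^+ kap j).
      by apply: contrapT => nO; apply: nm; right; rewrite invf_div.
    have := assoc_unit O1 nm'; move=> /(assocM (assoc_refl (w ^+ kap j))).
    by rewrite mulr1 mulrCA mulfV // mulr1.
  pose p j := `[< (b <= j)%N \/ m (w ^+ kap j / y) >].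
  have ex : exists j, p j by exists b; apply/asboolP; left.
  case: (ex_minnP ex) => t /asboolP pt tmin.
  have tb : (t <= b)%N by apply: tmin; apply/asboolP; left.
  exists t => //; split=> [j jt|j tj jb].
    apply: dich; first exact: leq_trans jt tb.
    by move=> mj; have := tmin j; rewrite leqNgt jt => /(_ _)/negP[] //; apply/asboolP; right.
  case: pt => [bt|mt]; first by have := leq_trans bt tj; rewrite leqNgt jb.
  have [->//|ne] := eqVneq j t.
  have lt : (t < j)%N by rewrite ltn_neqAle eq_sym ne.
  rewrite -(subnK (ltnW (kap_lt lt))).
  by rewrite exprD -mulrA; apply: nonunitM => //; apply: subringX.
(* [T k] has the value of the term at vertex [k]. The quotient [T k.+1 / T k] is [w ^+ kap k / y]: a
   nonunit from [t] on, the inverse of a nonunit before [t]. So the values increase strictly away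
   from [t] on both sides. *)
pose T k := w ^+ S k * y ^+ (b - k).
have T0 k : T k != 0 by rewrite mulf_neq0 ?expf_neq0.
have TS k : (k < b)%N -> T k.+1 = T k * (w ^+ kap k / y).
  move=> kb; rewrite /T /S big_ord_recr /= exprD -/(S k).
  have -> : (b - k)%N = (b - k.+1).+1 by rewrite -subSn.
  rewrite exprSr -!mulrA; congr (_ * _); rewrite [y * _]mulrCA mulfV // mulr1.
  by rewrite mulrC.
have Tlow k : (k <= t)%N -> O (T (t - k)%N / T t) /\ ((0 < k)%N -> m (T (t - k)%N / T t)).
  elim: k => [_|k IHk kt]; first by rewrite subn0 mulfV //; split=> //; apply: subring1.
  have [Ok _] := IHk (ltnW kt).
  have lt : (t - k.+1 < t)%N by rewrite ltn_subrL (leq_ltn_trans _ kt).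
  suff mk : m (T (t - k.+1)%N / T t) by split=> //; apply: nonunit_mem.
  have -> : T (t - k.+1)%N / T t = (y / w ^+ kap (t - k.+1)%N) * (T (t - k)%N / T t).
    have -> : (t - k)%N = (t - k.+1).+1 by rewrite -subSn.
    rewrite TS ?(leq_trans lt) // mulrA; congr (_ / _).
    rewrite mulrCA -[_ / y]invf_div mulfV ?mulr1 //.
    by rewrite mulf_neq0 ?invr_eq0.
  by apply: nonunitMr => //; apply: low.
have Thigh k : (t + k <= b)%N -> O (T (t + k)%N / T t) /\ ((0 < k)%N -> m (T (t + k)%N / T t)).
  elim: k => [_|k IHk kt]; first by rewrite addn0 mulfV //; split=> //; apply: subring1.
  rewrite addnS in kt; have [Ok _] := IHk (ltnW kt).
  suff mk : m (T (t + k.+1)%N / T t) by split=> //; apply: nonunit_mem.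
  rewrite addnS TS // mulrAC; apply: nonunitM => //; apply: high => //.
  exact: leq_addr.
have Tm l : (l <= b)%N -> l != t -> m (T l / T t).
  move=> lb ne; case: (ltngtP l t) => [lt|gt|e1].
  - have [_] := Tlow (t - l)%N (leq_subr _ _); rewrite subKn ?(ltnW lt) //.
    by apply; rewrite subn_gt0.
  - have := Thigh (l - t)%N; rewrite subnKC ?(ltnW gt) // => /(_ lb)[_]; apply.
    by rewrite subn_gt0.
  - by rewrite e1 eqxx in ne.
have vertexE l : (l <= b)%N -> exists u, [/\ u != 0, O u, O u^-1 &
    c ((b - l) * e)%N * x ^+ ((b - l) * e) / T t = u * (T l / T t)].
  move=> lb; have [u [u0 Ou Ou' ->]] := c_vertex lb; exists u; split=> //.
  by rewrite /T /y -!exprM !(mulnC e) -!mulrA.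
have kd : ((b - t) * e < d.+1)%N by rewrite ltnS leq_mul2r leq_subr orbT.
have := congr1 (fun z => z / T t) sum0; rewrite mul0r mulr_suml.
rewrite (bigD1 (Ordinal kd)) //= => /eqP; rewrite addr_eq0 => /eqP eT.
have [u [u0 Ou Ou' eu]] := vertexE t tb.
have: m u.
  rewrite mulfV // mulr1 in eu; rewrite -eu eT; apply/nonunitN/nonunit_sum => k nk.
  have [/dvdnP[l lk]|ndiv] := boolP (e %| k)%N.
    have lb : (l <= b)%N.
      by have := ltn_ord k; rewrite ltnS lk leq_mul2r eqn0Ngt e0.
    have [u1 [_ Ou1 _]] := vertexE (b - l)%N (leq_subr _ _).
    rewrite subKn // lk => ->; apply: nonunitM => //; apply: Tm; first exact: leq_subr.
    apply: contraNneq nk => e1; apply/eqP/val_inj => /=.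
    by rewrite lk -e1 subKn.
  have ltk : (k < d)%N.
    have := ltn_ord k; rewrite ltnS leq_eqVlt => /orP[/eqP ed|//].
    by move: ndiv; rewrite ed /d dvdn_mull.
  have [z Oz ->] := c_other ltk ndiv.
  have -> : w ^+ S b * z * x ^+ k / T t = (z * x ^+ k) * (T b / T t).
    by rewrite /T subnn expr0 mulr1 [z * _ * _]mulrCA !mulrA mulrAC.
  apply: nonunitMr; last first.
    by have [] := Thigh (b - t)%N; rewrite subnKC.
  apply: nonunitM => //; apply: nonunitX => //.
  by rewrite lt0n; apply: contraNneq ndiv => ->; rewrite dvdn0.
case=> [u0'|]; [by rewrite u0' eqxx in u0 | by []].
Qed.

End Newton.
End ValuationRingTheory.

(** * Reading multiplicities as digits *)

Lemma digits_uniq M b (n n' : nat -> nat) :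
  (forall j, n j < M)%N -> (forall j, n' j < M)%N ->
  (\sum_(j < b) n j * M ^ j = \sum_(j < b) n' j * M ^ j)%N ->
  forall j, (j < b)%N -> n j = n' j.
Proof.
move=> nM n'M; elim: b n n' nM n'M => // b IHb n n' nM n'M.
rewrite !big_ord_recl /= !expn0 !muln1.
have pull (f : nat -> nat) :
    (\sum_(i < b) f (bump 0 i) * M ^ bump 0 i = (\sum_(i < b) f i.+1 * M ^ i) * M)%N.
  by rewrite big_distrl /=; apply: eq_bigr => i _; rewrite /bump add1n expnSr mulnA.
rewrite !pull => e; have M0 : (0 < M)%N by apply: leq_ltn_trans (nM 0%N).
have cong a q : (a < M)%N -> ((a + q * M) %% M = a)%N.
  by move=> aM; rewrite addnC modnMDl modn_small.
have := congr1 (modn^~ M) e; rewrite /= !cong // => e0.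
move: e; rewrite e0 => /addnI/eqP; rewrite eqn_pmul2r // => /eqP e.
case=> [//|j]; rewrite ltnS => jb.
exact: (IHb (fun j => n j.+1) (fun j => n' j.+1)).
Qed.

(** The multiplicity of [j] in [s] is below [M], so it is the digit at [M ^ j] of the left-hand sum.
    On the right all digits are [e], which is positive. *)
Lemma digits_occur M b e (s : seq nat) :
  (all (fun j => j < b) s)%N -> (size s < M)%N -> (0 < e < M)%N ->
  (\sum_(j <- s) M ^ j = e * \sum_(j < b) M ^ j)%N ->
  forall j, (j < b)%N -> j \in s.
Proof.
move=> /allP sb sM /andP[e0 eM] E j jb.
have: (\sum_(j < b) count_mem (j : nat) s * M ^ j = \sum_(j < b) e * M ^ j)%N.
  rewrite -[RHS]big_distrr /= -E.
  under eq_bigr do rewrite -sum1_count big_distrl /=.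
  rewrite (exchange_big_dep xpredT) //= big_seq [RHS]big_seq.
  apply: eq_bigr => i /sb ib.
  by rewrite (big_pred1 (Ordinal ib)) ?mul1n.
move=> /(@digits_uniq M b (fun j => count_mem j s) (fun=> e)) H.
have : count_mem j s = e.
  by apply: H => // k; apply: leq_ltn_trans (count_size _ _) sM.
by move=> cj; rewrite -has_pred1 has_count cj.
Qed.
(** * The integral closure in a simple separable extension *)

Section FractionLift.
Variables (D : idomainType) (K : fieldType) (h : {rmorphism D -> K}).
Hypothesis h_inj : injective h.

(* The proof argument is what the ring morphism structure is attached to. *)
Definition frac_lift of injective h := fun x : {fraction D} =>
  h \n_(repr x) / h \d_(repr x).

Local Notation lift := (frac_lift h_inj).

Lemma inj_neq0 a : a != 0 -> h a != 0.
Proof. by rewrite -(rmorph0 h) (inj_eq h_inj). Qed.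

Lemma frac_liftE a b : b != 0 -> lift (a%:F / b%:F) = h a / h b.
Proof.
move=> b0; rewrite /frac_lift; set x := a%:F / b%:F.
have q0 : \d_(repr x) != 0 by exact: denom_ratioP.
apply/eqP; rewrite eqr_div ?inj_neq0 // -!rmorphM (inj_eq h_inj).
rewrite -tofrac_eq !tofracM -eqr_div ?tofrac_eq0 //.
by rewrite -frac_repr.
Qed.

Lemma frac_ind (x : {fraction D}) : exists a b, b != 0 /\ x = a%:F / b%:F.
Proof.
exists \n_(repr x), \d_(repr x); split; first exact: denom_ratioP.
exact: frac_repr.
Qed.

Fact frac_lift_zmod : zmod_morphism lift.
Proof.
move=> x y; have [a [b [b0 ->]]] := frac_ind x; have [c [d [d0 ->]]] := frac_ind y.
rewrite -mulNr addf_div ?tofrac_eq0 // -tofracN -!tofracM -tofracD.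
rewrite !frac_liftE ?mulf_neq0 // rmorphD !rmorphM rmorphN.
by rewrite -[- (h c / h d)]mulNr addf_div ?inj_neq0.
Qed.

HB.instance Definition _ :=
  GRing.isZmodMorphism.Build {fraction D} K lift frac_lift_zmod.

Fact frac_lift_monoid : monoid_morphism lift.
Proof.
split.
  have -> : 1 = 1%:F / 1%:F :> {fraction D} by rewrite divff ?tofrac_eq0 ?oner_eq0.
  by rewrite frac_liftE ?oner_eq0 // divff // inj_neq0 ?oner_eq0.
move=> x y; have [a [b [b0 ->]]] := frac_ind x; have [c [d [d0 ->]]] := frac_ind y.
rewrite mulf_div -!tofracM !frac_liftE ?mulf_neq0 // !rmorphM.
by rewrite mulf_div.
Qed.

HB.instance Definition _ :=
  GRing.isMonoidMorphism.Build {fraction D} K lift frac_lift_monoid.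

Lemma frac_lift_tofrac a : lift a%:F = h a.
Proof.
have := frac_liftE a (oner_neq0 D).
by rewrite tofrac1 rmorph1 !divr1.
Qed.

End FractionLift.

Lemma common_denominator (D : idomainType) n (c : 'I_n -> {fraction D}) :
  exists2 a : D, a != 0 & exists b : 'I_n -> D, forall i, a%:F * c i = (b i)%:F.
Proof.
have ex i : exists nd : D * D, nd.2 != 0 /\ c i = nd.1%:F / nd.2%:F.
  by have [a [b H]] := frac_ind (c i); exists (a, b).
have [nd ndP] := boolp.choice ex.
exists (\prod_i (nd i).2).
  by apply/prodf_neq0 => i _; case: (ndP i).
exists (fun i => (nd i).1 * \prod_(j | j != i) (nd j).2) => i.
have [d0 ->] := ndP i; rewrite (bigD1 i) //= !tofracM [LHS]mulrC mulrA.
by rewrite mulfVK ?tofrac_eq0.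
Qed.

Lemma irreducible_factor (F : fieldType) (p : {poly F}) : (1 < size p)%N ->
  exists2 q, irreducible_poly q & q %| p.
Proof.
move=> sp; have p0 : p != 0 by rewrite -size_poly_gt0 ltnW.
pose P n := `[< exists q : {poly F}, [/\ size q = n, (1 < n)%N & q %| p] >].
have : exists n, P n by exists (size p); apply/asboolP; exists p.
case/ex_minnP => n /asboolP[q [sq n1 qp]] min; exists q => //; split=> [|r sr rq].
  by rewrite sq.
have r1 : (1 < size r)%N.
  rewrite ltn_neqAle eq_sym sr lt0n size_poly_eq0; apply: contraNneq p0 => r0.
  by rewrite -dvd0p -r0 (dvdp_trans rq).
have le : (n <= size r)%N.
  by apply: min; apply/asboolP; exists r; split=> //; apply: dvdp_trans qp.
rewrite -(dvdp_size_eqp rq) sq eqn_leq le andbT -sq dvdp_leq //.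
by rewrite -size_poly_gt0 sq ltnW.
Qed.

(** Adjoining a root changes the base field, so the induction on the degree runs over all fields at
    once. The result is a bare field with a morphism from [F], the composite of a tower of simple
    extensions. *)
Lemma splitting_field_exists (F : fieldType) (p : {poly F}) : p \is monic ->
  exists (L : fieldType) (iota : {rmorphism F -> L}) (rs : seq L),
    map_poly iota p = \prod_(r <- rs) ('X - r%:P).
Proof.
have [n] := ubnP (size p); elim: n F p => // n IHn F p sp mp.
have [s1 | s1] := leqP (size p) 1.
  exists F, idfun, [::]; rewrite big_nil map_poly_id //.
  move: mp => /monicP; rewrite {1}(size1_polyC s1) lead_coefC => p1.
  by rewrite (size1_polyC s1) p1.
have [q irr_q qp] := irreducible_factor s1.
have [L _ [z qz _]] := irredp_FAdjoin irr_q.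
have : root (map_poly (in_alg L) p) z.
  by rewrite -dvdp_XsubCl (dvdp_trans _ (_ : map_poly (in_alg L) q %| _)) ?dvdp_map ?dvdp_XsubCl.
move=> /factor_theorem[p' ep].
have mp' : p' \is monic by rewrite -(monicMr _ (monicXsubC z)) -ep map_monic.
have [|L' [iota [rs e]]] := IHn L p' _ mp'.
  have := size_map_poly (in_alg L) p; rewrite ep size_Mmonic ?monic_neq0 ?monicXsubC //.
  by rewrite size_XsubC addn2 /= => e; rewrite -ltnS e.
exists L', (iota \o in_alg L), (iota z :: rs).
rewrite map_poly_comp /= ep rmorphM /= e mulrC big_cons.
by rewrite rmorphB /= map_polyX map_polyC.
Qed.
Section IntegralClosure.
Variables (D : idomainType) (K : fieldType) (h : {rmorphism D -> K}).

Definition integral_elt : {pred K} := [pred y | `[< integralOver h y >]].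

Fact integral_elt_subring : subring_closed integral_elt.
Proof.
split; first by apply/asboolP/integral1.
  by move=> x y /asboolP ix /asboolP iy; apply/asboolP/integral_sub.
by move=> x y /asboolP ix /asboolP iy; apply/asboolP/integral_mul.
Qed.

HB.instance Definition _ :=
  GRing.isSubringClosed.Build K integral_elt integral_elt_subring.

Record int_closure := IntClosure {
  int_val : K; int_valP : int_val \in integral_elt }.

HB.instance Definition _ := [isSub for int_val].
HB.instance Definition _ := [Choice of int_closure by <:].
HB.instance Definition _ := [SubChoice_isSubComNzRing of int_closure by <:].

(** An [idomainType] includes a boolean unit predicate and a total inverse; both are supplied by
    classical choice. *)
Definition ic_unit : pred int_closure := [pred x | `[< exists y, y * x = 1 >]].
Definition ic_inv (x : int_closure) : int_closure :=
  if pselect (exists y, y * x = 1) is left ex then sval (cid ex) else x.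

Fact ic_mulVr : {in ic_unit, left_inverse 1 ic_inv *%R}.
Proof.
move=> x /asboolP ex; rewrite /ic_inv; case: pselect => // ex'.
exact: svalP (cid ex').
Qed.

Fact ic_unitP (x y : int_closure) : y * x = 1 -> ic_unit x.
Proof. by move=> e; apply/asboolP; exists y. Qed.

Fact ic_inv_out : {in [predC ic_unit], ic_inv =1 id}.
Proof.
move=> x; rewrite inE /= => /asboolP nex; rewrite /ic_inv.
by case: pselect.
Qed.

HB.instance Definition _ :=
  GRing.ComNzRing_hasMulInverse.Build int_closure ic_mulVr ic_unitP ic_inv_out.

Fact ic_idomain (x y : int_closure) : x * y = 0 -> (x == 0) || (y == 0).
Proof.
move=> xy0; have : int_val x * int_val y = 0 by rewrite -[LHS]/(int_val (x * y)) xy0.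
by move/eqP; rewrite mulf_eq0.
Qed.

HB.instance Definition _ := GRing.ComUnitRing_isIntegral.Build int_closure ic_idomain.

Definition ic_embed (a : D) : int_closure :=
  IntClosure (asboolT (integral_id h a)).

Fact ic_embed_zmod : zmod_morphism ic_embed.
Proof. by move=> a b; apply: val_inj; rewrite /= rmorphB. Qed.
HB.instance Definition _ := GRing.isZmodMorphism.Build D int_closure ic_embed ic_embed_zmod.

Fact ic_embed_monoid : monoid_morphism ic_embed.
Proof.
by split=> [|a b]; apply: val_inj; rewrite /= ?rmorph1 ?rmorphM.
Qed.
HB.instance Definition _ := GRing.isMonoidMorphism.Build D int_closure ic_embed ic_embed_monoid.

Definition ic_val : {rmorphism int_closure -> K} := val.

Lemma ic_val_inj : injective ic_val. Proof. exact: val_inj. Qed.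

Lemma ic_val_embed a : ic_val (ic_embed a) = h a. Proof. by []. Qed.

Lemma ic_val_integral (x : int_closure) : integralOver h (ic_val x).
Proof. by case: x => y iy; apply/asboolP. Qed.

Lemma ic_val_onto y : integralOver h y -> exists x, ic_val x = y.
Proof. by move=> iy; exists (IntClosure (asboolT iy)). Qed.

Lemma ic_integralRange : integralRange ic_embed.
Proof.
move=> x; have [p mp /rootP px] := ic_val_integral x; exists p => //.
apply/rootP; apply: ic_val_inj; rewrite rmorph0 -horner_map -[RHS]px.
by rewrite -map_poly_comp.
Qed.

Lemma ic_embed_inj : injective h -> injective ic_embed.
Proof. by move=> h_inj a b /(congr1 ic_val); rewrite !ic_val_embed => /h_inj. Qed.

End IntegralClosure.
Arguments ic_val {D K h}.

(** * Simple extensions: power basis, conjugates, separability *)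

Section SimpleExtension.
Variables (F : fieldType) (p : {poly F}) (L : fieldExtType F) (z : L).
Hypotheses (mp : p \is monic) (irr_p : irreducible_poly p).
Hypotheses (pz : root (map_poly (in_alg L) p) z) (gen_z : <<1; z>>%VS = fullv).

Definition ev (q : {poly F}) : L := (map_poly (in_alg L) q).[z].

Lemma ev_is_additive q r : ev (q - r) = ev q - ev r.
Proof. by rewrite /ev rmorphB !hornerE. Qed.

Lemma evM q r : ev (q * r) = ev q * ev r.
Proof. by rewrite /ev rmorphM hornerM. Qed.

Lemma ev_onto y : exists q, y = ev q.
Proof. by apply/Fadjoin1_polyP; rewrite gen_z memvf. Qed.

Lemma ev_eq0 q : ev q = 0 <-> p %| q.
Proof.
split=> [q0|/dvdpP[r ->]]; last by rewrite evM /ev (rootP pz) mulr0.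
apply: contrapT => /negP; rewrite -irreducible_poly_coprime //.
case/Bezout_coprimepP=> u; rewrite eqp_sym => /eqpP[[a b] /= /andP[a0 b0] e].
have p0 : ev p = 0 by apply: rootP.
have e0 : ev (u.1 * p + u.2 * q) = 0.
  by rewrite /ev rmorphD hornerD -/(ev (u.1 * p)) -/(ev (u.2 * q)) !evM p0 q0 !mulr0 addr0.
have := congr1 ev e; rewrite -!mul_polyC !evM e0 mulr0 /ev rmorph1 hornerC mulr1.
by rewrite map_polyC hornerC => /eqP; rewrite fmorph_eq0 (negPf a0).
Qed.

Lemma power_basis y : exists c : 'I_(size p).-1 -> F, y = \sum_i c i *: z ^+ i.
Proof.
have [q ->] := ev_onto y; exists (fun i => (q %% p)`_i).
have -> : ev q = ev (q %% p).
  apply/eqP; rewrite -subr_eq0 -ev_is_additive; apply/eqP/ev_eq0.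
  by rewrite {1}(divp_eq q p) addrK dvdp_mulIr.
have sp : size p = (size p).-1.+1 by rewrite prednK // size_poly_gt0 monic_neq0.
have sq : (size (map_poly (in_alg L) (q %% p)) <= (size p).-1)%N.
  by rewrite size_map_poly -ltnS -sp ltn_modp monic_neq0.
rewrite /ev (horner_coef_wide _ sq); apply: eq_bigr => i _.
by rewrite coef_map /= mulr_algl.
Qed.

Lemma power_basis_uniq (c c' : 'I_(size p).-1 -> F) :
  \sum_i c i *: z ^+ i = \sum_i c' i *: z ^+ i -> c =1 c'.
Proof.
move=> e; pose q := \poly_(i < (size p).-1) (if insub i is Some j then c j - c' j else 0).
have coq (i : 'I_(size p).-1) : q`_i = c i - c' i by rewrite coef_poly ltn_ord valK.
have sq : (size q <= (size p).-1)%N by apply: size_poly.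
have p0 := monic_neq0 mp.
have: ev q = 0.
  have sq' : (size (map_poly (in_alg L) q) <= (size p).-1)%N by rewrite size_map_poly.
  rewrite /ev (horner_coef_wide _ sq') -[RHS](subrr (\sum_i c i *: z ^+ i)) {2}e -sumrB.
  by apply: eq_bigr => i _; rewrite coef_map /= mulr_algl coq scalerBl.
move=> /ev_eq0 pq i; apply/eqP; rewrite -subr_eq0 -coq.
suff -> : q = 0 by rewrite coef0.
apply: contraTeq pq => q0; apply/negP => /(dvdp_leq q0); apply/negP.
by rewrite -ltnNge (leq_ltn_trans sq) // prednK // size_poly_gt0.
Qed.

Section Conjugate.
Variables (M : fieldType) (iota : {rmorphism F -> M}) (r : M).
Hypothesis pr : root (map_poly iota p) r.

(** The image of [y] is computed from any polynomial representing [y]: two of them differ by a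
    multiple of [p], which vanishes at [r]. As [M] is only a field receiving [F] through [iota], the
    result is a ring morphism compatible with [iota]. *)
Lemma conjugation_exists : exists phi : {rmorphism L -> M},
  phi z = r /\ forall a, phi a%:A = iota a.
Proof.
have [Q QP] := boolp.choice ev_onto.
pose phi y := (map_poly iota (Q y)).[r].
have phiE q : phi (ev q) = (map_poly iota q).[r].
  apply/eqP; rewrite -subr_eq0 /phi -hornerN -hornerD -rmorphB; apply/eqP.
  have /ev_eq0/dvdpP[s ->] : ev (Q (ev q) - q) = 0 by rewrite ev_is_additive -QP subrr.
  by rewrite rmorphM hornerM (rootP pr) mulr0.
have phiB : zmod_morphism phi.
  move=> x y; rewrite [x]QP [y]QP -ev_is_additive !phiE.
  by rewrite rmorphB !hornerE.
have phi_alg a : phi a%:A = iota a.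
  have -> : a%:A = ev a%:P by rewrite /ev map_polyC hornerC.
  by rewrite phiE map_polyC hornerC.
have phi1 : monoid_morphism phi.
  split; first by rewrite -[1]scale1r phi_alg rmorph1.
  by move=> x y; rewrite [x]QP [y]QP -evM !phiE rmorphM hornerM.
pose phiM : {rmorphism L -> M} := HB.pack phi
  (GRing.isZmodMorphism.Build L M phi phiB) (GRing.isMonoidMorphism.Build L M phi phi1).
exists phiM; split=> //=.
have {1}-> : z = ev 'X by rewrite /ev map_polyX hornerX.
by rewrite phiE map_polyX hornerX.
Qed.

End Conjugate.

Lemma simple_separable : separable_poly p -> forall y : L, exists q : {poly F},
  [/\ q \is monic, irreducible_poly q, root (map_poly (in_alg L) q) y & separable_poly q].
Proof.
move=> sp y; have sz : separable_element 1 z.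
  apply/separable_elementP; exists (map_poly (in_alg L) p); split=> //.
    exact: alg_polyOver.
  by rewrite separable_map.
have : separable_element 1 y by apply: (adjoin_separableP sz); rewrite gen_z memvf.
rewrite /separable_element; have /polyOver1P[q eq] := minPolyOver 1 y.
have mq := monic_minPoly 1 y; have ry := root_minPoly 1 y.
rewrite eq separable_map => sq.
rewrite eq map_monic in mq; rewrite eq in ry.
exists q; split=> //; split=> [|r sr rq].
  rewrite -(size_map_poly (in_alg L)); apply: root_size_gt1 ry.
  by rewrite map_poly_eq0 monic_neq0.
have := @minPoly_irr _ _ 1 y (map_poly (in_alg L) r) (alg_polyOver _ _).
rewrite eq dvdp_map eqp_map => /(_ rq) /orP[//|].
by rewrite -size_poly_eq1 size_map_poly (negPf sr).
Qed.

End SimpleExtension.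

(** Once factors ['X] are removed from a polynomial vanishing at [w], its constant term is nonzero,
    and the equation shows it to be a multiple of [w] by an integral element. *)
Lemma integral_multiple (D K : idomainType) (h : {rmorphism D -> K}) w :
  injective h -> w != 0 -> integralOver h w ->
  exists2 a, a != 0 & exists2 w', integralOver h w' & w' * w = h a.
Proof.
move=> h_inj w0 iw; have [p mp] := iw; have := monic_neq0 mp; clear mp.
elim/poly_ind: p => [|p c IHp]; first by rewrite eqxx.
have [->|c0] := eqVneq c 0.
  rewrite addr0 mulf_eq0 polyX_eq0 orbF => p0.
  by rewrite rmorphM /= map_polyX rootM rootX (negPf w0) orbF; apply: IHp.
move=> _ /rootP; rewrite rmorphD rmorphM /= map_polyX map_polyC !hornerE => /eqP.
rewrite addr_eq0 => /eqP e; exists (- c); first by rewrite oppr_eq0.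
exists (map_poly h p).[w]; last by rewrite e rmorphN.
apply: integral_horner => //; apply/integral_poly => i; rewrite coef_map.
exact: integral_id.
Qed.
(** The [phi k] play the role of coordinates: this is the Noetherian property of the submodules of a
    free module of rank [n], with a jointly injective family of linear forms instead of an
    embedding. The values of the last form make up an ideal of [D], and its kernel is handled by
    induction. *)
Lemma submodule_generators (D E : comNzRingType) (f : {rmorphism D -> E})
    (phi : nat -> E -> D) :
  noetherian D ->
  (forall k a x y, phi k (f a * x + y) = a * phi k x + phi k y) ->
  forall (n : nat) (S : set E),
  S 0 -> (forall a x y, S x -> S y -> S (f a * x + y)) ->
  (forall x, S x -> (forall k, (k < n)%N -> phi k x = 0) -> x = 0) ->
  exists m (b : 'I_m -> E), (forall i, S (b i)) /\
    forall x, S x -> exists c : 'I_m -> D, x = \sum_i f (c i) * b i.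
Proof.
move=> noD lin; elim=> [|n IHn] S S0 SD inj.
  exists 0%N, (fun=> 0); split=> [[]//|x Sx]; exists (fun=> 0).
  by rewrite big_ord0; apply: inj.
have phi0 k : phi k 0 = 0.
  by have := lin k (-1) 0 0; rewrite mulr0 addr0 mulN1r addNr.
have sumS m (b : 'I_m -> E) c : (forall i, S (b i)) -> S (\sum_i f (c i) * b i).
  by move=> Sb; apply: big_rec => // i x _; apply: SD.
have phi_sum k m (b : 'I_m -> E) c :
    phi k (\sum_i f (c i) * b i) = \sum_i c i * phi k (b i).
  apply: (big_rec2 (fun x y => phi k x = y)) => // i x y _ <-; exact: lin.
pose I := [set phi n x | x in S].
have iI : ideal I.
  split=> //; first by exists 0.
  - move=> _ _ [x Sx <-] [y Sy <-]; exists (f 1 * x + y); first exact: SD.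
    by rewrite lin mul1r.
  - move=> s _ _ [x Sx <-]; exists (f s * x + 0); first exact: SD.
    by rewrite lin phi0 addr0.
have [m1 [d Id]] := noD _ iI.
have dI i : exists x, S x /\ phi n x = d i.
  have : I (d i).
    rewrite Id; exists (fun j => (j == i)%:R).
    by rewrite (bigD1 i) //= eqxx mul1r big1 ?addr0 // => j /negPf->; rewrite mul0r.
  by move=> [x Sx e]; exists x.
have [s sP] := boolp.choice dI.
have [|||m2 [b [Sb bP]]] := IHn [set x | S x /\ phi n x = 0].
- by split; rewrite ?phi0.
- move=> a x y [Sx x0] [Sy y0]; split; first exact: SD.
  by rewrite lin x0 y0 mulr0 addr0.
- by move=> x [Sx x0] H; apply: inj => // k; rewrite ltnS leq_eqVlt => /orP[/eqP->|/H].
exists (m1 + m2)%N, (fun i => match split i with inl j => s j | inr j => b j end).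
split; first by move=> i; case: split => j; [case: (sP j) | case: (Sb j)].
move=> x Sx; have [c1 e1] : exists c, phi n x = \sum_i c i * d i.
  have : I (phi n x) by exists x.
  by rewrite Id.
(* The difference is written [f (-1) * _ + x] to match the closure property that is assumed of
   [S]. *)
have [|c2 e2] := bP (f (-1) * (\sum_i f (c1 i) * s i) + x).
  split; first by apply: SD => //; apply: sumS => i; case: (sP i).
  rewrite lin phi_sum e1 mulN1r addrC; apply/eqP; rewrite subr_eq0; apply/eqP.
  by apply: eq_bigr => i _; case: (sP i) => _ ->.
exists (fun i => match split i with inl j => c1 j | inr j => c2 j end).
rewrite big_split_ord /= addrC; apply: (canRL (subrK _)).
transitivity (f (-1) * (\sum_i f (c1 i) * s i) + x).
  rewrite rmorphN1 mulN1r [RHS]addrC; congr (_ - _); apply: eq_bigr => i _.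
  by rewrite -[lshift _ _]/(unsplit (inl i)) unsplitK.
rewrite e2; apply: eq_bigr => i _.
by rewrite -[rshift _ _]/(unsplit (inr i)) unsplitK.
Qed.

Section Extension.
Variables (D : idomainType) (p : {poly D}).
Hypothesis dedD : dedekind D.
Local Notation F := {fraction D}.
Local Notation toF := (@FracField.tofrac D : {rmorphism D -> F}).
Local Notation pF := (map_poly toF p).
Variables (L : fieldExtType F) (z : L).
Hypotheses (mp : p \is monic) (irr_p : irreducible_poly pF) (sep_p : separable_poly pF).
Hypotheses (pz : root (map_poly (in_alg L) pF) z) (gen_z : <<1; z>>%VS = fullv).

Definition ext_map : {rmorphism D -> L} := in_alg L \o toF.
Local Notation h := ext_map.
Local Notation E := (int_closure h).
Local Notation f := (ic_embed h).

Let mpF : pF \is monic. Proof. exact: monic_map. Qed.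

Lemma ext_map_inj : injective h.
Proof.
by move=> a b /fmorph_inj /eqP; rewrite tofrac_eq => /eqP.
Qed.

Lemma ext_map_alg a (y : L) : h a * y = a%:F *: y.
Proof. by rewrite /= mulr_algl. Qed.

Lemma ext_gen_integral : integralOver h z.
Proof. by exists p => //; rewrite map_poly_comp. Qed.

Lemma ext_frac y : exists a (e : E), a != 0 /\ h a * y = ic_val e.
Proof.
have [c ->] := power_basis mpF irr_p pz gen_z y.
have [a a0 [b bP]] := common_denominator c.
have [e eP] : exists e : E, ic_val e = \sum_i h (b i) * z ^+ i.
  apply: ic_val_onto; apply/asboolP.
  have zi : z \in integral_elt h by apply/asboolP/ext_gen_integral.
  apply: (@rpred_sum _ (integral_elt h)) => i _; apply: rpredM; last exact: rpredX.
  by apply/asboolP/integral_id.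
exists a, e; split=> //; rewrite eP mulr_sumr; apply: eq_bigr => i _.
by rewrite !ext_map_alg scalerA bP.
Qed.

(** The field of fractions of [E] is a quotient type, whereas all computations take place in [L].
    [g] is the isomorphism between the two, along which separability and the degree are
    transported. *)
Local Notation g := (frac_lift (@ic_val_inj D L h)).

Lemma ext_frac_val (e : E) : g e%:F = ic_val e.
Proof. exact: frac_lift_tofrac. Qed.

Lemma ext_frac_inj : injective g. Proof. exact: fmorph_inj. Qed.

Lemma ext_frac_onto y : exists x, g x = y.
Proof.
have [a [e [a0 ae]]] := ext_frac y; exists (e%:F / (f a)%:F).
have fa0 : f a != 0.
  by rewrite -(rmorph0 f) (inj_eq (ic_embed_inj ext_map_inj)).
by rewrite frac_liftE // -ae ic_val_embed mulrC mulKf.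
Qed.

Lemma ext_frac_map (x : F) : g (frac_map f x) = x%:A.
Proof.
have [a [b [b0 ->]]] := frac_ind x.
have fb0 : f b != 0.
  by rewrite -(rmorph0 f) (inj_eq (ic_embed_inj ext_map_inj)).
rewrite (frac_mapE (f := f)) ?frac_liftE ?ic_val_embed //; last first.
  exact: ic_embed_inj ext_map_inj.
by rewrite -[RHS]/(in_alg L _) fmorph_div.
Qed.

Lemma ext_integrally_closed : integrally_closed_domain E.
Proof.
move=> x [q mq /rootP qx].
have : integralOver h (g x).
  apply: (@integral_root_monic _ _ _ _ (map_poly ic_val q)); first exact: monic_map.
    apply/rootP.
    have := congr1 g qx; rewrite rmorph0 -horner_map -map_poly_comp => e.
    by rewrite -[RHS]e; congr (_.[_]); apply: eq_map_poly => a /=; rewrite ext_frac_val.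
  by apply/integral_poly => i; rewrite coef_map; apply: ic_val_integral.
move=> /ic_val_onto[e eE]; exists e; apply: ext_frac_inj.
by rewrite ext_frac_val.
Qed.

Lemma ext_separable : separable_algebraic (frac_map f).
Proof.
move=> x; have [q [mq irr_q qx sq]] := simple_separable pz gen_z sep_p (g x).
exists q; split=> //; apply/rootP/ext_frac_inj; rewrite rmorph0.
rewrite -horner_map -[RHS](rootP qx); congr (_.[_]).
have tf_inj : injective (@FracField.tofrac E \o f).
  by move=> a b /eqP; rewrite tofrac_eq => /eqP /(ic_embed_inj ext_map_inj).
pose fm : {rmorphism F -> {fraction E}} :=
  frac_lift (h := @FracField.tofrac E \o f) tf_inj.
rewrite -[map_poly (frac_map f) q]/(map_poly fm q) -map_poly_comp.
apply: eq_map_poly => a; exact: ext_frac_map.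
Qed.

Lemma ext_degree : extension_degree (frac_map f) (size p).-1.
Proof.
have sF : (size pF).-1 = (size p).-1.
  by rewrite size_map_poly_id0 // (monicP mp) rmorph1 oner_neq0.
have [b bP] := boolp.choice ext_frac_onto; rewrite -sF.
exists (fun i => b (z ^+ i)) => x.
have gsum (c : 'I_(size pF).-1 -> F) :
    g (\sum_i frac_map f (c i) * b (z ^+ i)) = \sum_i c i *: z ^+ i.
  rewrite rmorph_sum; apply: eq_bigr => i _.
  by rewrite rmorphM /= bP ext_frac_map mulr_algl.
have [c cE] := power_basis mpF irr_p pz gen_z (g x).
exists [ffun i => c i]; split=> [|c' e].
  apply: ext_frac_inj; rewrite gsum cE; apply: eq_bigr => i _.
  by rewrite ffunE.
apply/ffunP => i; rewrite ffunE.
apply: (power_basis_uniq mpF irr_p pz (c' := c')) i.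
by rewrite -cE -gsum -e.
Qed.

Lemma ext_dim : (\dim {:L} <= (size p).-1)%N.
Proof.
have sF : (size pF).-1 = (size p).-1.
  by rewrite size_map_poly_id0 // (monicP mp) rmorph1 oner_neq0.
pose X := [seq z ^+ i | i : 'I_(size pF).-1].
have sX : size X = (size p).-1 by rewrite size_map size_enum_ord.
rewrite -sX; apply: leq_trans (dim_span X); apply: dimvS; apply/subvP => y _.
have [c ->] := power_basis mpF irr_p pz gen_z y.
apply: rpred_sum => i _; apply/memvZ/memv_span/map_f; exact: mem_enum.
Qed.

(** This is the form in which the degree of the extension enters the count of primes. *)
Lemma ext_dependent n (e : 'I_n -> E) : ((size p).-1 < n)%N ->
  exists c : 'I_n -> D, (exists i, c i != 0) /\ \sum_i f (c i) * e i = 0.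
Proof.
move=> lt; pose X := [tuple ic_val (e i) | i < n].
have : ~~ free X.
  apply: contraL lt => /eqP fX; rewrite -leqNgt -(size_tuple X) -fX.
  exact: leq_trans (dimvS (subvf _)) ext_dim.
move=> /freeP nf.
have [k [k0 [i ki]]] : exists k : 'I_n -> F, \sum_i k i *: X`_i = 0 /\ exists i, k i != 0.
  apply: contrapT => no; apply: nf => k k0 i; apply: contrapT => /eqP ki.
  by apply: no; exists k; split=> //; exists i.
have [a a0 [b bP]] := common_denominator k.
exists b; split.
  by exists i; rewrite -tofrac_eq0 -bP mulf_neq0 // tofrac_eq0.
apply: ic_val_inj; rewrite rmorph0 rmorph_sum.
transitivity (a%:F *: \sum_i k i *: X`_i); last by rewrite k0 scaler0.
rewrite scaler_sumr; apply: eq_bigr => j _.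
rewrite rmorphM ic_val_embed ext_map_alg -bP scalerA.
by rewrite -tnth_nth tnth_mktuple.
Qed.

Section Finite.
Variables (M : fieldType) (iota : {rmorphism F -> M}) (rs : seq M).
Hypothesis split_p : map_poly iota pF = \prod_(r <- rs) ('X - r%:P).

Let k : {rmorphism D -> M} := iota \o toF.

Let k_inj : injective k.
Proof. by move=> a b /fmorph_inj /eqP; rewrite tofrac_eq => /eqP. Qed.

Lemma conj_integral (phi : {rmorphism L -> M}) (y : L) :
  (forall a, phi a%:A = iota a) -> integralOver h y -> integralOver k (phi y).
Proof.
move=> phiA [q mq /rootP qy]; exists q => //; apply/rootP.
rewrite -(rmorph0 phi) -qy -horner_map -map_poly_comp; congr (_.[_]).
by apply: eq_map_poly => a /=; rewrite phiA.
Qed.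

(* The coordinates of an integral element in the power basis are obtained from
   its conjugates by inverting a Vandermonde matrix, whose determinant divides
   an element of D in the integral closure. *)
Lemma ext_coordinates : exists2 a, a != 0 & forall y, integralOver h y ->
  exists b : 'I_(size pF).-1 -> D, h a * y = \sum_i h (b i) * z ^+ i.
Proof.
have srs : (size pF).-1 = size rs.
  by rewrite -(size_map_poly iota) split_p size_prod_XsubC.
have urs : uniq rs.
  by rewrite -separable_prod_XsubC -split_p separable_map.
pose d := (size pF).-1; pose x (j : 'I_d) := rs`_j.
have rx j : root (map_poly iota pF) (x j).
  by rewrite split_p root_prod_XsubC mem_nth // -srs.
have [phi phiP] := boolp.choice (fun j => conjugation_exists irr_p pz gen_z (rx j)).
pose V := Vandermonde d (\row_j x j).
have xk j : x j \in integral_elt k.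
  apply/asboolP; exists p => //; have := rx j; rewrite -map_poly_comp.
  by [].
have Vk i j : V i j \in integral_elt k by rewrite !mxE; apply: rpredX.
have detk n (A : 'M[M]_n) : (forall i j, A i j \in integral_elt k) -> \det A \in integral_elt k.
  move=> Ak; apply: rpred_sum => s _; apply: rpredM.
    by apply: rpredX; rewrite rpredN rpred1.
  by apply: rpred_prod => i _.
have adjk i j : (\adj V) i j \in integral_elt k.
  rewrite mxE; apply: rpredM; first by apply: rpredX; rewrite rpredN rpred1.
  by apply: detk => i' j'; rewrite !mxE rpredX.
have detV : \det V != 0.
  rewrite det_Vandermonde; apply/prodf_neq0 => i _; apply/prodf_neq0 => j ij.
  rewrite !mxE subr_eq0 /x nth_uniq -?srs //.
  by rewrite neq_ltn ij orbT.
have [a a0 [w wk ew]] := integral_multiple k_inj detV (asboolW (detk _ _ Vk)).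
exists a => // y iy; have [c cE] := power_basis mpF irr_p pz gen_z y.
suff bP i : exists b, a%:F * c i = b%:F.
  have [b bE] := boolp.choice bP; exists b; rewrite cE mulr_sumr.
  by apply: eq_bigr => i _; rewrite !ext_map_alg scalerA bE.
have [_ icD _] := dedD; apply: icD.
suff [q mq qr] : integralOver k (iota (a%:F * c i)).
  exists q => //; move: qr; rewrite map_poly_comp fmorph_root.
  by [].
pose v := \row_i iota (c i).
have ephi : v *m V = \row_j phi j y.
  apply/rowP => j; rewrite !mxE cE rmorph_sum; apply: eq_bigr => i' _.
  have [pz' pa] := phiP j.
  by rewrite !mxE -mulr_algl rmorphM pa rmorphXn pz'.
have : (v *m V *m \adj V) 0 i = \det V * iota (c i).
  by rewrite -mulmxA mul_mx_adj mul_mx_scalar !mxE.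
rewrite ephi => e.
rewrite rmorphM /= -[iota a%:F]/(k a) -ew -mulrA -e; apply: integral_mul => //.
apply/asboolP; rewrite mxE; apply: (@rpred_sum _ (integral_elt k)) => j _.
apply: rpredM => //; rewrite mxE; apply/asboolP/conj_integral => //.
by case: (phiP j).
Qed.

End Finite.

(** Taken for the whole of [E] it gives finiteness over [D], taken for an ideal it gives the
    Noetherian property. The coordinates of [a] times an element in the power basis lie in [D] and
    are linear because they are unique. *)
Lemma ext_submodule (S : set E) : S 0 ->
  (forall a x y, S x -> S y -> S (f a * x + y)) ->
  exists m (b : 'I_m -> E), (forall i, S (b i)) /\
    forall x, S x -> exists c : 'I_m -> D, x = \sum_i f (c i) * b i.
Proof.
move=> S0 SD; have [M [iota [rs split_p]]] := splitting_field_exists mpF.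
have [a a0 aP] := ext_coordinates split_p.
have [c cE] := boolp.choice (fun e : E => aP _ (ic_val_integral e)).
pose phi k (e : E) := if insub k is Some i then c e i else 0.
have inj_h := ext_map_inj.
have cU (b b' : 'I_(size pF).-1 -> D) :
    \sum_i h (b i) * z ^+ i = \sum_i h (b' i) * z ^+ i -> b =1 b'.
  move=> e i; apply/eqP; rewrite -tofrac_eq; apply/eqP; move: i.
  apply: (power_basis_uniq mpF irr_p pz).
  by under eq_bigr do rewrite -ext_map_alg; rewrite e; under eq_bigr do rewrite ext_map_alg.
have noD : noetherian D by case: dedD.
apply: (@submodule_generators D E f phi noD _ (size pF).-1 S) => //.
  move=> i s x y; rewrite /phi; case: insubP => [j _ _|_]; last by rewrite mulr0 addr0.
  apply: (cU (c (f s * x + y)) (fun j => s * c x j + c y j)).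
  rewrite -cE rmorphD rmorphM ic_val_embed mulrDr mulrCA !cE mulr_sumr -big_split.
  by apply: eq_bigr => l _; rewrite rmorphD rmorphM mulrDl mulrA.
move=> x Sx x0; apply: ic_val_inj; rewrite rmorph0; apply: (mulfI (inj_neq0 inj_h a0)).
rewrite mulr0 cE big1 // => i _.
by have := x0 i (ltn_ord i); rewrite /phi valK => ->; rewrite rmorph0 mul0r.
Qed.

Lemma ext_finite : finite_module f.
Proof.
have [||m [b [_ bP]]] := @ext_submodule setT; [by []|by []|].
by exists m, b => x; apply: bP.
Qed.

Lemma ext_noetherian : noetherian E.
Proof.
move=> A iA; have [||m [b [Ab bP]]] := @ext_submodule A.
- exact: ideal0.
- by move=> a x y Ax Ay; apply: idealD => //; apply: ideal_mull.
exists m, b; apply/seteqP; split=> x.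
  by move=> /bP[c ->]; exists (fun i => f (c i)).
by move=> [c ->]; apply: ideal_sum => // i _; apply: ideal_mull.
Qed.

Lemma ext_contraction_prime (Q : set E) : prime_ideal Q -> prime_ideal (f @^-1` Q).
Proof.
move=> [iQ Q1 pQ]; split; last 2 first.
- by rewrite /preimage /= rmorph1.
- by move=> a b _ _; rewrite /preimage /= rmorphM; apply: pQ.
split=> //; rewrite /preimage /=; first by rewrite rmorph0; apply: ideal0.
  by move=> a b Qa Qb; rewrite rmorphD; apply: idealD.
by move=> s a _ Qa; rewrite rmorphM; apply: ideal_mull.
Qed.

Lemma ext_contraction_nzprime (Q : set E) : nzprime Q -> nzprime (f @^-1` Q).
Proof.
move=> [pQ [x Qx x0]]; split; first exact: ext_contraction_prime.
have [a a0 [w _ ew]] := integral_multiple (ic_embed_inj ext_map_inj) x0 (ic_integralRange x).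
by exists a => //; rewrite /preimage /= -ew; apply: ideal_mull => //; case: pQ.
Qed.

(** [E / Q] is a domain integral over the field obtained from the contraction of [Q]. A monic [q]
    with value at [y] in [Q] either has constant term in [Q], and a factor [y] can be cancelled, or
    yields an inverse of [y] modulo [Q]. *)
Lemma ext_nzprime_max (Q : set E) : nzprime Q -> maximal_ideal Q.
Proof.
move=> nQ; have mP := nzprime_max dedD (ext_contraction_nzprime nQ).
have pQ := nzprime_prime nQ; have iQ := nzprime_ideal nQ.
have inv y : ~ Q y -> exists t, Q (t * y - 1).
  move=> Qy; have [q mq /rootP qy] := ic_integralRange y.
  (* The vanishing at [y] is weakened to membership in [Q], which is what survives the cancellation
     of [y]. *)
  have : exists2 q : {poly D}, q \is monic & Q (map_poly f q).[y].
    by exists q; rewrite // qy; apply: ideal0.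
  case=> {}q {}mq {}qy; have [n] := ubnP (size q).
  elim: n q mq qy => // n IHn q mq qy sq.
  elim/poly_ind: q mq qy sq => [|q c _]; first by rewrite monicE lead_coef0 eq_sym oner_eq0.
  have [->|q0] := eqVneq q 0.
    rewrite mul0r add0r monicE lead_coefC => /eqP -> + _.
    by rewrite rmorph1 hornerC; case: pQ.
  have sqX : size (q * 'X + c%:P) = (size q).+1.
    by rewrite size_MXaddC (negPf q0).
  rewrite sqX => mq.
  have {}mq : q \is monic.
    move: mq; rewrite !monicE lead_coefDl; first by rewrite lead_coef_Mmonic ?monicX.
    by rewrite size_mulX // ltnS (leq_trans (size_polyC_leq1 c)) // size_poly_gt0.
  rewrite rmorphD rmorphM /= map_polyX map_polyC !hornerE => Qc sq.
  have [Qfc|Qfc] := pselect (Q (f c)).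
    apply: (IHn q mq _ sq).
    have : Q ((map_poly f q).[y] * y) by rewrite -[_ * _](addrK (f c)); apply: idealB.
    by case/(prime_idealP pQ).
  have [t [s [Qs e]]] := maximal_comax mP Qfc.
  exists (- f t * (map_poly f q).[y]).
  have -> : - f t * (map_poly f q).[y] * y - 1 =
      - (f t * ((map_poly f q).[y] * y + f c)) - f s.
    have -> : 1 = f t * f c + f s by rewrite -rmorphM -rmorphD e rmorph1.
    by rewrite mulrDr !opprD !mulNr mulrA addrA.
  by apply: idealB => //; apply: idealN => //; apply: ideal_mull.
split=> //; first by case: pQ.
move=> A iA A1 sQA; apply/seteqP; split=> // y Ay; apply: contrapT => /inv[t Qt].
apply: A1; rewrite -[1](subrK (t * y)) -[1 - _]opprB; apply: idealD => //.
  by apply: idealN => //; apply: sQA.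
exact: ideal_mull.
Qed.

Lemma ext_dedekind : dedekind E.
Proof.
split; [exact: ext_noetherian | exact: ext_integrally_closed |].
by move=> Q pQ Q0; apply: ext_nzprime_max.
Qed.

End Extension.
(** * Ramification *)

Section Ramification.
Variables (D E : idomainType) (f : {rmorphism D -> E}) (d : nat) (P : set D).
Hypotheses (dedD : dedekind D) (dedE : dedekind E) (f_inj : injective f).
Hypothesis dep : forall n (y : 'I_n -> E), (d < n)%N ->
  exists c : 'I_n -> D, (exists i, c i != 0) /\ \sum_i f (c i) * y i = 0.
Hypothesis nP : nzprime P.

Definition lies_over (N : set E) : Prop := nzprime N /\ f @^-1` N = P.

Definition ramification (N : set E) : nat := pval N (f (unif P).1).

Lemma lies_overE N a : lies_over N -> N (f a) = P a.
Proof. by move=> [_ <-]. Qed.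

Let f_neq0 a : a != 0 -> f a != 0.
Proof. by rewrite -(rmorph0 f) (inj_eq f_inj). Qed.

Lemma ramification_pval N a : lies_over N -> a != 0 ->
  pval N (f a) = (pval P a * ramification N)%N.
Proof.
move=> oN a0; have [nN _] := oN.
have [s [y [Ps Py e]]] := pvalP dedD nP a0.
have [_ pi0 _ _] := unifP dedD nP.
have P0 := ideal0 (nzprime_ideal nP).
have s0 : s != 0 by apply: contra_notN Ps => /eqP ->.
have y0 : y != 0 by apply: contra_notN Py => /eqP ->.
have := congr1 (pval N \o f) e; rewrite /= !rmorphM rmorphXn.
rewrite !pvalM ?expf_neq0 ?f_neq0 // pvalX ?f_neq0 //.
rewrite (@pval_eq0 _ dedE _ (f s)) ?(@pval_eq0 _ dedE _ (f y)) ?lies_overE //.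
by rewrite add0n addn0.
Qed.

Lemma ramification_gt0 N : lies_over N -> (0 < ramification N)%N.
Proof.
move=> oN; have [nN _] := oN; have [Ppi pi0 _ _] := unifP dedD nP.
by apply/(pval_gt0 dedE nN (f_neq0 pi0)); rewrite lies_overE.
Qed.

Lemma ramification_vge N a : lies_over N -> P a -> vge N (ramification N) (f a).
Proof.
move=> oN Pa; have [->|a0] := eqVneq a 0; first by left; rewrite rmorph0.
right; rewrite ramification_pval // leq_pmull //.
exact/(pval_gt0 dedD nP a0).
Qed.

(** A relation is divided by the power of the uniformizer given by the least order of a nonzero
    coefficient, so that one coefficient leaves [P]. The division takes place in the localization;
    the product of the denominators [(sy j).1] brings the result back to [D]. *)
Lemma dependent_local n (y : 'I_n -> E) : (d < n)%N ->
  exists c : 'I_n -> D, (exists i, ~ P (c i)) /\ \sum_i f (c i) * y i = 0.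
Proof.
move=> lt; have [c [[i1 ci1] sum0]] := dep y lt.
have [i0 ci0 imin] := @arg_minnP _ i1 (fun i => c i != 0) (fun i => pval P (c i)) ci1.
pose v := pval P (c i0); pose pi := (unif P).1.
have [Ppi pi0 _ _] := unifP dedD nP; have pP := nzprime_prime nP.
have ex i : exists sy : D * D,
    [/\ ~ P sy.1, sy.1 * c i = pi ^+ v * sy.2 & i = i0 -> ~ P sy.2].
  have : vge P v (c i).
    by have [->|ci] := eqVneq (c i) 0; [left | right; apply: imin].
  move=> /(vgeE dedD v (c i) nP)[s [t [Ps e]]]; exists (s, t); split=> // ei Pt.
  have : vge P (v + 1) (s * c i).
    rewrite e; apply: vgeM => //; last exact/vge1.
    by right; rewrite pvalX // pval_unif // muln1.
  move=> /(vgeMl dedD nP Ps); rewrite ei => /(vge_lt P _ ci0).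
  by rewrite addn1 ltnn.
have [sy syP] := boolp.choice ex.
exists (fun i => (sy i).2 * \prod_(j | j != i) (sy j).1); split.
  exists i0; have [_ _ /(_ erefl) N2] := syP i0.
  apply: prime_ideal_mul => //; apply: prime_ideal_prod => // j _.
  by case: (syP j).
apply: (mulfI (expf_neq0 v (f_neq0 pi0))).
transitivity (f (\prod_j (sy j).1) * (\sum_i f (c i) * y i)); last by rewrite sum0 !mulr0.
rewrite !mulr_sumr.
apply: eq_bigr => i _; rewrite !mulrA -rmorphXn -!rmorphM; congr (f _ * _).
by have [_ e _] := syP i; rewrite mulrA -e [in RHS](bigD1 i) //= mulrAC.
Qed.

Section Chain.
Variable Ns : seq (set E).
Hypothesis Ns_over : forall N, N \in Ns -> lies_over N.
Hypothesis Ns_count : forall N, N \in Ns -> (count_mem N Ns <= ramification N)%N.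

(* The elements z i belong to the successive terms of a chain of ideals of E in
   which the exponent of one prime grows by one at each step, and which ends
   above the extension of P. *)
Definition chain_spec (z : nat -> E) : Prop := forall i, (i < size Ns)%N ->
  z i != 0 /\ forall N, N \in Ns -> pval N (z i) = count_mem N (take i Ns).

(** No positive order is prescribed at index 0, so [z 0] can be taken to be 1. When a relation
    involving [y] is reduced modulo a prime, this makes the term at index 0 an element of [D]. *)
Lemma chain_exists : exists2 z, chain_spec z & z 0%N = 1.
Proof.
have nNs N : N \in Ns -> nzprime N by move=> /Ns_over[].
have ex i : exists t, t != 0 /\ forall N, N \in Ns -> pval N t = count_mem N (take i Ns).
  by have [t t0 tP] := pval_approx dedE (fun N => count_mem N (take i Ns)) nNs; exists t.
have [z zP] := boolp.choice ex.
exists (fun i => if i is 0 then 1 else z i) => // [[|i]] _; last exact: zP.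
split=> [|N NNs]; first exact: oner_neq0.
by rewrite take0 /= pval_eq0 //; have [[] ] := nNs N NNs.
Qed.

(** Look at the [i]-th prime [N]: the terms before [i] have coefficients in [P], hence order at
    least the ramification of [N], and the later [z j] have order larger than [z i]. So the order of
    [f (c i) * z i] exceeds that of [z i], and [c i] lies in [P]. *)
Lemma chain_independent z (c : 'I_(size Ns) -> D) : chain_spec z ->
  (forall N, N \in Ns -> vge N (count_mem N Ns) (\sum_i f (c i) * z i)) ->
  forall i, P (c i).
Proof.
move=> zP vs [i lti]; have [n] := ubnP i; elim: n i lti => // n IHn i lti leiN.
have IH (j : 'I_(size Ns)) : (j < i)%N -> P (c j).
  by case: j => j ltj /= ji; apply: IHn; apply: leq_trans ji _.
pose N := nth setT Ns i; have NNs : N \in Ns by apply: mem_nth.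
have oN := Ns_over NNs; have [nN _] := oN.
pose k := count_mem N (take i Ns).
have tS : count_mem N (take i.+1 Ns) = k.+1.
  by rewrite (take_nth setT) // -cats1 count_cat /= -/N eqxx addn1.
have kle : (k.+1 <= count_mem N Ns)%N.
  by rewrite -tS -[X in (_ <= count_mem _ X)%N](cat_take_drop i.+1) count_cat leq_addr.
have iv := vge_ideal dedE k.+1 nN.
have [zi0 zi] := zP i lti.
apply: contrapT => nPc.
have : vge N k.+1 (f (c (Ordinal lti)) * z i).
  have := vgeW kle (vs N NNs); rewrite (bigD1 (Ordinal lti)) //= => tot.
  rewrite -[_ * _](addrK (\sum_(j | j != Ordinal lti) f (c j) * z j)).
  apply: idealB => //; apply: ideal_sum => // j ne.
  have [ji|ij|e] := ltngtP j i.
  - apply: ideal_mulr => //; apply: vgeW (ramification_vge oN (IH j ji)).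
    exact: leq_trans kle (Ns_count NNs).
  - apply: ideal_mull => //; right; have [_ ->] := zP j (ltn_ord j); last by [].
    by rewrite -tS -(cat_take_drop i.+1 (take j Ns)) count_cat take_takel // leq_addr.
  - by case/eqP: ne; apply: val_inj.
move=> /(vgeMl dedE nN _); rewrite lies_overE // => /(_ nPc) /(vge_lt N _ zi0).
by rewrite zi // ltnn.
Qed.

(** The inequality that bounds the sum of the ramification indices by the degree; a list with
    bounded multiplicities stands for the sum. *)
Lemma chain_size : (size Ns <= d)%N.
Proof.
rewrite leqNgt; apply/negP => lt; have [z zP _] := chain_exists.
have [c [[i Pci] sum0]] := dependent_local (fun i : 'I_(size Ns) => z i) lt.
by apply: Pci; apply: (chain_independent zP) => N _; rewrite sum0; left.
Qed.

End Chain.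

(* If y were not congruent to an element of D, then y could be added to the d
   elements of a chain starting with N without losing independence modulo P. *)
Lemma chain_residue Ns N y :
  (forall N, N \in Ns -> lies_over N) ->
  (forall N, N \in Ns -> (count_mem N Ns <= ramification N)%N) ->
  size Ns = d -> N \in Ns -> exists a, N (y - f a).
Proof.
(* With [N] at the head, each [z i] with [i > 0] lies in [N], so modulo [N] only [y] and [z 0 = 1]
   remain in the relation. *)
wlog -> : Ns / Ns = N :: behead Ns => [W|] over cnt sN NNs.
  have pNs := perm_to_rem NNs.
  apply: (W (N :: rem N Ns)) => //.
  - by move=> M; rewrite -(perm_mem pNs); apply: over.
  - by move=> M; rewrite -(perm_mem pNs) -(permP pNs); apply: cnt.
  - by rewrite -sN (perm_size pNs).
  - exact: mem_head.
move: (behead Ns) over cnt sN {NNs} => Ms over cnt sN.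
have oN := over N (mem_head _ _); have [nN _] := oN; have iN := nzprime_ideal nN.
have [z zP z0] := chain_exists over.
have sz : (size (N :: Ms)).+1 = d.+1 by rewrite sN.
have lt : (d < (size (N :: Ms)).+1)%N by rewrite sz.
pose w (i : 'I_(size (N :: Ms)).+1) := if unlift ord0 i is Some j then z j else y.
have [c [[i0 Pc] ]] := dependent_local w lt.
rewrite big_ord_recl /w unlift_none.
under eq_bigr do rewrite liftK.
have [Pc0|Pc0] := pselect (P (c ord0)).
  move=> /eqP; rewrite addrC addr_eq0 => /eqP e.
  case: Pc; have allP : forall i, P (c (lift ord0 i)).
    apply: (chain_independent over cnt zP) => M MNs; rewrite e.
    have oM := over M MNs; have [nM _] := oM.
    have iv := vge_ideal dedE (count_mem M (N :: Ms)) nM.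
    apply: idealN => //; apply: ideal_mulr => //.
    exact: vgeW (cnt M MNs) (ramification_vge oM Pc0).
  by case: (unliftP ord0 i0) => [j ->|->].
rewrite big_ord_recl /= z0 mulr1 => sum0.
have [t [q [Pq e1]]] := maximal_comax (nzprime_max dedD nP) Pc0.
pose c1 := c (lift ord0 ord0).
have Nc : N (f (c ord0) * y + f c1).
  move: sum0; rewrite addrA => /eqP; rewrite addr_eq0 => /eqP ->.
  apply: idealN => //; apply: ideal_sum => // i _; apply: ideal_mull => //.
  have lti : (i.+1 < size (N :: Ms))%N by apply: (ltn_ord i).
  have [zi0 /(_ N (mem_head _ _)) zi] := zP i.+1 lti.
  by apply/(pval_gt0 dedE nN zi0); rewrite zi /= eqxx.
exists (- (t * c1)).
have -> : y - f (- (t * c1)) = f t * (f (c ord0) * y + f c1) + f q * y.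
  rewrite rmorphN opprK mulrDr mulrA -!rmorphM.
  by rewrite addrAC -mulrDl -rmorphD e1 rmorph1 mul1r.
apply: idealD => //; first exact: ideal_mull.
by apply: ideal_mulr => //; rewrite lies_overE.
Qed.

(* As sum e_N f_N <= d, primes N with e_N >= e whose number times e is d exhaust
   the primes over P. *)
Lemma primes_over_exhausted (Ms : seq (set E)) e :
  (forall N, N \in Ms -> lies_over N /\ (e <= ramification N)%N) ->
  uniq Ms -> (size Ms * e)%N = d -> (0 < e)%N ->
  forall N, lies_over N ->
    ramification N = e /\ forall y, exists a, N (y - f a).
Proof.
move=> over uMs sMs e0 N oN.
pose Ns := flatten [seq nseq e M | M <- Ms].
have sNs : size Ns = d.
  rewrite /Ns size_flatten /shape -map_comp -sMs.
  by elim: (Ms) => //= M Ms' ->; rewrite size_nseq mulSn.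
have cNs M : count_mem M Ns = (e * (M \in Ms))%N.
  rewrite /Ns count_flatten -map_comp.
  rewrite -(count_uniq_mem M uMs); elim: (Ms) => [|M' Ms' IH] /=; first by rewrite muln0.
  by rewrite IH count_nseq mulnDr mulnC.
have mNs M : (M \in Ns) = (M \in Ms).
  by rewrite -has_pred1 has_count cNs muln_gt0 e0 lt0b.
have oNs M : M \in Ns -> lies_over M by rewrite mNs => /over[].
(* Otherwise the list, which already has length [d], could be extended by [N]: as a new prime, or as
   one more copy of a prime with ramification above [e]. *)
have NMs : (N \in Ms) /\ (ramification N <= e)%N.
  apply: contrapT => no; suff : (size (N :: Ns) <= d)%N by rewrite /= sNs ltnn.
  apply: chain_size => M; first by rewrite inE => /predU1P[->//|/oNs].
  rewrite inE => /predU1P[->|].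
    rewrite /= eqxx cNs; have [NMs|_] := boolP (N \in Ms).
      by rewrite muln1 add1n ltnNge; apply/negP => le; apply: no.
    by rewrite muln0; apply: ramification_gt0.
  rewrite mNs /= => MMs; have [_ le] := over M MMs.
  have [MN|ne] := eqVneq N M; last by rewrite add0n cNs MMs muln1.
  rewrite -MN in MMs *; rewrite cNs MMs muln1 add1n ltnNge.
  by apply/negP => le'; apply: no.
have [NMs' le] := NMs; have [_ ge] := over N NMs'.
split; first by apply/eqP; rewrite eqn_leq le ge.
move=> y; apply: (@chain_residue Ns) => //; last by rewrite mNs.
by move=> M MNs; rewrite cNs -mNs MNs muln1; rewrite mNs in MNs; case: (over M MNs).
Qed.

End Ramification.
Lemma dominating_valuation_ring (D : idomainType) (M : fieldType)
    (k : {rmorphism D -> M}) (P : set D) :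
  dedekind D -> injective k -> nzprime P ->
  exists O, [/\ valuation_ring O, forall a, O (k a) & center O k = P].
Proof.
move=> dedD k_inj nP; have iP := nzprime_ideal nP.
pose A := range k; pose P' := [set k a | a in P].
have sA : subring A.
  split; first by exists 1; rewrite ?rmorph1.
    by move=> _ _ [a _ <-] [b _ <-]; exists (a - b); rewrite ?rmorphB.
  by move=> _ _ [a _ <-] [b _ <-]; exists (a * b); rewrite ?rmorphM.
have P1 : ~ mul_span P' A 1.
  suff sub : mul_span P' A `<=` P'.
    move=> /sub[a Pa]; rewrite -(rmorph1 k) => /k_inj a1.
    by case: nP => -[_ + _]; rewrite -a1.
  apply: mul_span_sub; first by exists 0; [apply: ideal0 | rewrite rmorph0].
    by move=> _ _ [a Pa <-] [b Pb <-]; exists (a + b); [apply: idealD | rewrite rmorphD].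
  by move=> _ _ [a Pa <-] [b _ <-]; exists (a * b); [apply: ideal_mulr | rewrite rmorphM].
have [|O [vO sAO sPO]] := valuation_ring_exists sA P1.
  by move=> _ [a Pa <-]; exists a.
have kO a : O (k a) by apply: sAO; exists a.
exists O; split=> //.
have sPC : P `<=` center O k by move=> a Pa; apply: sPO; exists a.
have nC : nzprime (center O k).
  have [_ [a Pa a0]] := nP; exact: (center_nzprime vO kO (sPC a Pa) a0).
have [_ _ maxP] := nzprime_max dedD nP; apply: maxP => //.
  exact: nzprime_ideal.
by case: nC => -[].
Qed.

(* The slopes of the Newton polygons are kap j / e; since kap j = 1 mod e each
   of them forces ramification e, and since the kap j are spread like powers of
   M, a sum of b * e of them determines how often each one occurs. *)
Definition slope e M j : nat := (1 + e * M ^ j)%N.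

(** The lower coefficients have to be nonzero because [pval P 0] carries no information. Those off
    the vertices get the order of the constant term, which keeps them above the polygon. *)
Definition newton_at (D : idomainType) (P : set D) b e M (p : {poly D}) : Prop :=
  [/\ p \is monic, size p = (b * e).+1, forall k, (k < b * e)%N -> p`_k != 0,
      forall t, (0 < t <= b)%N -> pval P p`_((b - t) * e) = newton_ord (slope e M) t &
      forall k, (k < b * e)%N -> ~~ (e %| k)%N -> pval P p`_k = newton_ord (slope e M) b].

(** * From the Newton polygon at a prime to the primes above it *)

Section NewtonAt.
Variables (D : idomainType) (P : set D) (b e Mb : nat) (p : {poly D}).
Hypotheses (dedD : dedekind D) (nP : nzprime P).
Hypotheses (b0 : (0 < b)%N) (e0 : (0 < e)%N) (M_gt : (b * e < Mb)%N).
Hypothesis pP : newton_at P b e Mb p.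
Local Notation F := {fraction D}.
Local Notation toF := (@FracField.tofrac D : {rmorphism D -> F}).
Local Notation pF := (map_poly toF p).
Local Notation kap := (slope e Mb).
Variables (M : fieldType) (iota : {rmorphism F -> M}) (rs : seq M).
Hypothesis split_p : map_poly iota pF = \prod_(r <- rs) ('X - r%:P).

Definition base_map : {rmorphism D -> M} := iota \o toF.
Local Notation k := base_map.

Lemma base_map_inj : injective k.
Proof. by move=> a b' /fmorph_inj /eqP; rewrite tofrac_eq => /eqP. Qed.

Variable O : set M.
Hypotheses (vO : valuation_ring O) (kO : forall a, O (k a)) (cO : center O k = P).

Let sO : subring O. Proof. by case: vO. Qed.
Let w := k (unif P).1.

Let mw : nonunit O w /\ w != 0.
Proof.
have nC : nzprime (center O k) by rewrite cO.
by have := center_unif dedD base_map_inj nC; rewrite cO.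
Qed.

Let k_pval a : a != 0 -> associate O (k a) (w ^+ pval P a).
Proof.
move=> a0; have nC : nzprime (center O k) by rewrite cO.
by have := center_pval vO dedD kO nC a0; rewrite cO.
Qed.

Let kap_lt i j : (i < j)%N -> (kap i < kap j)%N.
Proof.
move=> ij; rewrite ltn_add2l ltn_pmul2l // ltn_exp2l //.
by apply: leq_ltn_trans M_gt; rewrite muln_gt0 b0 e0.
Qed.

Lemma integral_valuation_ring x : integralOver k x -> O x.
Proof.
move=> [q mq qx]; apply: (valuation_ring_integral vO _ _ qx).
  exact: monic_map.
move=> i; rewrite coef_map; exact: kO.
Qed.

Lemma root_slope r : r \in rs ->
  exists2 j, (j < b)%N & associate O (r ^+ e) (w ^+ kap j).
Proof.
move=> rrs; have [mp sp c0 cv co] := pP; have [mw' w0] := mw.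
have rr : root (map_poly k p) r by rewrite map_poly_comp split_p root_prod_XsubC.
have sk : size (map_poly k p) = (b * e).+1.
  by rewrite size_map_poly_id0 ?sp // (monicP mp) rmorph1 oner_neq0.
apply: (@newton_root _ O vO w b e kap (fun i => k p`_i)) => //.
- move=> t tb; have [->|t0] := posnP t.
    rewrite subn0 /newton_ord big_ord0 expr0.
    have -> : p`_(b * e) = 1 by move/monicP: mp; rewrite lead_coefE sp.
    by rewrite rmorph1; apply: assoc_refl.
  rewrite -cv ?t0 //; apply: k_pval; apply: c0.
  by rewrite ltn_mul2r e0 ltn_subrL t0.
- move=> i ib ndiv; have [u [_ Ou _ ->]] := k_pval (c0 i ib).
  by exists u; rewrite // co // mulrC.
- by have -> : p`_(b * e) = 1; [move/monicP: mp; rewrite lead_coefE sp | rewrite rmorph1].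
- by apply: integral_valuation_ring; exists p.
- rewrite -[RHS](rootP rr) horner_coef sk.
  by apply: eq_bigr => i _; rewrite coef_map.
Qed.

(** The slopes have denominator [e], which the [e]-th power clears. Sublists are allowed so as to
    cover the roots of a factor as well as all roots. *)
Lemma roots_slopes (s : seq M) : {subset s <= rs} ->
  exists J : M -> nat, (forall r, r \in s -> (J r < b)%N /\
      associate O (r ^+ e) (w ^+ kap (J r))) /\
    associate O ((\prod_(r <- s) - r) ^+ e) (w ^+ (\sum_(r <- s) kap (J r))).
Proof.
move=> srs; have ex r : exists j, r \in rs -> (j < b)%N /\ associate O (r ^+ e) (w ^+ kap j).
  have [rrs|_] := boolP (r \in rs); last by exists 0%N.
  by have [j jb a] := root_slope rrs; exists j.
have [J JP] := boolp.choice ex; exists J; split; first by move=> r /srs /JP.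
elim: s srs => [|r s IHs] srs.
  by rewrite !big_nil expr1n; apply: assoc_refl.
rewrite !big_cons exprMn exprD; apply: assocM => //.
  have [_ a] := JP r (srs r (mem_head _ _)).
  rewrite exprNn -[w ^+ _]mul1r; apply: assocM => //.
  rewrite -[X in associate _ _ X](expr1n _ e); apply: assocX => //; apply: assocN => //.
  exact: assoc_refl.
by apply: IHs => r' r's; apply: srs; rewrite inE r's orbT.
Qed.

Lemma slope_sum (s : seq nat) :
  (\sum_(j <- s) kap j = size s + e * \sum_(j <- s) Mb ^ j)%N.
Proof. by rewrite big_split sum1_size /= big_distrr. Qed.

(** [e] times the order of the constant term, which lies in the fraction field of [D], is a sum of
    one slope numerator per root of [q], and each numerator is 1 modulo [e]. *)
Lemma factor_degree (q : {poly F}) : q \is monic -> q %| pF -> (e %| (size q).-1)%N.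
Proof.
move=> mq qp; have [mw' w0] := mw.
have : map_poly iota q %| \prod_(r <- rs) ('X - r%:P) by rewrite -split_p dvdp_map.
move=> /dvdp_prod_XsubC[m]; set s := mask m rs => eqs.
have {}eqs : map_poly iota q = \prod_(r <- s) ('X - r%:P).
  by apply/eqP; rewrite -eqp_monic ?map_monic ?monic_prod_XsubC.
have srs : {subset s <= rs} by move=> r; apply: mem_mask.
have [J [_ a]] := roots_slopes srs.
have sq : (size q).-1 = size s by rewrite -(size_map_poly iota) eqs size_prod_XsubC.
have [x [y [y0 exy]]] := frac_ind q`_0.
have q0 : iota q`_0 = \prod_(r <- s) - r.
  rewrite -coef_map eqs -horner_coef0 horner_prod; apply: eq_bigr => r _.
  by rewrite !hornerE.
rewrite -q0 exy fmorph_div -[iota x%:F]/(k x) -[iota y%:F]/(k y) in a.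
have ky0 : k y != 0 by rewrite -(rmorph0 k) (inj_eq base_map_inj).
have x0 : x != 0.
  have := assoc_neq0 a (expf_neq0 _ w0).
  by apply: contraNneq => ->; rewrite rmorph0 mul0r expr0n gtn_eqF.
have E : (e * pval P x = \sum_(r <- s) kap (J r) + e * pval P y)%N.
  apply: (assoc_expI vO mw' w0); rewrite exprD ![w ^+ (e * _)]exprM ![w ^+ e ^+ _]exprAC.
  apply: (@assoc_trans _ _ vO _ (k x ^+ e)).
    by apply: assoc_sym; apply: assocX => //; apply: k_pval.
  have -> : k x ^+ e = (k x / k y) ^+ e * k y ^+ e by rewrite -exprMn mulfVK.
  by apply: assocM => //; apply: assocX => //; apply: k_pval.
have := dvdn_mulr (pval P x) (dvdnn e); rewrite E dvdn_addl ?dvdn_mulr //.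
rewrite -(big_map J xpredT (fun j => kap j)) slope_sum size_map dvdn_addl ?dvdn_mulr //.
by rewrite sq.
Qed.

(** The order of the constant term gives [e] times the sum of all numerators as the sum of the
    numerators belonging to the roots. Both sides contain [b * e] ones; after cancelling these and a
    factor [e], the powers of [Mb] are compared digit by digit. *)
Lemma slope_occurs j : (j < b)%N ->
  exists2 r, r \in rs & associate O (r ^+ e) (w ^+ kap j).
Proof.
move=> jb; have [mp sp c0 cv _] := pP; have [mw' w0] := mw.
have [J [JP a]] := @roots_slopes rs (fun r rrs => rrs).
have srs : size rs = (b * e)%N.
  have : size (\prod_(r <- rs) ('X - r%:P)) = (size rs).+1 by exact: size_prod_XsubC.
  rewrite -split_p size_map_poly size_map_poly_id0 ?sp => [[<-]//|].
  by rewrite (monicP mp) rmorph1 oner_neq0.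
have E : (\sum_(r <- rs) kap (J r) = e * newton_ord kap b)%N.
  apply: (assoc_expI vO mw' w0); apply: (assoc_trans vO (assoc_sym a)).
  have -> : \prod_(r <- rs) - r = k p`_0.
    rewrite -[k p`_0]/(iota (toF p`_0)) -!coef_map split_p -horner_coef0 horner_prod.
    by apply: eq_bigr => r _; rewrite !hornerE.
  rewrite mulnC exprM; apply: assocX => //; rewrite -cv ?b0 ?leqnn // subnn mul0n.
  by apply: k_pval; apply: c0; rewrite muln_gt0 b0.
have [r rrs ej] : exists2 r, r \in rs & j = J r.
  apply/mapP; apply: (@digits_occur Mb b e (map J rs)) => //.
  - by apply/allP => _ /mapP[r rrs ->]; case: (JP r rrs).
  - by rewrite size_map srs.
  - rewrite e0 (leq_ltn_trans _ M_gt) // leq_pmull //.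
  move: E; rewrite -(big_map J xpredT (fun j => kap j)) slope_sum size_map srs.
  rewrite /newton_ord /slope big_split sum1_card card_ord mulnDr [(e * b)%N]mulnC => /addnI/eqP.
  by rewrite eqn_pmul2l // -big_distrr => /eqP.
by exists r; rewrite // ej; case: (JP r rrs).
Qed.

Section PrimesOver.
Variables (L : fieldExtType F) (z : L).
Hypotheses (irr_p : irreducible_poly pF) (sep_p : separable_poly pF).
Hypotheses (pz : root (map_poly (in_alg L) pF) z) (gen_z : <<1; z>>%VS = fullv).
Local Notation E := (int_closure (ext_map L)).
Local Notation f := (ic_embed (ext_map L)).

(** The embedding sending [z] to a root of slope [kap j] pulls [O] back to [E], and [N] is the
    center. The final equation computes the value of [r ^+ e] twice: through [ze], and through the
    uniformizer at [P]. *)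
Lemma prime_of_slope (ze : E) j : ic_val ze = z -> (j < b)%N ->
  exists N, [/\ lies_over f P N, (0 < ramification f P N)%N &
                (e * pval N ze = ramification f P N * kap j)%N].
Proof.
move=> zeE jb; have [mp _ _ _ _] := pP.
have [r rrs ar] := slope_occurs jb; have [mw' w0] := mw.
have rr : root (map_poly iota pF) r by rewrite split_p root_prod_XsubC.
have [phi [phiz phiA]] := conjugation_exists irr_p pz gen_z rr.
pose psi : {rmorphism E -> M} := phi \o ic_val.
have dedE : dedekind E by apply: (ext_dedekind dedD mp irr_p sep_p pz gen_z).
have psi_inj : injective psi by move=> x y /fmorph_inj /ic_val_inj.
have psif a : psi (f a) = k a by rewrite /= -[RHS]phiA.
have psiO x : O (psi x).
  apply: integral_valuation_ring; apply: (conj_integral phiA).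
  exact: ic_val_integral.
pose N := center O psi.
have fN : f @^-1` N = P.
  by rewrite -cO; apply/funext => a; rewrite -[RHS]/(nonunit O (k a)) -psif.
have [Ppi pi0 _ _] := unifP dedD nP.
have nN : nzprime N.
  apply: (@center_nzprime _ _ vO _ psi psiO (f (unif P).1)); first by rewrite psif.
  by rewrite -(rmorph0 f) (inj_eq (ic_embed_inj (@ext_map_inj D L))).
have oN : lies_over f P N by split.
have psize : psi ze = r by rewrite -[psi ze]/(phi (ic_val ze)) zeE.
have r0 : r != 0.
  have := assoc_neq0 ar (expf_neq0 _ w0).
  by apply: contraNneq => ->; rewrite expr0n gtn_eqF.
have ze0 : ze != 0 by apply: contraNneq r0 => z0; rewrite -psize z0 rmorph0.
have [mW W0] := center_unif dedE psi_inj nN.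
exists N; split=> //.
  exact: (ramification_gt0 dedD dedE (ic_embed_inj (@ext_map_inj D L)) nP oN).
have fpi0 : f (unif P).1 != 0.
  by rewrite -(rmorph0 f) (inj_eq (ic_embed_inj (@ext_map_inj D L))).
apply: (assoc_expI vO mW W0).
apply: (@assoc_trans _ _ vO _ (r ^+ e)).
  apply: assoc_sym; rewrite mulnC exprM -psize; apply: assocX => //.
  exact: center_pval.
apply: (assoc_trans vO ar); rewrite exprM; apply: assocX => //.
rewrite /w -psif; exact: center_pval.
Qed.

(** [e] is prime to [kap j], hence divides the ramification index. Different [j] give different
    primes, because a prime determines both the order of [ze] and the ramification, and so the
    slope. *)
Lemma primes_over_slopes : exists Ms : seq (set E),
  [/\ forall N, N \in Ms -> lies_over f P N /\ (e <= ramification f P N)%N,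
      uniq Ms & size Ms = b].
Proof.
have [mp _ _ _ _] := pP; have [ze zeE] := ic_val_onto (ext_gen_integral mp pz).
have ex j : exists N, (j < b)%N -> [/\ lies_over f P N, (0 < ramification f P N)%N &
    (e * pval N ze = ramification f P N * kap j)%N].
  have [jb|_] := boolP (j < b)%N; last by exists setT.
  by have [N HN] := prime_of_slope zeE jb; exists N.
have [N NP] := boolp.choice ex; exists [seq N j | j <- seq.iota 0 b].
split; last by rewrite size_map size_iota.
  move=> _ /mapP[j + ->]; rewrite mem_iota => /NP[oN r0 er]; split=> //.
  apply: dvdn_leq => //; have := dvdn_mulr (pval (N j) ze) (dvdnn e).
  by rewrite er Gauss_dvdl // /coprime /slope addnC mulnC gcdnMDl gcdn1.
rewrite map_inj_in_uniq ?iota_uniq // => i j; rewrite !mem_iota => /NP[_ r0 ei] /NP[_ _ ej] eN.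
move: ej; rewrite -eN ei => /eqP; rewrite eqn_pmul2l // => /eqP e'.
by case: (ltngtP i j) => // /kap_lt; rewrite e' ltnn.
Qed.

Lemma primes_over_split N : lies_over f P N ->
  ramification f P N = e /\ forall y, exists a, N (y - f a).
Proof.
have [mp sp _ _ _] := pP; have [Ms [MsP uMs sMs]] := primes_over_slopes.
have dedE : dedekind E by apply: (ext_dedekind dedD mp irr_p sep_p pz gen_z).
apply: (@primes_over_exhausted _ _ f (b * e) P dedD dedE _ _ nP Ms e) => //.
- exact: ic_embed_inj (@ext_map_inj D L).
- move=> n y lt; apply: (ext_dependent mp irr_p pz gen_z); by rewrite sp.
- by rewrite sMs.
Qed.

Lemma prime_over_exists : exists N, lies_over f P N.
Proof.
have [Ms [MsP _ sMs]] := primes_over_slopes.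
by case: Ms sMs MsP b0 => [<-//|N Ms _ /(_ N (mem_head _ _))[]]; exists N.
Qed.

End PrimesOver.
End NewtonAt.
(** * Rees valuation rings *)

Lemma sub_normalization (K : fieldType) (S : set K) : subring S -> S `<=` normalization S.
Proof.
move=> sS x Sx; have S1 := subring1 sS; have S0 := subring0 sS; split.
  by exists x, 1; rewrite oner_neq0 divr1.
exists ('X - x%:P); split; rewrite ?monicXsubC ?root_XsubC // => i.
rewrite coefB coefX coefC; apply: (subringB sS).
  by case: (i == 1)%N.
by case: (i == 0)%N.
Qed.

Section ReesDedekind.
Variables (R : idomainType) (J : set R).
Hypotheses (dedR : dedekind R) (nJ : nzideal J).
Local Notation F := {fraction R}.

Definition local_ring (N : set R) : set F :=
  [set x | exists a b, ~ N b /\ x = a%:F / b%:F].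

Section Center.
Variables (K : fieldType) (ofq : {rmorphism F -> K}) (R' p : set K).
Hypotheses (pp : prime_ideal_of R' p) (R'c : forall a, R' (ofq a%:F)).
Hypothesis Jp : forall a, J a -> p (ofq a%:F).

(* The left-hand ring contains the discrete valuation ring of N and is not the
   whole field. *)
Lemma localization_local : exists N, [/\ nzprime N, J `<=` N &
  [set x | localization R' p (ofq x)] = local_ring N].
Proof.
have [[sub p0 pD pM] p1 ppr] := pp.
pose N := [set a : R | p (ofq a%:F)].
have nN : nzprime N.
  split; last by have [_ [a Ja a0]] := nJ; exists a => //; apply: Jp.
  split.
  - split=> //; first by rewrite /N /= tofrac0 rmorph0.
    + by move=> x y px py; rewrite /N /= tofracD rmorphD; apply: pD.
    + by move=> s x _ px; rewrite /N /= tofracM rmorphM; apply: pM.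
  - by rewrite /N /= tofrac1 rmorph1.
  - by move=> x y _ _; rewrite /N /= tofracM rmorphM; apply: ppr.
exists N; split=> //; apply/seteqP; split=> x; last first.
  move=> [a [b [Nb ->]]]; exists (ofq a%:F), (ofq b%:F); split=> //.
  by rewrite fmorph_div.
move=> [u [v [R'u R'v pv e]]].
have N0 := ideal0 (nzprime_ideal nN); have N1 : ~ N 1 by case: nN => -[].
have v0 : v != 0 by apply: contra_notN pv => /eqP ->.
have [a [b [b0 ex]]] := frac_ind x.
have [a0|a0] := eqVneq a 0.
  by exists 0, 1; split=> //; rewrite ex a0 tofrac0 !mul0r.
have [s [y [Ns Ny ea]]] := pvalP dedR nN a0.
have [s' [y' [Ns' Ny' eb]]] := pvalP dedR nN b0.
have [Npi pi0 _ _] := unifP dedR nN.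
have neq0 z : ~ N z -> z%:F != 0 by move=> Nz; rewrite tofrac_eq0; apply: contra_notN Nz => /eqP ->.
have pN := nzprime_prime nN.
case: (leqP (pval N b) (pval N a)) => [le|lt].
  exists (s' * ((unif N).1 ^+ (pval N a - pval N b) * y)), (s * y').
  split; first exact: prime_ideal_mul.
  apply/eqP; rewrite ex eqr_div ?tofrac_eq0 //; last first.
    by rewrite -tofrac_eq0; apply/neq0/prime_ideal_mul.
  rewrite -!tofracM tofrac_eq; apply/eqP.
  rewrite [a * _]mulrA [a * s]mulrC ea [RHS]mulrAC eb -{1}(subnK le) exprD -!mulrA.
  by rewrite [LHS]mulrCA [y * y']mulrC [y' * (_ * _)]mulrCA.
(* Here [x] has a pole at [N]: its product with the element [s * y' * (unif N).1 ^+ n] of [N] is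
   [s' * y], outside [N]. Substituting [x = u / v] would force [v] or [s' * y] into [p]. *)
pose n := (pval N b - pval N a)%N.
have e1 : a * (s * y' * (unif N).1 ^+ n) = b * (s' * y).
  rewrite -mulrA [a * _]mulrA [a * s]mulrC ea [RHS]mulrCA [RHS]mulrA eb.
  rewrite -(subnK (ltnW lt)) -/n exprD -!mulrA [RHS]mulrCA; congr (_ * _).
  by rewrite mulrA mulrC [y * y']mulrC.
have e2 : u * ofq (s * y' * (unif N).1 ^+ n)%:F = v * ofq (s' * y)%:F.
  have bF0 : b%:F != 0 by rewrite tofrac_eq0.
  have : x * (s * y' * (unif N).1 ^+ n)%:F = (s' * y)%:F.
    by rewrite ex mulrAC -tofracM e1 tofracM mulrC mulKf.
  move=> /(congr1 ofq); rewrite rmorphM e => <-.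
  by rewrite mulrA [v * _]mulrC mulfVK.
have pl : p (v * ofq (s' * y)%:F).
  have Npin : N (s * y' * (unif N).1 ^+ n).
    have iN := nzprime_ideal nN; apply: (ideal_mull _ iN).
    have : (0 < n)%N by rewrite subn_gt0.
    by case: (n) => // k _; rewrite exprS; apply: (ideal_mulr _ iN).
  by rewrite -e2; apply: pM.
case: (ppr _ _ R'v (R'c _) pl) => // Nsy.
by case: (prime_ideal_mul pN Ns' Ny).
Qed.

End Center.

(** For [a] in [J], the identity [a = t^-1 * (a * t)] puts [a] into the ideal generated by [t^-1],
    hence into [p]. So [p] contracts to a nonzero prime of [R] containing [J]. *)
Lemma rees_valuation_ring_local V : rees_valuation_ring J V ->
  exists N, [/\ nzprime N, J `<=` N & V = local_ring N].
Proof.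
pose K : fieldType := {fraction {poly F}}.
pose ofq : {rmorphism F -> K} := @FracField.tofrac {poly F} \o polyC.
move=> [p [pp tp _] ->].
have R'S : rees_ring J `<=` normalization (rees_ring J).
  have sub (A : set K) : subring_closed [pred x : K | x \in A] -> subring A.
    move=> [A1 AB AM]; split; first by rewrite inE in A1.
      by move=> x y Ax Ay; have := AB x y; rewrite !inE; apply.
    by move=> x y Ax Ay; have := AM x y; rewrite !inE; apply.
  apply: sub_normalization; split.
  - by move=> A [/sub sA _]; apply: subring1.
  - by move=> x y Sx Sy A HA; have [/sub sA _] := HA; apply: subringB; [|apply: Sx|apply: Sy].
  - by move=> x y Sx Sy A HA; have [/sub sA _] := HA; apply: subringM; [|apply: Sx|apply: Sy].
have t0 : rees_var R != 0 by rewrite tofrac_eq0 polyX_eq0.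
apply: (@localization_local K ofq (normalization (rees_ring J)) p) => //.
  by move=> a; apply: R'S => A [_]; apply; constructor 1; exists a.
move=> a Ja; apply: tp; exists (ofq a%:F * rees_var R).
  by apply: R'S => A [_]; apply; constructor 3; exists a.
by rewrite mulrCA mulVf // mulr1.
Qed.

Section Local.
Variable N : set R.
Hypothesis nN : nzprime N.
Local Notation V := (local_ring N).
Let m : set F := [set x | exists2 v, V v & x = (unif N).1%:F * v].
Let pi := (unif N).1%:F : F.

Let pN := nzprime_prime nN.
Let N1 : ~ N 1. Proof. by case: pN. Qed.
Let neq0 z : ~ N z -> z%:F != 0 :> F.
Proof.
move=> Nz; rewrite tofrac_eq0; apply: contra_notN Nz => /eqP ->.
by apply: ideal0; apply: nzprime_ideal.
Qed.

Let V_frac a b : ~ N b -> V (a%:F / b%:F). Proof. by move=> Nb; exists a, b. Qed.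
Let V1 : V 1.
Proof. by exists 1, 1; split=> //; rewrite divff // tofrac1 oner_neq0. Qed.
Let V0 : V 0.
Proof. by exists 0, 1; split=> //; rewrite tofrac0 mul0r. Qed.
Let VD x y : V x -> V y -> V (x + y).
Proof.
move=> [a [b [Nb ->]]] [c [d [Nd ->]]]; rewrite addf_div ?neq0 //.
by rewrite -!tofracM -tofracD; apply: V_frac; apply: prime_ideal_mul.
Qed.
Let VM x y : V x -> V y -> V (x * y).
Proof.
move=> [a [b [Nb ->]]] [c [d [Nd ->]]]; rewrite mulf_div -!tofracM.
by apply: V_frac; apply: prime_ideal_mul.
Qed.

Let pi0 : pi != 0.
Proof. by have [_ pi0 _ _] := unifP dedR nN; rewrite tofrac_eq0. Qed.

Let m_frac a b : N a -> ~ N b -> m (a%:F / b%:F).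
Proof.
move=> Na Nb; have [_ _ Nu uP] := unifP dedR nN; have [y e] := uP a Na.
exists (y%:F / ((unif N).2 * b)%:F); first by apply: V_frac; apply: prime_ideal_mul.
rewrite mulrA -tofracM -e !tofracM -mulf_div divff ?mul1r //.
exact: neq0.
Qed.

Let m_ideal : ideal_of V m.
Proof.
split.
- by move=> _ [v Vv ->]; apply: VM => //; exists (unif N).1, 1; rewrite tofrac1 divr1.
- by exists 0; rewrite ?mulr0.
- by move=> _ _ [v Vv ->] [v' Vv' ->]; exists (v + v'); rewrite ?mulrDr //; apply: VD.
- by move=> s _ Vs [v Vv ->]; exists (s * v); [apply: VM|rewrite mulrCA].
Qed.

Let m1 : ~ m 1.
Proof.
move=> [_ [a [b [Nb ->]]] /eqP]; rewrite mulrA -tofracM eq_sym -(inj_eq (mulIf (neq0 Nb))).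
rewrite mulfVK ?neq0 // mul1r tofrac_eq => /eqP e; apply: Nb; rewrite -e.
by have [Npi _ _ _] := unifP dedR nN; apply: ideal_mulr => //; apply: nzprime_ideal.
Qed.

Let proper_sub A : ideal_of V A -> ~ A 1 -> A `<=` m.
Proof.
move=> [sAV _ _ AM] A1 x Ax; have [a [b [Nb ex]]] := sAV x Ax; rewrite ex.
apply: m_frac => //; apply: contrapT => Na; apply: A1.
have -> : 1 = (b%:F / a%:F) * x by rewrite ex mulf_div [b%:F * _]mulrC divff // mulf_neq0 ?neq0.
by apply: AM => //; apply: V_frac.
Qed.

Let m_maximal : maximal_ideal_of V m.
Proof.
split=> // A iA A1 sA; apply/seteqP; split=> //; exact: proper_sub.
Qed.

Let m_uniq A : maximal_ideal_of V A -> A = m.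
Proof. by move=> [iA A1 maxA]; apply/esym/maxA => //; apply: proper_sub. Qed.

Let m_exp1 : ideal_exp V m 1 = m.
Proof.
apply/seteqP; split=> x; last first.
  by move=> mx; rewrite -[x]mulr1; apply: mul_span_mem.
have [sV m0 mD mM] := m_ideal; apply: mul_span_sub => // a b ma Vb.
by rewrite mulrC; apply: mM.
Qed.

Let m_exp_sub n : (0 < n)%N -> ideal_exp V m n `<=` m.
Proof.
case: n => // n _; have [sV m0 mD mM] := m_ideal.
have expV k : ideal_exp V m k `<=` V.
  elim: k => [//|k IHk]; apply: mul_span_sub => // a b /sV Va /IHk Vb; exact: VM.
by apply: mul_span_sub => // a b ma /expV Vb; rewrite mulrC; apply: mM.
Qed.

(** An element of order one makes [J] generate the maximal ideal [m] of the local ring. The exponent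
    0 would give the whole ring, and an exponent of at least 2 an ideal inside [pi ^+ 2 * V], which
    does not contain [pi]. *)
Lemma local_rees_integer : J `<=` N -> (exists c, [/\ J c, c != 0 & pval N c = 1%N]) ->
  forall e, rees_integer J V e <-> e = 1%N.
Proof.
move=> sJN [c [Jc c0 vc]] e; have [sV m0 mD mM] := m_ideal.
have JV : mul_span [set a%:F | a in J] V = m.
  apply/seteqP; split.
    apply: mul_span_sub => // _ v [a Ja <-] Vv; rewrite mulrC; apply: mM => //.
    by rewrite -[a%:F]divr1 -tofrac1; apply: m_frac => //; apply: sJN.
  move=> _ [v Vv ->]; have [s [y [Ns Ny es]]] := pvalP dedR nN c0.
  have -> : pi * v = c%:F * (s%:F / y%:F * v).
    rewrite !mulrA -tofracM [c * s]mulrC es vc expr1 tofracM mulfK //.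
    exact: neq0.
  apply: mul_span_mem; first by exists c.
  by apply: VM => //; apply: V_frac.
split=> [[A mA]|->]; last first.
  by exists m; rewrite ?m_exp1.
rewrite (m_uniq mA) JV; case: e => [|[|e]] // em.
  by case: m1; rewrite em.
have mpi : m pi by exists 1; rewrite ?mulr1.
have : ideal_exp V m e.+2 `<=` [set x | exists2 v, V v & x = pi * (pi * v)].
  apply: mul_span_sub; first by exists 0; rewrite ?mulr0.
    by move=> _ _ [v Vv ->] [v' Vv' ->]; exists (v + v'); rewrite ?mulrDr //; apply: VD.
  move=> _ b [v Vv ->] /(m_exp_sub (ltn0Sn e))[v' Vv' ->]; exists (v * v'); first exact: VM.
  by rewrite mulrACA -mulrA.
rewrite -em => /(_ pi mpi)[v Vv /eqP]; rewrite -{1}[pi]mulr1 (inj_eq (mulfI pi0)) => /eqP e1.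
by case: m1; rewrite e1; exists v.
Qed.

End Local.

Lemma dedekind_rees_integers : (forall N, nzprime N -> J `<=` N -> ival N J = 1%N) ->
  forall V, rees_valuation_ring J V -> forall e, rees_integer J V e <-> e = 1%N.
Proof.
move=> J1 V /rees_valuation_ring_local[N [nN sJN ->]]; apply: local_rees_integer => //.
by have [_ [c [Jc c0 vc]]] := ivalP N nJ; exists c; rewrite vc J1.
Qed.

End ReesDedekind.
(** * Construction of the extension *)

Lemma residue_map_bijective (D E : idomainType) (f : {rmorphism D -> E}) (N : idealr E) :
  (forall y, exists a, y - f a \in N) -> bijective (@residue_map D E f N).
Proof.
move=> res.
have inj : injective (@residue_map D E f N).
  move=> x y; rewrite /residue_map => /eqP.
  rewrite -Quotient.idealrBE -rmorphB => fxy.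
  rewrite -[x]reprK -[y]reprK; apply/eqP; rewrite -Quotient.idealrBE.
  exact: fxy.
have surj y : exists x, @residue_map D E f N x = y.
  have [a aP] := res (repr y); exists (\pi_({ideal_quot (contraction f N)})%qT a).
  rewrite residue_mapE -[y in RHS]reprK; apply/eqP.
  by rewrite eq_sym -Quotient.idealrBE.
have [g gP] := boolp.choice surj.
by exists g => // x; apply: inj; rewrite gP.
Qed.

(** * Projective fullness from orders at most one *)

Section ProjectivelyFull.
Variables (E : idomainType) (J : set E).
Hypotheses (dedE : dedekind E) (nJ : nonzero_proper_ideal J).
Hypothesis J_val : forall N, nzprime N -> (ival N J <= 1)%N.

Lemma nonzero_proper_nzideal (A : set E) : nonzero_proper_ideal A -> nzideal A.
Proof. by case=> iA A0 _; split. Qed.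

Let zJ := nonzero_proper_nzideal nJ.

Lemma ideal_exp1 (A : set E) : ideal A -> A ^^+ 1 = A.
Proof.
move=> iA; apply/seteqP; split=> x; first exact: ideal_exp_sub.
by move=> Ax; rewrite -[x]mulr1; apply: mul_span_mem.
Qed.

(** Projective equivalence means that the orders of [A] and [J] are proportional. At one prime [M]
    over [J] the order of [J] is 1, so the ratio is the integer [ival M A], and it is the same at
    every prime. *)
Lemma proj_equiv_power (A : set E) : proj_equiv A J ->
  ideal_closure A = A -> exists2 n, (0 < n)%N & A = J ^^+ n.
Proof.
move=> [nA _ [p [q [p0 q0 epq]]]] cA.
have zA := nonzero_proper_nzideal nA.
have e N : nzprime N -> (p * ival N A = q * ival N J)%N.
  move=> nN; rewrite -(ival_exp dedE p nN zA) -(ival_exp dedE q nN zJ).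
  rewrite -(ideal_closure_id dedE (ideal_exp_nzideal p zA)) epq.
  by rewrite (ideal_closure_id dedE (ideal_exp_nzideal q zJ)).
have [iJ _ J1] := nJ.
have [M mM sJM] : exists2 M, maximal_ideal M & J `<=` M.
  by apply: maximal_over => //; case: dedE.
have nM : nzprime M.
  split; first exact: maximal_prime.
  by have [_ [x Jx x0]] := zJ; exists x => //; apply: sJM.
have val1 N : nzprime N -> J `<=` N -> ival N J = 1%N.
  move=> nN sJN; apply/eqP; rewrite eqn_leq J_val //.
  exact/(ival_gt0 dedE nN zJ).
have eM := e M nM; rewrite val1 // muln1 in eM.
exists (ival M A); first by move: q0; rewrite -eM muln_gt0 => /andP[].
apply: (ival_inj dedE zA (ideal_exp_nzideal _ zJ)) => N nN.
apply/eqP; rewrite ival_exp // -(eqn_pmul2l p0) e // mulnA eM.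
exact: eqxx.
Qed.

Lemma radical_projectively_full : projectively_full J.
Proof.
have [iJ _ _] := nJ; have cJ := ideal_closure_id dedE zJ.
split=> //; exists J, J; split=> //; split.
  split.
    by split=> //; split=> //; exists 1%N, 1%N.
  move=> A [AJ cA]; have [n n0 ->] := proj_equiv_power AJ cA.
  exact: ideal_exp_sub.
move=> A [AJ cA]; have [n n0 ->] := proj_equiv_power AJ cA.
exists n => //; rewrite ideal_closure_id //.
exact: ideal_exp_nzideal.
Qed.

End ProjectivelyFull.

Lemma ival_extension (D E : idomainType) (f : {rmorphism D -> E}) (I P : set D) (N : set E) :
  dedekind D -> dedekind E -> injective f -> nzideal I -> nzprime P -> lies_over f P N ->
  nzideal (ideal_extension f I) ->
  ival N (ideal_extension f I) = (ival P I * ramification f P N)%N.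
Proof.
move=> dedD dedE f_inj zI nP oN zIE; have [nN _] := oN.
have [geI [a [Ia a0 va]]] := ivalP P zI.
have fa0 : f a != 0 by rewrite -(rmorph0 f) (inj_eq f_inj).
apply: ival_eq => //; split; last first.
  exists (f a); split=> //; last by rewrite (ramification_pval dedD dedE f_inj nP oN) // va.
  by rewrite -[f a]mulr1; apply: mul_span_mem => //; exists a.
have iv := vge_ideal dedE (ival P I * ramification f P N) nN.
apply: mul_span_sub; first exact: (ideal0 iv).
  by move=> x y; apply: (idealD iv).
move=> _ y [c Ic <-] _; apply: (ideal_mulr _ iv).
have [->|c0] := eqVneq c 0; first by left; rewrite rmorph0.
right; rewrite (ramification_pval dedD dedE f_inj nP oN) // leq_mul2r.
by rewrite ((vge_lt P _ c0).1 (geI c Ic)) orbT.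
Qed.

Lemma biggcdn_dvd (T : eqType) (s : seq T) (F : T -> nat) x : x \in s ->
  (\big[gcdn/0]_(y <- s) F y %| F x)%N.
Proof.
elim: s => // y s IHs; rewrite inE big_cons => /predU1P[->|/IHs]; first exact: dvdn_gcdl.
exact: dvdn_trans (dvdn_gcdr _ _).
Qed.

Lemma biggcdn_mull (T : eqType) (s : seq T) (F : T -> nat) c :
  (c * \big[gcdn/0]_(y <- s) F y = \big[gcdn/0]_(y <- s) (c * F y))%N.
Proof.
elim: s => [|y s IHs]; first by rewrite !big_nil muln0.
by rewrite !big_cons muln_gcdr IHs.
Qed.

Lemma dvd_biggcdn (T : eqType) (s : seq T) (F : T -> nat) d :
  (forall x, x \in s -> d %| F x)%N -> (d %| \big[gcdn/0]_(y <- s) F y)%N.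
Proof.
move=> dF; rewrite big_seq; apply: (big_ind (fun x => d %| x)%N) => [|x y dx dy|//].
  exact: dvdn0.
by rewrite dvdn_gcd dx.
Qed.

(** * The polynomial with prescribed Newton polygons *)

Section NewtonPolynomial.
Variables (D : idomainType) (ps : seq (set D)) (d : nat) (b e : set D -> nat).
Hypotheses (dedD : dedekind D) (d0 : (0 < d)%N).
Hypothesis nps : forall P, P \in ps -> nzprime P.
Hypothesis be : forall P, P \in ps -> (b P * e P)%N = d.
Hypothesis b_gcd : (\big[gcdn/0]_(P <- ps) b P = 1)%N.

Let be0 P : P \in ps -> (0 < b P)%N /\ (0 < e P)%N.
Proof. by move=> /be ebe; move: d0; rewrite -ebe muln_gt0 => /andP. Qed.

Lemma newton_polynomial_exists : exists p : {poly D},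
  [/\ p \is monic, size p = d.+1, forall k, (k <= d)%N -> p`_k != 0 &
      forall P, P \in ps -> newton_at P (b P) (e P) d.+1 p].
Proof.
(* At [k = (b P - t) * e P] the expression [b P - k %/ e P] is the vertex index [t]. The base [d.+1]
   exceeds the number [d] of roots, so multiplicities of slopes are digits. *)
pose n k P := if (e P %| k)%N then newton_ord (slope (e P) d.+1) (b P - k %/ e P)
  else newton_ord (slope (e P) d.+1) (b P).
have ex k : exists c, c != 0 /\ forall P, P \in ps -> pval P c = n k P.
  by have [c c0 cP] := pval_approx dedD (n k) nps; exists c.
have [c cP] := boolp.choice ex.
pose p := \poly_(k < d.+1) (if k == d then 1 else c k).
have pk k : (k < d)%N -> p`_k = c k.
  by move=> kd; rewrite coef_poly ltnS (ltnW kd) ltn_eqF.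
have pd : p`_d = 1 by rewrite coef_poly ltnSn eqxx.
have sp : size p = d.+1 by rewrite size_poly_eq //= eqxx oner_neq0.
have mp : p \is monic by rewrite monicE lead_coefE sp pd.
have pn0 k : (k <= d)%N -> p`_k != 0.
  rewrite leq_eqVlt => /predU1P[->|kd]; first by rewrite pd oner_neq0.
  by rewrite pk //; case: (cP k).
exists p; split=> // P Pps; have ebe := be Pps; have [bP0 eP0] := be0 Pps.
split; rewrite ?ebe //.
- by move=> k kd; apply: pn0; apply: ltnW.
- move=> t /andP[t0 tb].
  have ltd : ((b P - t) * e P < d)%N by rewrite -ebe ltn_mul2r eP0 ltn_subrL t0.
  rewrite pk //; have [_ ->//] := cP ((b P - t) * e P)%N.
  by rewrite /n dvdn_mull // mulnK // subKn.
- move=> k kd ndiv; rewrite pk //; have [_ ->//] := cP k.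
  by rewrite /n (negPf ndiv).
Qed.

Local Notation F := {fraction D}.
Local Notation toF := (@FracField.tofrac D : {rmorphism D -> F}).

Lemma newton_polynomial_irreducible (p : {poly D}) :
  (forall P, P \in ps -> newton_at P (b P) (e P) d.+1 p) -> p \is monic ->
  size p = d.+1 -> irreducible_poly (map_poly toF p).
Proof.
move=> pP mp sp; have spF : size (map_poly toF p) = d.+1.
  by rewrite size_map_poly_id0 // (monicP mp) rmorph1 oner_neq0.
split=> [|q sq qp]; first by rewrite spF ltnS.
have p0 : map_poly toF p != 0 by rewrite -size_poly_gt0 spF.
have q0 : q != 0 by apply: contraNneq p0 => q0; rewrite -dvd0p -q0.
have [M [iota [rs split_p]]] := splitting_field_exists (monic_map toF mp).
pose q' := (lead_coef q)^-1 *: q.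
have lq0 : (lead_coef q)^-1 != 0 by rewrite invr_eq0 lead_coef_eq0.
have mq' : q' \is monic by rewrite monicE lead_coefZ mulVf // lead_coef_eq0.
have q'p : q' %| map_poly toF p by rewrite dvdpZl.
have sq' : size q' = size q by rewrite size_scale.
have dvd_e P : P \in ps -> (e P %| (size q).-1)%N.
  move=> Pps; have [bP0 eP0] := be0 Pps; rewrite -sq'.
  have M_gt : (b P * e P < d.+1)%N by rewrite be.
  have [O [vO kO cO]] := dominating_valuation_ring dedD (@base_map_inj _ _ iota) (nps Pps).
  exact: (factor_degree dedD (nps Pps) bP0 eP0 M_gt (pP P Pps) split_p vO kO cO mq' q'p).
(* [d = b P * e P] divides [b P] times the degree for each [P], hence the gcd of these products,
   which is the degree itself. *)
have dvd_d : (d %| (size q).-1)%N.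
  rewrite -[(size q).-1]muln1 -b_gcd biggcdn_mull; apply: dvd_biggcdn => P Pps.
  by rewrite -(be Pps) mulnC dvdn_mul // dvd_e.
have sq1 : (0 < (size q).-1)%N.
  have : (0 < size q)%N by rewrite size_poly_gt0.
  by case: (size q) sq => [|[]].
rewrite -dvdp_size_eqp // spF eqn_leq -{1}spF dvdp_leq //=.
by rewrite (leq_ltn_trans (dvdn_leq sq1 dvd_d)) // prednK // size_poly_gt0.
Qed.

(** The linear coefficient is the constant coefficient of the derivative, so the derivative is
    nonzero in every characteristic; being of smaller degree, it is prime to an irreducible
    polynomial. *)
Lemma newton_polynomial_separable (p : {poly D}) :
  irreducible_poly (map_poly toF p) -> p`_1 != 0 -> separable_poly (map_poly toF p).
Proof.
move=> irr p1; rewrite separable_poly.unlock irreducible_poly_coprime //.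
have dp0 : (map_poly toF p)^`() != 0.
  apply: contra_neq p1 => dp0; have := congr1 (fun q : {poly F} => q`_0) dp0.
  rewrite coef_deriv coef0 mulr1n coef_map /= => /eqP.
  by rewrite tofrac_eq0 => /eqP.
apply/negP => /(dvdp_leq dp0); apply/negP; rewrite -ltnNge.
by apply: lt_size_deriv; apply: irredp_neq0.
Qed.

End NewtonPolynomial.

Theorem corollary2p9 (D : idomainType) (I : set D) :
  dedekind D -> nonzero_proper_ideal I ->
  exists (E : idomainType) (f : {rmorphism D -> E}) (J : set E) (m : nat),
    [/\ dedekind E,
        finite_separable_integral_extension f,
        radical_ideal J,
        (0 < m)%N &
        ideal_extension f I = J ^^+ m] /\
    [/\ projectively_full J,
        proj_equiv J (ideal_extension f I) &
        forall V, rees_valuation_ring J V ->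
          forall e, rees_integer J V e <-> e = 1%N] /\
    (forall N : idealr E, maximal_ideal [set` N] -> f @` I `<=` [set` N] ->
       bijective (@residue_map D E f N)) /\
    (exists2 d : nat, extension_degree (frac_map f) d & (d %| m)%N).
Proof.
move=> dedD nI; have zI := nonzero_proper_nzideal nI; have [iI [x0 Ix0 x00] I1] := nI.
have noD : noetherian D by case: dedD.
have nzP P : prime_ideal P -> I `<=` P -> nzprime P.
  by move=> pP sIP; split=> //; exists x0 => //; apply: sIP.
have [ps psE] : exists ps : seq (set D), forall P, (P \in ps) = `[< prime_ideal P /\ I `<=` P >].
  apply: finite_primes_over => // P pP sIP; exact: nzprime_max (nzP P pP sIP).
have nps P : P \in ps -> nzprime P by rewrite psE => /asboolP[]; apply: nzP.
pose a P := ival P I; pose c := (\big[gcdn/0]_(P <- ps) a P)%N.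
have a0 P : P \in ps -> (0 < a P)%N.
  move=> Pps; apply/(ival_gt0 dedD (nps P Pps) zI).
  by move: Pps; rewrite psE => /asboolP[].
have [P0 P0ps] : exists P, P \in ps.
  have [M mM sIM] := maximal_over noD iI I1; exists M; rewrite psE; apply/asboolP.
  by split=> //; apply: maximal_prime.
have ca P : P \in ps -> (c %| a P)%N by apply: biggcdn_dvd.
have c0 : (0 < c)%N := dvdn_gt0 (a0 P0 P0ps) (ca P0 P0ps).
pose b P := (a P %/ c)%N.
have cb P : P \in ps -> (c * b P = a P)%N by move=> /ca; rewrite mulnC; apply: divnK.
have b0 P : P \in ps -> (0 < b P)%N.
  by move=> Pps; have := a0 P Pps; rewrite -cb // muln_gt0 => /andP[].
have b_gcd : (\big[gcdn/0]_(P <- ps) b P = 1)%N.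
  apply/eqP; rewrite -(eqn_pmul2l c0) muln1 biggcdn_mull; apply/eqP.
  exact: (eq_big_seq a cb).
pose d := (\prod_(P <- ps) b P)%N; pose e P := (d %/ b P)%N.
have d0 : (0 < d)%N.
  rewrite /d big_seq; apply: (big_ind (fun x => 0 < x)%N) => // x y x0' y0.
  by rewrite muln_gt0 x0'.
have be P : P \in ps -> (b P * e P)%N = d.
  by move=> Pps; rewrite mulnC divnK // /d (big_rem P) //= dvdn_mulr.
have e0 P : P \in ps -> (0 < e P)%N.
  by move=> /be ebe; move: d0; rewrite -ebe muln_gt0 => /andP[].
have [p [mp sp pn0 pP]] := newton_polynomial_exists dedD d0 nps be.
pose toF : {rmorphism D -> {fraction D}} := @FracField.tofrac D.
have irr_p : irreducible_poly (map_poly toF p).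
  exact: (newton_polynomial_irreducible dedD d0 nps be b_gcd).
have sep_p : separable_poly (map_poly toF p).
  by apply: newton_polynomial_separable => //; apply: pn0.
have [L _ [z pz gen_z]] := irredp_FAdjoin irr_p.
(* One splitting field serves all primes of [ps]; only the valuation ring inside it depends on
   [P]. *)
have [M [iota [rs split_p]]] := splitting_field_exists (monic_map toF mp).
pose h := ext_map L; pose E : idomainType := int_closure h.
pose f : {rmorphism D -> E} := ic_embed h.
have dedE : dedekind E by apply: (ext_dedekind dedD mp irr_p sep_p pz gen_z).
have f_inj : injective f by apply: ic_embed_inj; apply: ext_map_inj.
have splitP P : P \in ps ->
    (forall N : set E, lies_over f P N ->
       ramification f P N = e P /\ forall y, exists a, N (y - f a)) /\
    exists N : set E, lies_over f P N.
  move=> Pps; have nP := nps P Pps.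
  have M_gt : (b P * e P < d.+1)%N by rewrite be.
  have [O [vO kO cO]] := dominating_valuation_ring dedD (@base_map_inj _ _ iota) nP.
  split=> [N oN|].
    exact: (primes_over_split dedD nP (b0 P Pps) (e0 P Pps) M_gt (pP P Pps) split_p
      vO kO cO irr_p sep_p pz gen_z).
  exact: (prime_over_exists dedD nP (b0 P Pps) (e0 P Pps) M_gt (pP P Pps) split_p
      vO kO cO irr_p sep_p pz gen_z).
pose IE := ideal_extension f I; pose m := (c * d)%N.
have IEf x : I x -> IE (f x).
  by move=> Ix; rewrite -[f x]mulr1; apply: mul_span_mem => //; exists x.
have zIE : nzideal IE.
  split; first by apply: mul_span_ideal; apply: idealT.
  by exists (f x0); [apply: IEf | rewrite -(rmorph0 f) (inj_eq f_inj)].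
have iIE := zIE.1.
have sIE (N : set E) : ideal N -> (IE `<=` N <-> forall x, I x -> N (f x)).
  move=> iN; split=> [s x Ix|s]; first exact/s/IEf.
  apply: mul_span_sub; first exact: ideal0.
    by move=> x y; apply: idealD.
  by move=> _ y [x Ix <-] _; apply: ideal_mulr => //; apply: s.
have nzN (N : set E) : prime_ideal N -> IE `<=` N -> nzprime N.
  move=> pN s; split=> //; have [_ [y IEy y0]] := zIE.
  by exists y => //; apply: s.
have over (N : set E) : nzprime N -> IE `<=` N ->
    (f @^-1` N \in ps) /\ lies_over f (f @^-1` N) N.
  move=> nN s; split; last by split.
  rewrite psE; apply/asboolP; split; first exact: ext_contraction_prime (nzprime_prime nN).
  exact/(sIE N (nzprime_ideal nN)).
have [qs qsE] : exists qs : seq (set E), forall N, (N \in qs) = `[< prime_ideal N /\ IE `<=` N >].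
  apply: finite_primes_over => //; first by case: dedE.
  by move=> N pN s; apply: nzprime_max (nzN N pN s).
have nqs N : N \in qs -> nzprime N by rewrite qsE => /asboolP[]; apply: nzN.
(* Taking the intersection of the primes over [IE] makes radicality immediate; its orders are
   determined by approximation. *)
pose J : set E := [set x | forall N, N \in qs -> N x].
have iJ : ideal J.
  split=> //.
  - by move=> N /nqs/nzprime_ideal; apply: ideal0.
  - by move=> x y Jx Jy N Nqs; apply: idealD; [apply/nzprime_ideal/nqs | apply: Jx | apply: Jy].
  - by move=> s x _ Jx N Nqs; apply: ideal_mull; [apply/nzprime_ideal/nqs | apply: Jx].
have sIEJ : IE `<=` J.
  by move=> x IEx N; rewrite qsE => /asboolP[_]; apply.
have zJ : nzideal J.
  by split=> //; have [_ [y IEy y0]] := zIE; exists y => //; apply: sIEJ.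
have [N0 oN0] := (splitP P0 P0ps).2.
have N0qs : N0 \in qs.
  have [nN0 fN0] := oN0; rewrite qsE; apply/asboolP; split; first exact: nzprime_prime.
  apply/(sIE N0 (nzprime_ideal nN0)) => x Ix.
  have : (f @^-1` N0) x by rewrite fN0; move: P0ps; rewrite psE => /asboolP[_]; apply.
  by [].
have nJ : nonzero_proper_ideal J.
  by split=> //; [case: zJ | move=> /(_ N0 N0qs); case: (nqs N0 N0qs) => -[]].
have nIE : nonzero_proper_ideal IE.
  by split=> //; [case: zIE | move=> /sIEJ; case: nJ].
have qs_val N : nzprime N -> ival N J = (N \in qs).
  move=> nN; pose n Q : nat := Q \in qs.
  (* [N] is put in front of [qs] so that the order of the approximating element is also controlled
     at a prime that does not contain [IE]. *)
  have nNqs Q : Q \in N :: qs -> nzprime Q by rewrite inE => /predU1P[->//|/nqs].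
  have [t t0 tP] := pval_approx dedE n nNqs.
  have Jt : J t.
    move=> Q Qqs; apply/(pval_gt0 dedE (nqs Q Qqs) t0).
    by rewrite tP ?inE ?Qqs ?orbT // /n Qqs.
  apply: ival_eq => //; split; last by exists t; rewrite tP ?mem_head.
  move=> x Jx; have [Nqs|_] := boolP (N \in qs); last by right.
  by apply/vge1 => //; apply: Jx.
have IE_val N : nzprime N -> ival N IE = (m * (N \in qs))%N.
  move=> nN; have [Nqs|nNqs] := boolP (N \in qs).
    have s : IE `<=` N by move: Nqs; rewrite qsE => /asboolP[].
    have [Pps oN] := over N nN s; have nP := nps _ Pps.
    rewrite (ival_extension dedD dedE f_inj zI nP oN zIE).
    have [-> _] := (splitP _ Pps).1 N oN.
    by rewrite -/(a _) -cb // -mulnA be // muln1.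
  rewrite muln0; apply/eqP; rewrite -leqn0 leqNgt; apply: contraNN nNqs.
  move=> /(ival_gt0 dedE nN zIE) s; rewrite qsE; apply/asboolP.
  by split=> //; apply: nzprime_prime.
have m0 : (0 < m)%N by rewrite muln_gt0 c0.
have IEm : IE = J ^^+ m.
  apply: (ival_inj dedE zIE (ideal_exp_nzideal m zJ)) => N nN.
  by rewrite ival_exp // IE_val // qs_val.
exists E, f, J, m; split; last split; last split.
- split=> //.
  + split=> //; first exact: ic_integralRange.
      exact: (ext_finite dedD mp irr_p sep_p pz gen_z).
    exact: (ext_separable sep_p pz gen_z).
  + split=> // x n Jxn N Nqs; apply: contrapT => Nx.
    exact: (prime_ideal_exp (nzprime_prime (nqs N Nqs)) Nx (Jxn N Nqs)).
- split.
  + apply: radical_projectively_full => // N nN.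
    by rewrite qs_val //; case: (_ \in _).
  + split=> //; exists m, 1%N; split=> //.
    by rewrite ideal_exp1 // -/IE IEm.
  + apply: dedekind_rees_integers => // N nN sJN; rewrite qs_val //.
    have : (0 < ival N J)%N by apply/(ival_gt0 dedE nN zJ).
    by rewrite qs_val //; case: (_ \in _).
- move=> N mN sIN; apply: residue_map_bijective => y.
  have pN : prime_ideal [set` N] := maximal_prime mN.
  have s : IE `<=` [set` N].
    by apply/sIE; [case: mN | move=> x Ix; apply: sIN; exists x].
  have nN := nzN _ pN s; have [Pps oN] := over _ nN s.
  have [_ /(_ y)[t tP]] := (splitP _ Pps).1 _ oN.
  by exists t.
- exists d; last by rewrite dvdn_mull.
  have := ext_degree mp irr_p pz gen_z; rewrite sp; exact.
Qed.
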